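(* Let $m=n+\delta$ with $n>1$ a positive integer and $0<\delta<1$. Then there exists a constant $C>0$ such that, for all $t>0$ and all $v_0\in L^2(\mathbb{R})\cap L^1(\mathbb{R};1+|x|^2)$, $$\Big\|S(t)v_0-\sum_{\alpha=0}^1\mathcal{M}_\alpha(v_0)\,\partial_x^\alpha G_m(t)-t\,\mathcal{M}_0(v_0)\,(\partial_xM)G_m(t)\Big\|_2$$ $$\le C\Big[t^{-\frac2m-\frac1{2m}}\|v_0\|_1+t^{-\frac2m-\frac1{2m}}\sum_{r=1}^2\big\||x|^rv_0\big\|_1+t^{-1-\frac1{2m}}\Big(\sum_{r=0}^1\frac{t^{-r/m}}{r!}\Big)\|v_0\|_1+e^{-t/2}\|v_0\|_2$$ $$\qquad+e^{-t/2}t^{-\frac1{2m}}\Big(\sum_{r=0}^1\frac{t^{-r/m}}{r!}\Big)\|v_0\|_1+\mathcal{M}_0(v_0)\,t^{-\frac2m-\frac1{2m}}\big\||x|K_m\big\|_1\Big].$$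
   Context: $\|\cdot\|_p$ is the $L^p(\mathbb{R})$ norm; $\widehat f(\xi)=\int_{\mathbb{R}}e^{-ix\xi}f(x)\,dx$. $L^1(\mathbb{R};1+|x|^k)$ is the space of functions integrable against the weight $1+|x|^k$. $M$ is the Fourier multiplier operator $\widehat{Mf}(\xi)=|\xi|^m\widehat f(\xi)$; thus $\partial_xM$ has symbol $i\xi|\xi|^m$. $S(t)$ is the solution operator of the linear equation $v_t+Mv_t+Mv-Mv_x=0$, $v(x,0)=v_0(x)$ ($x\in\mathbb{R}$, $t>0$), i.e. $$S(t)v_0(x)=\frac1{2\pi}\int_{\mathbb{R}}e^{-t\Phi(\xi)+ix\xi}\,\widehat{v_0}(\xi)\,d\xi,\qquad \Phi(\xi)=\frac{|\xi|^m-i\xi|\xi|^m}{1+|\xi|^m}.$$ $G_m(x,t)=\frac1{2\pi}\int_{\mathbb{R}}e^{ix\xi-t|\xi|^m}\,d\xi$ and $G_m(t)=G_m(\cdot,t)$. $K_m$ is defined by $\widehat{K_m}(\xi)=1/(1+|\xi|^m)$. $\mathcal{M}_\alpha(v_0)=\frac{(-1)^\alpha}{\alpha!}\int_{\mathbb{R}}x^\alpha v_0(x)\,dx$.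
   Formalization: In the last term M_0(v_0) is replaced by |M_0(v_0)|: with the signed moment the bound fails for some m (when || |x|K_m ||_1 > 1), e.g. v_0 minus a narrow unit bump and t large, where the right side becomes negative. *)

(* Defs.v *)
From HB Require Import structures.
From mathcomp Require Import all_boot all_order all_algebra.
From mathcomp Require Import all_classical all_reals all_analysis.
From mathcomp Require Export complex.
Set Implicit Arguments.
Unset Strict Implicit.
Unset Printing Implicit Defensive.
Import Order.TTheory GRing.Theory Num.Theory.
Import numFieldNormedType.Exports.
Local Open Scope classical_set_scope.
Local Open Scope ring_scope.
Local Open Scope complex_scope.

(* Functions on the line are total functions R -> R[i]; they are integrated
   and differentiated componentwise. *)

Section ComplexValued.
Context {R : realType}.
Implicit Types (f : R -> R[i]) (D : set R).

Definition cmeasurable f : Prop :=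
  measurable_fun setT (fun x => complex.Re (f x)) /\
  measurable_fun setT (fun x => complex.Im (f x)).

Definition cintegral D f : R[i] :=
  (\int[lebesgue_measure]_(x in D) complex.Re (f x)) +i*
  (\int[lebesgue_measure]_(x in D) complex.Im (f x)).

Definition cderive (k : nat) f (x : R) : R[i] :=
  derive1n k (fun y => complex.Re (f y)) x +i*
  derive1n k (fun y => complex.Im (f y)) x.

Definition cexp (z : R[i]) : R[i] :=
  (expR (complex.Re z) * cos (complex.Im z)) +i*
  (expR (complex.Re z) * sin (complex.Im z)).

Definition LpNorm (p : \bar R) f : \bar R :=
  Lnorm lebesgue_measure p (fun x => (Normc.normc (f x))%:E).

Definition inL2 f : Prop := cmeasurable f /\ (LpNorm 2%:E f < +oo)%E.

(* L^1(R; 1 + |x|^k) *)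
Definition inL1_weight (k : nat) f : Prop :=
  cmeasurable f /\
  (\int[lebesgue_measure]_x ((1 + `|x| ^+ k) * Normc.normc (f x))%:E < +oo)%E.

Definition absx_pow (k : nat) f (x : R) : R[i] := (`|x| ^+ k)%:C * f x.

End ComplexValued.

Section Fourier.
Context {R : realType}.
Implicit Types (f g w : R -> R[i]).

Definition fourier f (xi : R) : R[i] :=
  cintegral setT (fun x => cexp (0 +i* (- (x * xi))) * f x).

Definition inv_fourier_on (D : set R) g (x : R) : R[i] :=
  ((2 * pi)^-1)%:C * cintegral D (fun xi => cexp (0 +i* (x * xi)) * g xi).

(* [w] is the inverse Fourier transform of [g] in the sense of Plancherel:
   the L^2 limit, as N -> +oo, of the integrals of [g] over [-N, N]. *)
Definition is_inv_fourier2 g w : Prop :=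
  cmeasurable w /\
  LpNorm 2%:E (fun x => w x - inv_fourier_on `[- N, N] g x) @[N --> +oo%R]
    --> 0%E.

(* The limit is unique up to a null set; a representative is chosen (the
   value is 0 when there is no limit). *)
Definition inv_fourier2 g : R -> R[i] :=
  xget (fun _ => 0) [set w | is_inv_fourier2 g w].

Definition fourier_multiplier (sigma : R -> R[i]) f : R -> R[i] :=
  inv_fourier2 (fun xi => sigma xi * fourier f xi).

End Fourier.

Section Equation.
Context {R : realType}.
Implicit Types (m t x xi : R) (v : R -> R[i]).

Definition Phi m xi : R[i] :=
  ((`|xi| `^ m) +i* (- (xi * `|xi| `^ m))) / (1 + `|xi| `^ m)%:C.

(* For v in L^1 and L^2 the symbol exp(-t Phi) does not decay, so the defining
   integral over the line converges in L^2 but in general not absolutely. *)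
Definition solution_op m t v : R -> R[i] :=
  fourier_multiplier (fun xi => cexp (- (t%:C * Phi m xi))) v.

(* The operator d/dx M, of symbol i xi |xi|^m. *)
Definition dxM m (f : R -> R[i]) : R -> R[i] :=
  fourier_multiplier (fun xi => 0 +i* (xi * `|xi| `^ m)) f.

Definition G m t x : R[i] :=
  inv_fourier_on setT (fun xi => (expR (- (t * `|xi| `^ m)))%:C) x.

(* The function with Fourier transform 1 / (1 + |xi|^m), which is integrable
   when m > 1. *)
Definition K m x : R[i] :=
  inv_fourier_on setT (fun xi => ((1 + `|xi| `^ m)^-1)%:C) x.

Definition moment (a : nat) v : R[i] :=
  ((-1) ^+ a / a`!%:R)%:C * cintegral setT (fun x => (x ^+ a)%:C * v x).

End Equation.

(* Main.v *)
Require Import Defs.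
From HB Require Import structures.
From mathcomp Require Import all_boot all_order all_algebra.
From mathcomp Require Import all_classical all_reals all_analysis.
From mathcomp Require Import measurable_realfun ring lra.
Set Implicit Arguments.
Unset Strict Implicit.
Unset Printing Implicit Defensive.
Import Order.TTheory GRing.Theory Num.Theory.
Import numFieldNormedType.Exports.
Local Open Scope ring_scope.
Local Open Scope complex_scope.

(* By Plancherel it suffices to bound in L^2 the Fourier transform of the
   difference, which is
     exp(-t Phi) v^ - exp(-t |xi|^m) (M_0 + i xi M_1 + i t xi |xi|^m M_0).
   For |xi| <= 1, Phi = |xi|^m - i xi |xi|^m + O(|xi|^(2m)), and v^ differs from
   M_0 and from M_0 + i xi M_1 by O(|xi| ||x v||_1) and O(xi^2 ||x^2 v||_1), so
   in the variable t^(1/m) xi the difference is a rapidly decaying profile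
   times the stated powers of t. For |xi| > 1 both exp(-t Phi) and the heat
   symbol are at most exp(-t/2). Only the inequality in Plancherel is needed,
   up to a constant: it follows from Abel summation and the Schur test for the
   Poisson kernel. The L^2 limits defining the multipliers exist by
   Riesz-Fischer, which makes the chosen representatives genuine. *)

(** * Integrable real functions on the line *)

Section RealIntegrals.
Local Open Scope classical_set_scope.
Context {R : realType}.
Implicit Types (a b f g h F : R -> R) (u x y xi e M : R).
Local Notation mu := (@lebesgue_measure R).
Local Notation L1 f := (mu.-integrable setT (EFin \o (f : R -> R))).

(** Two features of the definitions shape the proof. [dxM] reads its argument through the Fourier
    integral of [G m t], so the heat symbol has to be recovered by pointwise inversion, and for that
    [G m t] must itself be integrable. Since |xi|^m need not be smooth at the origin, decay of the
    kernel is obtained only in mean: one integration by parts shows that x G is square integrable,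
    and together with G in L^2 this gives G in L^1. Moreover, [solution_op] and [dxM] are chosen
    representatives of L^2 limits. The working notion is therefore the relation of being an L^2
    limit of truncated inverse transforms: it is linear and it carries an energy bound, so the
    pieces of the difference are combined on the transform side and estimated once. The count of
    powers there is uniform: each factor xi is worth t^(-1/m), each uncompensated factor |xi|^m is
    worth t^-1, and taking the L^2 norm in xi contributes the common t^(-1/(2m)). *)

Lemma integrable_measurable f : L1 f -> measurable_fun setT f.
Proof. by move=> /measurable_int /measurable_EFinP. Qed.

Lemma le_L1 f g : measurable_fun setT f -> (forall x, `|f x| <= g x) ->
  L1 g -> L1 f.
Proof.
move=> mf fg; apply: le_integrable => //; first exact/measurable_EFinP.
by move=> x _ /=; rewrite lee_fin (le_trans (fg x))// ler_norm.
Qed.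

Lemma integrableMb f h M : L1 f -> measurable_fun setT h ->
  (forall x, `|h x| <= M) -> L1 (fun x => f x * h x).
Proof.
move=> fi mh hM; apply: (@le_L1 _ (fun x => `|M| * `|f x|)).
- by apply: measurable_funM => //; exact: integrable_measurable.
- move=> x; rewrite normrM mulrC ler_wpM2r// (le_trans (hM x))// ler_norm//.
- have := @integrableZl _ _ _ mu setT measurableT `|M| _ (integrable_norm fi).
  by apply: eq_integrable.
Qed.

Lemma L1Z (k : R) f : L1 f -> L1 (fun x => k * f x).
Proof.
move=> fi; have := @integrableZl _ _ _ mu setT measurableT k _ fi.
by apply: eq_integrable.
Qed.

Lemma L1Zr (k : R) f : L1 f -> L1 (fun x => f x * k).
Proof.
move=> fi; have := @integrableZr _ _ _ mu setT measurableT k _ fi.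
by apply: eq_integrable.
Qed.

Lemma L1D f g : L1 f -> L1 g -> L1 (fun x => f x + g x).
Proof.
move=> fi gi; have := @integrableD _ _ _ mu setT measurableT _ _ fi gi.
by apply: eq_integrable.
Qed.

Lemma L1B f g : L1 f -> L1 g -> L1 (fun x => f x - g x).
Proof.
move=> fi gi; have := @integrableB _ _ _ mu setT measurableT _ _ fi gi.
by apply: eq_integrable.
Qed.

Lemma L1_norm f : L1 f -> L1 (fun x => `|f x|).
Proof. by move=> fi; exact: integrable_norm fi. Qed.

(** * Cosine and sine transforms *)

Lemma continuous_cosM x : continuous (fun y => cos (x * y) : R).
Proof.
move=> y; apply: (@continuous_comp _ _ _ (fun y => x * y) cos).
  exact: mulrl_continuous.
exact: continuous_cos.
Qed.

Lemma continuous_sinM x : continuous (fun y => sin (x * y) : R).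
Proof.
move=> y; apply: (@continuous_comp _ _ _ (fun y => x * y) sin).
  exact: mulrl_continuous.
exact: continuous_sin.
Qed.

Lemma measurable_cosM x : measurable_fun setT (fun y => cos (x * y) : R).
Proof. exact: continuous_measurable_fun (@continuous_cosM x). Qed.

Lemma measurable_sinM x : measurable_fun setT (fun y => sin (x * y) : R).
Proof. exact: continuous_measurable_fun (@continuous_sinM x). Qed.

(** One pair of real transforms serves both signs of the exponent: passing from e^(i x xi) to e^(-i
    x xi) only flips the sine part, which is the parameter [s] of [transform]. *)
Definition cosT a xi : R := \int[mu]_x (a x * cos (x * xi)).
Definition sinT a xi : R := \int[mu]_x (a x * sin (x * xi)).

Lemma L1_cos a xi : L1 a -> L1 (fun x => a x * cos (x * xi)).
Proof.
move=> ai; apply: (integrableMb (M := 1)) => //.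
  by under eq_fun do rewrite mulrC; exact: measurable_cosM.
by move=> x; exact: cos_max.
Qed.

Lemma L1_sin a xi : L1 a -> L1 (fun x => a x * sin (x * xi)).
Proof.
move=> ai; apply: (integrableMb (M := 1)) => //.
  by under eq_fun do rewrite mulrC; exact: measurable_sinM.
by move=> x; exact: sin_max.
Qed.

Lemma continuous_param (k : R -> R -> R) a : L1 a ->
  (forall y, measurable_fun setT (k^~ y)) -> (forall x, continuous (k x)) ->
  (forall x y, `|k x y| <= 1) ->
  continuous (fun y => \int[mu]_x (a x * k x y)).
Proof.
move=> ai mk ck k1 y.
have := @continuity_under_integral R _ _ mu (fun y x => a x * k x y) setT
  measurableT (y - 1) (y + 1).
move=> /(_ _ _ (fun x => `|a x|)); apply => //.
- by move=> z _; apply: (integrableMb (M := 1)).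
- apply: aeW => x _ z _; apply: continuousM => //; first exact: cst_continuous.
  exact: ck.
- exact: L1_norm.
- by move=> z _; apply: aeW => x _; rewrite normrM ler_piMr.
- by rewrite inE/= in_itv/= ltrBlDr ltrDl ltr01.
Qed.

Lemma continuous_cosT a : L1 a -> continuous (cosT a).
Proof.
move=> ai; apply: (continuous_param (k := fun x y => cos (x * y))) => //.
- by move=> y; under eq_fun do rewrite mulrC; exact: measurable_cosM.
- by move=> x; exact: continuous_cosM.
- by move=> x y; exact: cos_max.
Qed.

Lemma continuous_sinT a : L1 a -> continuous (sinT a).
Proof.
move=> ai; apply: (continuous_param (k := fun x y => sin (x * y))) => //.
- by move=> y; under eq_fun do rewrite mulrC; exact: measurable_sinM.
- by move=> x; exact: continuous_sinM.
- by move=> x y; exact: sin_max.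
Qed.

Lemma norm_integral_mul_le a h M : L1 a -> measurable_fun setT h ->
  (forall x, `|h x| <= M) -> `|\int[mu]_x (a x * h x)| <= M * \int[mu]_x `|a x|.
Proof.
move=> ai mh hM; have aih := integrableMb ai mh hM.
apply: (le_trans (le_normr_Rintegral _ aih)) => //.
rewrite -RintegralZl//; last exact: L1_norm.
apply: le_Rintegral => //; [exact: L1_norm|exact/L1Z/L1_norm|].
by move=> x _; rewrite normrM mulrC ler_wpM2r.
Qed.

Lemma norm_cosT_le a xi : L1 a -> `|cosT a xi| <= \int[mu]_x `|a x|.
Proof.
move=> ai; rewrite -[leRHS]mul1r; apply: norm_integral_mul_le => //.
  by under eq_fun do rewrite mulrC; exact: measurable_cosM.
by move=> x; exact: cos_max.
Qed.

Lemma norm_sinT_le a xi : L1 a -> `|sinT a xi| <= \int[mu]_x `|a x|.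
Proof.
move=> ai; rewrite -[leRHS]mul1r; apply: norm_integral_mul_le => //.
  by under eq_fun do rewrite mulrC; exact: measurable_sinM.
by move=> x; exact: sin_max.
Qed.

Lemma dominated_cvg_Rintegral (f_ : nat -> R -> R) f g :
  (forall n, measurable_fun setT (f_ n)) -> measurable_fun setT f ->
  (forall x, f_ n x @[n --> \oo] --> f x) ->
  (forall n x, `|f_ n x| <= g x) -> L1 g ->
  \int[mu]_x f_ n x @[n --> \oo] --> \int[mu]_x f x.
Proof.
move=> mf_ mf ff fg gi.
have [| | | | |fi _ h] := @dominated_convergence _ _ _ mu setT measurableT
  (fun n => EFin \o f_ n) (EFin \o f) (EFin \o g).
- by move=> n; apply/measurable_EFinP; exact: mf_.
- by apply/measurable_EFinP; exact: mf.
- by apply: aeW => x _ /=; apply: cvg_EFin; [exact: nearW|exact: ff].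
- exact: gi.
- by apply: aeW => x n _ /=; rewrite lee_fin.
apply: fine_cvg; rewrite fineK; first exact: h.
exact: integrable_fin_num.
Qed.

Lemma measurable_restrictT f (D : set R) : measurable D ->
  measurable_fun setT f -> measurable_fun setT (f \_ D).
Proof.
move=> mD mf; apply/(measurable_restrictT f mD).
exact: measurable_funTS.
Qed.

(** * Integrals over half-lines and parity *)

Lemma cvg_Rintegral_itv f : L1 f ->
  \int[mu]_(x in `[0, n.+1%:R]) f x @[n --> \oo]
    --> \int[mu]_(x in `[0, +oo[) f x.
Proof.
move=> fi.
have mf := integrable_measurable fi.
rewrite Rintegral_mkcond; under eq_fun do rewrite Rintegral_mkcond.
apply: (@dominated_cvg_Rintegral _ _ (fun x => `|f x|)).
- by move=> n; exact: measurable_restrictT.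
- exact: measurable_restrictT.
- move=> x.
  apply: cvg_near_cst.
  near=> n; rewrite /= !patchE.
  suff -> : (x \in `[0%R, +oo[%classic) = (x \in `[0%R, n.+1%:R]%classic) by [].
  apply/idP/idP; rewrite !inE/= !in_itv/= andbT; last by case/andP.
  move=> ->/=; rewrite (@le_trans _ _ n%:R)// ?ler_nat//.
  by near: n; exact: nbhs_infty_ger.
- by move=> n x; rewrite patchE; case: ifP => // _; rewrite normr0.
- exact: L1_norm.
Unshelve. all: by end_near. Qed.

(** Limit of the fundamental theorem on [0, n + 1], an interval that is never degenerate.
    Differentiability is asked for x > 0 only, because the primitives to come involve |x|. *)
Lemma integral_itvcy_FTC f F l : L1 f -> continuous f -> continuous F ->
  (forall x, 0 < x -> is_derive x 1 F (f x)) -> F x @[x --> +oo] --> l ->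
  \int[mu]_(x in `[0, +oo[) f x = l - F 0.
Proof.
move=> fi cf cF dF Fl.
have h := cvg_Rintegral_itv fi.
apply: (cvg_unique _ h) => //.
have -> : (fun n => \int[mu]_(x in `[0, n.+1%:R]) f x) =
    (fun n : nat => F n.+1%:R - F 0).
  apply/funext => n; rewrite /Rintegral (@continuous_FTC2 _ f F)//.
  - exact: continuous_subspaceT.
  - split; first by move=> x; rewrite in_itv/= => /andP[x0 _]; have [] := dF _ x0.
      exact/cvg_at_right_filter/cF.
    exact/cvg_at_left_filter/cF.
  - move=> x; rewrite in_itv/= => /andP[x0 _]; rewrite derive1E.
    by have [_ ->] := dF _ x0.
apply: cvgB; last exact: cvg_cst.
apply: (cvg_comp (fun n : nat => n.+1%:R) F _ Fl).
have := @cvgr_idn R; rewrite -cvg_shiftS.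
exact.
Qed.

(** The reflection x -> -x is a substitution for nonnegative integrands, so [f] is written as (f +
    |f|) - |f| and each part is reflected separately. *)
Lemma Rintegral_split f : continuous f -> L1 f ->
  \int[mu]_x f x = \int[mu]_(x in `[0, +oo[) f x + \int[mu]_(x in `[0, +oo[) f (- x).
Proof.
move=> cf fi.
have ge0 g : continuous g -> (forall x, 0 <= g x) -> L1 g ->
  \int[mu]_(x in `]-oo, 0]) g x = \int[mu]_(x in `[0, +oo[) g (- x) /\
  mu.-integrable `[0, +oo[ (EFin \o (fun x => g (- x))).
  move=> cg g0 gi.
  have cgN : continuous (fun x => g (- x)).
    by move=> x; apply: continuous_comp; [exact: opp_continuous|exact: cg].
  have := @ge0_integration_by_substitutionNy R g 0; rewrite oppr0 => e.
  have {}e : (\int[mu]_(x in `]-oo, 0%R]) (g x)%:E =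
      \int[mu]_(x in `[0%R, +oo[) (g (- x))%:E)%E.
    apply: e; first exact: continuous_subspaceT.
    by move=> x _; exact: g0.
  split; first by rewrite /Rintegral e.
  apply/integrableP; split.
    apply/measurable_EFinP; apply: measurable_funTS.
    exact: continuous_measurable_fun.
  under eq_integral do rewrite /= ger0_norm//.
  rewrite -e.
  have /integrableP[_] : mu.-integrable `]-oo, 0] (EFin \o g).
    by apply: integrableS gi.
  by under eq_integral do rewrite /= ger0_norm//.
have cn : continuous (fun x => `|f x|).
  by move=> x; apply: continuous_comp; [exact: cf|exact: norm_continuous].
have cfn : continuous (fun x => f x + `|f x|).
  by move=> x; exact: (continuousD (cf x) (cn x)).
have [e1 i1] := ge0 _ cn (fun x => normr_ge0 _) (L1_norm fi).
have [|e2 i2] := ge0 _ cfn _ (L1D fi (L1_norm fi)).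
  by move=> x; rewrite -lerBlDl sub0r -normrN ler_norm.
have -> : [set: R] = `[0, +oo[ `|` `]-oo, 0[.
  by rewrite -setCitvr setUv.
rewrite Rintegral_setU//; last 2 first.
- by rewrite -setCitvr setUv.
- by rewrite -setCitvr; exact/disj_setPCl.
congr +%R.
rewrite Rintegral_itv_bndo_bndc//; last exact: integrableS fi.
transitivity (\int[mu]_(x in `]-oo, 0]) ((f x + `|f x|) - `|f x|)).
  by apply: eq_Rintegral => x _; rewrite addrK.
rewrite RintegralB//; [|exact: integrableS (L1D fi (L1_norm fi))|exact: integrableS (L1_norm fi)].
rewrite e1 e2 -RintegralB//.
by apply: eq_Rintegral => x _; rewrite addrK.
Qed.

Lemma continuous_integral_odd f : continuous f -> L1 f ->
  (forall x, f (- x) = - f x) -> \int[mu]_x f x = 0.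
Proof.
move=> cf fi fN; rewrite Rintegral_split//.
under [X in _ + X]eq_Rintegral do rewrite fN -mulN1r.
rewrite RintegralZl//; last exact: integrableS fi.
by rewrite mulN1r subrr.
Qed.

Lemma continuous_integral_even f : continuous f -> L1 f ->
  (forall x, f (- x) = f x) ->
  \int[mu]_x f x = 2 * \int[mu]_(x in `[0, +oo[) f x.
Proof.
move=> cf fi fN; rewrite Rintegral_split//.
under [X in _ + X]eq_Rintegral do rewrite fN.
by rewrite mulr2n mulrDl mul1r.
Qed.

(** * Abel damping and the Poisson kernel *)

Definition abel e x : R := expR (- (e * `|x|)).

Lemma continuous_abel e : continuous (abel e).
Proof.
move=> x; apply: continuous_comp; last exact: continuous_expR.
apply: continuousN; apply: continuousM; first exact: cst_continuous.
exact: norm_continuous.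
Qed.

Lemma measurable_abel e : measurable_fun setT (abel e).
Proof. exact: continuous_measurable_fun (@continuous_abel e). Qed.

Lemma abel_ge0 e x : 0 <= abel e x. Proof. exact: expR_ge0. Qed.

Lemma abel_le1 e x : 0 <= e -> abel e x <= 1.
Proof. by move=> e0; rewrite /abel expR_le1 oppr_le0 mulr_ge0. Qed.

Lemma norm_abelM_le e x (v c : R) : 0 <= e -> `|c| <= 1 ->
  `|abel e x * v * c| <= `|v|.
Proof.
move=> e0 c1; rewrite !normrM (ger0_norm (abel_ge0 _ _)).
apply: le_trans (ler_piMr _ c1) _; first by rewrite mulr_ge0 ?abel_ge0.
by rewrite ler_piMl// abel_le1.
Qed.

Lemma abelN e x : abel e (- x) = abel e x.
Proof. by rewrite /abel normrN. Qed.

Lemma cvgr_expRM e : 0 < e -> expR (- (e * x)) @[x --> +oo%R] --> (0 : R).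
Proof.
move=> e0; apply: (cvg_comp (fun x => e * x) (fun x => expR (- x))); last exact: cvgr_expR.
exact: gt0_cvgMry.
Qed.

Lemma is_derive_cosM u x :
  is_derive x 1 (fun x : R => cos (u * x)) (- (u * sin (u * x))).
Proof.
have h : is_derive x 1 (fun x : R => u * x) u.
  have := @is_deriveZ _ _ _ id u x 1 1 (is_derive_id _ _).
  by move=> ?; apply: is_derive_eq; rewrite /GRing.scale/= mulr1.
have := @is_derive1_comp _ cos (fun x => u * x) x _ _ (is_derive_cos _) h.
by move=> ?; apply: is_derive_eq; rewrite mulNr mulrC.
Qed.

Lemma is_derive_sinM u x :
  is_derive x 1 (fun x : R => sin (u * x)) (u * cos (u * x)).
Proof.
have h : is_derive x 1 (fun x : R => u * x) u.
  have := @is_deriveZ _ _ _ id u x 1 1 (is_derive_id _ _).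
  by move=> ?; apply: is_derive_eq; rewrite /GRing.scale/= mulr1.
have := @is_derive1_comp _ sin (fun x => u * x) x _ _ (is_derive_sin _) h.
by move=> ?; apply: is_derive_eq; rewrite mulrC.
Qed.

Lemma is_derive_mul f g x df dg : is_derive x 1 f df -> is_derive x 1 g dg ->
  is_derive x 1 (fun x => f x * g x) (f x * dg + g x * df).
Proof. by move=> hf hg; have := is_deriveM hf hg. Qed.

Lemma is_derive_scale (k : R) f x df : is_derive x 1 f df ->
  is_derive x 1 (fun x => k * f x) (k * df).
Proof. by move=> hf; have := is_deriveZ k hf. Qed.

Lemma is_derive_continuous f df : (forall x, is_derive x 1 f (df x)) -> continuous f.
Proof.
move=> h x; apply/differentiable_continuous/derivable1_diffP.
by have [] := h x.
Qed.

Lemma L1_abel e : 0 < e -> L1 (abel e).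
Proof.
move=> e0; apply/integrableP; split.
  by apply/measurable_EFinP; exact: continuous_measurable_fun (@continuous_abel e).
under eq_integral do rewrite /= ger0_norm ?abel_ge0//.
rewrite ge0_symfun_integralT; [|exact: abel_ge0|exact: continuous_abel|]; last first.
  by move=> x /=; rewrite abelN.
rewrite -set_itvcy.
have dF x : is_derive x 1 (fun x => - e^-1 * expR (- e * x)) (expR (- e * x)).
  by apply: is_derive_eq; rewrite /GRing.scale/=; field; rewrite gt_eqF.
have cF := is_derive_continuous dF.
rewrite (@ge0_continuous_FTC2y _ _ (fun x => - e^-1 * expR (- e * x)) 0 0)//.
- by rewrite -EFinB -EFinM ltry.
- by move=> x _; exact: abel_ge0.
- apply: continuous_subspaceT; exact: continuous_abel.
- rewrite -(mulr0 (- e^-1)); apply: cvgMr.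
  by under eq_fun do rewrite mulNr; exact: cvgr_expRM.
- exact/cvg_at_right_filter/cF.
- move=> x; rewrite in_itv/= andbT => x0; rewrite derive1E.
  by have [_ ->] := dF x; rewrite /abel gtr0_norm// mulNr.
Qed.

(** By evenness the integral is twice the one over [0, +oo[, where e^(-e x) (u sin(u x) - e cos(u
    x)) / (e^2 + u^2) is an explicit primitive that vanishes at infinity. *)
Lemma integral_abel_cos e u : 0 < e ->
  \int[mu]_x (abel e x * cos (u * x)) = 2 * e / (e ^+ 2 + u ^+ 2).
Proof.
move=> e0.
have eu : e ^+ 2 + u ^+ 2 != 0.
  by rewrite gt_eqF// ltr_pwDl ?exprn_gt0// sqr_ge0.
have ci : continuous (fun x => abel e x * cos (u * x)).
  by move=> x; exact: (continuousM (@continuous_abel e x) (@continuous_cosM u x)).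
have ii : L1 (fun x => abel e x * cos (u * x)).
  have := L1_cos u (L1_abel e0); congr (_.-integrable _ _).
  by apply/funext => x /=; rewrite (mulrC x).
rewrite continuous_integral_even//; last first.
  by move=> x; rewrite abelN mulrN cosN.
have dF x : is_derive x 1 (fun x => expR (- e * x) *
    ((e ^+ 2 + u ^+ 2)^-1 * (u * sin (u * x) - e * cos (u * x))))
    (expR (- e * x) * cos (u * x)).
  by apply: is_derive_eq; rewrite /GRing.scale/=; field.
have cF := is_derive_continuous dF.
have dF' x : 0 < x -> is_derive x 1 (fun x => expR (- e * x) *
    ((e ^+ 2 + u ^+ 2)^-1 * (u * sin (u * x) - e * cos (u * x))))
    (abel e x * cos (u * x)).
  by move=> x0; apply: is_derive_eq (dF x) _; rewrite /abel gtr0_norm// mulNr.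
rewrite (@integral_itvcy_FTC _ _ 0 ii ci cF dF').
- by rewrite !mulr0 expR0 sin0 cos0; field.
- apply: (@squeeze_cvgr _ _ _ _
    (fun x => - ((`|u| + e) / (e ^+ 2 + u ^+ 2) * expR (- (e * x))))
    (fun x => (`|u| + e) / (e ^+ 2 + u ^+ 2) * expR (- (e * x)))).
  + apply: nearW => x; rewrite -ler_norml normrM ger0_norm ?expR_ge0// mulNr.
    have inv0 : 0 <= (e ^+ 2 + u ^+ 2)^-1 by rewrite invr_ge0 addr_ge0// sqr_ge0.
    rewrite mulrC ler_wpM2r ?expR_ge0// normrM mulrC (ger0_norm inv0).
    rewrite ler_wpM2r//.
    rewrite (le_trans (ler_normB _ _))// lerD// normrM ?(gtr0_norm e0).
      by rewrite ler_piMr// sin_max.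
    by rewrite (ler_piMr (ltW e0))// cos_max.
  + rewrite -[X in _ --> X]oppr0; apply: cvgN.
    rewrite -(mulr0 ((`|u| + e) / (e ^+ 2 + u ^+ 2))).
    by apply: cvgMr; exact: cvgr_expRM.
  + rewrite -(mulr0 ((`|u| + e) / (e ^+ 2 + u ^+ 2))).
    by apply: cvgMr; exact: cvgr_expRM.
Qed.

Lemma integral_abel_sin e u : 0 < e ->
  \int[mu]_x (abel e x * sin (u * x)) = 0.
Proof.
move=> e0; apply: continuous_integral_odd.
- by move=> x; exact: (continuousM (@continuous_abel e x) (@continuous_sinM u x)).
- have := L1_sin u (L1_abel e0); congr (_.-integrable _ _).
  by apply/funext => x /=; rewrite (mulrC x).
- by move=> x; rewrite abelN mulrN sinN mulrN.
Qed.

(** The Poisson kernel of the upper half-plane at height [e], multiplied by 2 pi: in this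
    normalisation it is exactly the Fourier transform of [abel e]. *)
Definition poisson e u : R := 2 * e / (e ^+ 2 + u ^+ 2).

Lemma poisson_ge0 e u : 0 < e -> 0 <= poisson e u.
Proof.
by move=> e0; rewrite divr_ge0// ?addr_ge0 ?sqr_ge0// mulr_ge0// ltW.
Qed.

Lemma continuous_poisson e : 0 < e -> continuous (poisson e).
Proof.
move=> e0 u; apply: cvgM; first exact: cvg_cst.
apply: cvgV; first by rewrite gt_eqF// ltr_pwDl ?exprn_gt0// sqr_ge0.
by apply: cvgD; [exact: cvg_cst|exact: exprn_continuous].
Qed.

Lemma integral_poisson1 : (\int[mu]_u (poisson 1 u)%:E = (2 * pi)%:E)%E.
Proof.
rewrite ge0_symfun_integralT.
- rewrite -set_itvcy (@ge0_continuous_FTC2y _ _ (fun x => 2 * atan x) 0 pi).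
  + by rewrite atan0 mulr0 sube0.
  + by move=> x _; exact: poisson_ge0.
  + by apply: continuous_subspaceT; exact: continuous_poisson.
  + rewrite [X in _ --> X](_ : _ = 2 * (pi / 2)); last by field.
    apply: cvgMr; exact: cvgy_atan.
  + by move=> x _; apply: derivableZ; exact: derivable_atan.
  + apply/cvg_at_right_filter; apply: cvgMr; exact: continuous_atan.
  + move=> x _; rewrite derive1E.
    have h : is_derive x 1 atan ((1 + x ^+ 2)^-1).
      apply: DeriveDef; first exact: derivable_atan.
      by rewrite -derive1E derive1_atan.
    have [_ ->] := is_derive_scale 2 h.
    by rewrite /poisson expr1n mulr1.
- by move=> u; exact: poisson_ge0.
- exact: continuous_poisson.
- by move=> u /=; rewrite /poisson sqrrN.
Qed.

(** The substitution x = e u + xi moves [e] from the kernel into the argument of [G]. The kernel is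
    then fixed, which is what dominated convergence as e -> 0 needs; a constant [G] gives the total
    mass. *)
Lemma integral_poisson_shift (G : R -> R) e xi : 0 < e -> continuous G ->
  (forall x, 0 <= G x) ->
  (\int[mu]_x (G x * poisson e (x - xi))%:E =
   \int[mu]_u (G (e * u + xi) * poisson 1 u)%:E)%E.
Proof.
move=> e0 cG G0.
have dF x : is_derive x 1 (fun u => e * u + xi) e.
  have h := is_deriveD (is_derive_scale e (is_derive_id x 1)) (is_derive_cst xi x 1).
  by apply: is_derive_eq; rewrite mulr1 addr0.
have dFE : (fun u => e * u + xi)^`()%classic = cst e.
  by apply/funext => u; rewrite derive1E; have [_ ->] := dF u.
have pe (u : R) : poisson e (e * u) * e = poisson 1 u.
  rewrite /poisson expr1n; field.
  by rewrite !gt_eqF// ltr_pwDl ?sqr_ge0// exprn_gt0.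
rewrite (@increasing_ge0_integration_by_substitutionT _ (fun u => e * u + xi)
  (fun x => G x * poisson e (x - xi))).
- apply: eq_integral => u _; rewrite /= dFE /= -mulrA; congr (_ * _)%:E.
  by rewrite mulrfctE addrK pe.
- by move=> x y xy; rewrite ltrD2r ltr_pM2l.
- by rewrite dFE; exact: cst_continuous.
- by rewrite dFE; exact: is_cvg_cst.
- by rewrite dFE; exact: is_cvg_cst.
- by move=> x; have [] := dF x.
- apply: (cvg_comp (fun u => e * u) (fun u => u + xi)); last exact: cvg_addrr_Ny.
  exact: gt0_cvgMrNy.
- apply: (cvg_comp (fun u => e * u) (fun u => u + xi)); last exact: cvg_addrr.
  exact: gt0_cvgMry.
- move=> x; apply: (@cvgM _ _ _ _ G); first exact: cG.
  apply: (@continuous_comp _ _ _ (fun x => x - xi)); last exact: continuous_poisson.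
  by apply: cvgB; [exact: cvg_id|exact: cvg_cst].
- by move=> x; rewrite mulr_ge0 ?poisson_ge0.
Qed.

Lemma integral_poisson e xi : 0 < e ->
  (\int[mu]_x (poisson e (x - xi))%:E = (2 * pi)%:E)%E.
Proof.
move=> e0; have := @integral_poisson_shift (cst 1) e xi e0.
under eq_integral do rewrite mul1r; move=> ->//; last exact: cst_continuous.
by under eq_integral do rewrite mul1r; exact: integral_poisson1.
Qed.

Lemma L1_poisson e xi : 0 < e -> L1 (fun x => poisson e (x - xi)).
Proof.
move=> e0; apply/integrableP; split.
  apply/measurable_EFinP; apply: continuous_measurable_fun => x.
  apply: (@continuous_comp _ _ _ (fun x => x - xi)); last exact: continuous_poisson.
  by apply: cvgB; [exact: cvg_id|exact: cvg_cst].
under eq_integral do rewrite /= ger0_norm ?poisson_ge0//.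
by rewrite integral_poisson// ltry.
Qed.

(** Fubini, with |a(x)| |h(y)| as integrable majorant on the plane. *)
Lemma Rintegral_swap a h (k : R -> R -> R) : L1 a -> L1 h ->
  measurable_fun setT (fun z : R * R => k z.1 z.2) ->
  (forall x y, `|k x y| <= 1) ->
  \int[mu]_x (a x * \int[mu]_y (h y * k x y)) =
  \int[mu]_y (h y * \int[mu]_x (a x * k x y)).
Proof.
move=> ai hi mk k1.
pose F (z : R * R) : \bar R := (a z.1 * (h z.2 * k z.1 z.2))%:E.
have ma := integrable_measurable ai; have mh := integrable_measurable hi.
have mF : measurable_fun setT F.
  apply/measurable_EFinP; apply: measurable_funM.
    exact: measurableT_comp ma _.
  by apply: measurable_funM => //; exact: measurableT_comp mh _.
have mk1 x : measurable_fun setT (k x).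
  exact: (measurableT_comp mk (measurable_pair1 x)).
have mk2 y : measurable_fun setT (k^~ y).
  exact: (measurableT_comp mk (measurable_pair2 y)).
have fa : (\int[mu]_x (`|a x|)%:E < +oo)%E by have /integrableP[] := ai.
have fh : (\int[mu]_x (`|h x|)%:E < +oo)%E by have /integrableP[] := hi.
have iF : (mu \x mu)%E.-integrable setT F.
  apply/integrable12ltyP => //.
  apply: (@le_lt_trans _ _ (\int[mu]_x \int[mu]_y (`|a x| * `|h y|)%:E)%E).
    apply: ge0_le_integral => //.
    - by move=> x _; apply: integral_ge0.
    - apply: (@measurable_fun_fubini_tonelli_F _ _ _ _ _ mu (fun z => `|F z|%E)) => //.
      exact: measurableT_comp.
    - apply: (@measurable_fun_fubini_tonelli_F _ _ _ _ _ mu (fun z : R * R => (`|a z.1| * `|h z.2|)%:E)) => //.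
      apply/measurable_EFinP; apply: measurable_funM; apply: measurableT_comp => //.
        exact: measurableT_comp ma _.
      exact: measurableT_comp mh _.
    - move=> x _; apply: ge0_le_integral => //.
      + apply: measurableT_comp => //.
        exact: (measurableT_comp mF (measurable_pair1 x)).
      + apply/measurable_EFinP; apply: measurable_funM => //.
        exact: measurableT_comp.
      + by move=> y _; rewrite lee_fin !normrM mulrA ler_piMr// mulr_ge0.
  under eq_integral => x _.
    under eq_integral do rewrite EFinM.
    rewrite ge0_integralZl//; last by apply/measurable_EFinP; exact: measurableT_comp.
    over.
  rewrite ge0_integralZr//; last 2 first.
  - by apply/measurable_EFinP; exact: measurableT_comp.
  - by apply: integral_ge0.
  rewrite lte_mul_pinfty//; first exact: integral_ge0.
  by rewrite ge0_fin_numE//; exact: integral_ge0.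
have inner1 x : (\int[mu]_y F (x, y) = (a x * \int[mu]_y (h y * k x y))%:E)%E.
  have hki := integrableMb hi (mk1 x) (k1 x).
  rewrite EFinM fineK; last exact: integrable_fin_num.
  by rewrite -integralZl//; apply: eq_integral => y _; rewrite -EFinM.
have inner2 y : (\int[mu]_x F (x, y) = (h y * \int[mu]_x (a x * k x y))%:E)%E.
  have aki := integrableMb ai (mk2 y) (k1^~ y).
  rewrite EFinM fineK; last exact: integrable_fin_num.
  by rewrite -integralZl//; apply: eq_integral => x _; rewrite -EFinM mulrCA.
rewrite /Rintegral; congr fine.
under eq_integral do rewrite -inner1.
rewrite Fubini//.
by apply: eq_integral => y _; exact: inner2.
Qed.

(** * Multiplication formula and damped inversion *)

Lemma measurable_cos_prod : measurable_fun setT (fun z : R * R => cos (z.1 * z.2)).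
Proof.
apply: measurableT_comp; first exact: continuous_measurable_fun (@continuous_cos R).
exact: measurable_funM.
Qed.

Lemma measurable_sin_prod : measurable_fun setT (fun z : R * R => sin (z.1 * z.2)).
Proof.
apply: measurableT_comp; first exact: continuous_measurable_fun (@continuous_sin R).
exact: measurable_funM.
Qed.

(** Both sides are the double integral of a(x) h(y) cos(x y): the multiplication formula, through
    which a transform is moved from one factor to the other. *)
Lemma cosT_sym a h : L1 a -> L1 h ->
  \int[mu]_x (a x * cosT h x) = \int[mu]_x (h x * cosT a x).
Proof.
move=> ai hi.
have /= <- := Rintegral_swap ai hi measurable_cos_prod (fun x y => cos_max (x * y)).
apply: eq_Rintegral => x _; congr *%R.
by apply: eq_Rintegral => y _; rewrite (mulrC x).
Qed.

Lemma sinT_sym a h : L1 a -> L1 h ->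
  \int[mu]_x (a x * sinT h x) = \int[mu]_x (h x * sinT a x).
Proof.
move=> ai hi.
have /= <- := Rintegral_swap ai hi measurable_sin_prod (fun x y => sin_max (x * y)).
apply: eq_Rintegral => x _; congr *%R.
by apply: eq_Rintegral => y _; rewrite (mulrC x).
Qed.

Lemma measurable_cosT a : L1 a -> measurable_fun setT (cosT a).
Proof. by move=> /continuous_cosT/continuous_measurable_fun. Qed.

Lemma measurable_sinT a : L1 a -> measurable_fun setT (sinT a).
Proof. by move=> /continuous_sinT/continuous_measurable_fun. Qed.

Lemma L1_mul_cosT h a : L1 h -> L1 a -> L1 (fun x => h x * cosT a x).
Proof.
move=> hi ai; apply: integrableMb => //; first exact: measurable_cosT.
by move=> x; exact: norm_cosT_le.
Qed.

Lemma L1_mul_sinT h a : L1 h -> L1 a -> L1 (fun x => h x * sinT a x).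
Proof.
move=> hi ai; apply: integrableMb => //; first exact: measurable_sinT.
by move=> x; exact: norm_sinT_le.
Qed.

(* Abel summation: damping by exp(-e|xi|) makes Fubini applicable, and the inner
   cosine integral is the Poisson kernel. *)
Lemma abel_inversion_cos a e x : L1 a -> 0 < e ->
  cosT (fun xi => abel e xi * cosT a xi) x +
  sinT (fun xi => abel e xi * sinT a xi) x =
  \int[mu]_y (a y * poisson e (y - x)).
Proof.
move=> ai e0; have ei := L1_abel e0.
rewrite /(cosT (fun _ => _)) /(sinT (fun _ => _)) -RintegralD//; last 2 first.
- exact/L1_cos/L1_mul_cosT.
- exact/L1_sin/L1_mul_sinT.
transitivity (\int[mu]_xi (abel e xi * \int[mu]_y (a y * cos (xi * (y - x))))).
  apply: eq_Rintegral => xi _; rewrite -!mulrA -mulrDr; congr *%R.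
  rewrite /cosT /sinT -!RintegralZr//; [|exact: L1_sin|exact: L1_cos].
  rewrite -RintegralD//.
  - apply: eq_Rintegral => y _; rewrite -!mulrA -mulrDr -cosB; congr (_ * cos _).
    by ring.
  - exact/L1Zr/L1_cos.
  - exact/L1Zr/L1_sin.
rewrite (@Rintegral_swap _ _ (fun xi y => cos (xi * (y - x))))//.
- apply: eq_Rintegral => y _; congr *%R.
  rewrite /poisson -integral_abel_cos//.
  by apply: eq_Rintegral => xi _; rewrite (mulrC xi).
- apply: measurableT_comp; first exact: continuous_measurable_fun (@continuous_cos R).
  by apply: measurable_funM => //; exact: measurable_funB.
- by move=> u v; exact: cos_max.
Qed.

(** The difference of the two sides is the imaginary part of the damped inversion. Its inner
    integral has the odd integrand [abel] times sine and vanishes. *)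
Lemma abel_inversion_sin a e x : L1 a -> 0 < e ->
  cosT (fun xi => abel e xi * sinT a xi) x =
  sinT (fun xi => abel e xi * cosT a xi) x.
Proof.
move=> ai e0; have ei := L1_abel e0.
apply/eqP; rewrite -subr_eq0; apply/eqP.
rewrite /(cosT (fun _ => _)) /(sinT (fun _ => _)) -RintegralB//; last 2 first.
- exact/L1_cos/L1_mul_sinT.
- exact/L1_sin/L1_mul_cosT.
transitivity (\int[mu]_xi (abel e xi * \int[mu]_y (a y * sin (xi * (y - x))))).
  apply: eq_Rintegral => xi _; rewrite -!mulrA -mulrBr; congr *%R.
  rewrite /cosT /sinT -!RintegralZr//; [|exact: L1_cos|exact: L1_sin].
  rewrite -RintegralB//.
  - apply: eq_Rintegral => y _; rewrite -!mulrA -mulrBr -sinB; congr (_ * sin _).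
    by ring.
  - exact/L1Zr/L1_sin.
  - exact/L1Zr/L1_cos.
rewrite (@Rintegral_swap _ _ (fun xi y => sin (xi * (y - x))))//.
- under eq_Rintegral => y _.
    rewrite (_ : \int[mu]_ _ _ = \int[mu]_xi (abel e xi * sin ((y - x) * xi))); last first.
      by apply: eq_Rintegral => xi _; rewrite (mulrC xi).
    rewrite integral_abel_sin// mulr0.
    over.
  by rewrite Rintegral_cst// mul0r.
- apply: measurableT_comp; first exact: continuous_measurable_fun (@continuous_sin R).
  by apply: measurable_funM => //; exact: measurable_funB.
- by move=> u v; exact: sin_max.
Qed.

(** The damped square is a transform multiplied by a damped transform. The multiplication formula
    moves the first one over, leaving [a] against the damped inversion of its own transform. *)
Lemma abel_plancherel a e : L1 a -> 0 < e ->
  \int[mu]_xi (abel e xi * (cosT a xi ^+ 2 + sinT a xi ^+ 2)) =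
  \int[mu]_x (a x * \int[mu]_y (a y * poisson e (y - x))).
Proof.
move=> ai e0; have ei := L1_abel e0.
have bc := L1_mul_cosT ei ai; have bs := L1_mul_sinT ei ai.
transitivity (\int[mu]_xi (abel e xi * cosT a xi * cosT a xi +
    abel e xi * sinT a xi * sinT a xi)).
  by apply: eq_Rintegral => x _; rewrite mulrDr !expr2 !mulrA.
rewrite RintegralD//; [|exact: L1_mul_cosT|exact: L1_mul_sinT].
rewrite cosT_sym// sinT_sym// -RintegralD//; [|exact: L1_mul_cosT|exact: L1_mul_sinT].
by apply: eq_Rintegral => x _; rewrite -mulrDr abel_inversion_cos.
Qed.

Lemma measurable_poisson_sub e : 0 < e ->
  measurable_fun setT (fun z : R * R => poisson e (z.2 - z.1)).
Proof.
move=> e0.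
apply: (measurableT_comp (continuous_measurable_fun (@continuous_poisson e e0))).
exact: measurable_funB.
Qed.

(* a(x) a(y) <= (a(x)^2 + a(y)^2) / 2, and the Poisson kernel has mass 2 pi in
   each variable. *)
Lemma schur_poisson a e : L1 a -> 0 < e ->
  ((\int[mu]_x (a x * \int[mu]_y (a y * poisson e (y - x))))%:E <=
   (2 * pi)%:E * \int[mu]_x (a x ^+ 2)%:E)%E.
Proof.
move=> ai e0.
have ma := integrable_measurable ai.
have mp := measurable_poisson_sub e0.
have mp1 x : measurable_fun setT (fun y => poisson e (y - x)).
  exact: integrable_measurable (L1_poisson x e0).
pose S := (\int[mu]_x (a x ^+ 2)%:E)%E.
have S0 : (0 <= S)%E by apply: integral_ge0 => x _; rewrite lee_fin sqr_ge0.
have pM x : poisson e x <= 2 / e.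
  rewrite /poisson expr2 ler_pdivrMr; last by rewrite ltr_pwDl ?mulr_gt0// sqr_ge0.
  have -> : 2 / e * (e * e + x ^+ 2) = 2 * e + 2 / e * x ^+ 2.
    by field; rewrite gt_eqF.
  by rewrite lerDl mulr_ge0 ?sqr_ge0// divr_ge0// ltW.
have ap x : L1 (fun y => a y * poisson e (y - x)).
  apply: (integrableMb (M := 2 / e)) => // y.
  by rewrite ger0_norm ?poisson_ge0.
have pint x : (\int[mu]_y (poisson e (y - x))%:E = (2 * pi)%:E)%E by exact: integral_poisson.
have pint' y : (\int[mu]_x (poisson e (y - x))%:E = (2 * pi)%:E)%E.
  rewrite -(integral_poisson y e0); apply: eq_integral => x _.
  by rewrite /poisson -(sqrrN (y - _)) opprB.
have psq x : (\int[mu]_y ((a x ^+ 2 / 2) * poisson e (y - x))%:E = (a x ^+ 2 / 2 * (2 * pi))%:E)%E.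
  under eq_integral do rewrite EFinM.
  rewrite ge0_integralZl//; last 3 first.
  - by apply/measurable_EFinP; exact: mp1.
  - by move=> y _; rewrite lee_fin poisson_ge0.
  - by rewrite lee_fin divr_ge0// sqr_ge0.
  by rewrite pint -EFinM.
have psq' y : (\int[mu]_x ((a y ^+ 2 / 2) * poisson e (y - x))%:E = (a y ^+ 2 / 2 * (2 * pi))%:E)%E.
  under eq_integral do rewrite EFinM.
  rewrite ge0_integralZl//; last 3 first.
  - apply/measurable_EFinP.
    exact: (measurableT_comp mp (measurable_pair2 y)).
  - by move=> x _; rewrite lee_fin poisson_ge0.
  - by rewrite lee_fin divr_ge0// sqr_ge0.
  by rewrite pint' -EFinM.
have half : (\int[mu]_x (a x ^+ 2 / 2 * (2 * pi))%:E = pi%:E * S)%E.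
  rewrite /S -ge0_integralZl//.
  - by apply: eq_integral => x _; rewrite -EFinM; congr EFin; field.
  - by apply/measurable_EFinP; exact: measurable_funX.
  - by move=> x _; rewrite lee_fin sqr_ge0.
  - by rewrite lee_fin pi_ge0.
have mA : measurable_fun setT (fun z : R * R => (a z.1 ^+ 2 / 2 * poisson e (z.2 - z.1))%:E).
  apply/measurable_EFinP; apply: measurable_funM => //.
  by apply: measurable_funM => //; apply: measurable_funX; exact: measurableT_comp ma _.
have mB : measurable_fun setT (fun z : R * R => (a z.2 ^+ 2 / 2 * poisson e (z.2 - z.1))%:E).
  apply/measurable_EFinP; apply: measurable_funM => //.
  by apply: measurable_funM => //; apply: measurable_funX; exact: measurableT_comp ma _.
have A0 (z : R * R) : (0 <= (a z.1 ^+ 2 / 2 * poisson e (z.2 - z.1))%:E)%E.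
  by rewrite lee_fin mulr_ge0 ?poisson_ge0// divr_ge0 ?sqr_ge0.
have B0 (z : R * R) : (0 <= (a z.2 ^+ 2 / 2 * poisson e (z.2 - z.1))%:E)%E.
  by rewrite lee_fin mulr_ge0 ?poisson_ge0// divr_ge0 ?sqr_ge0.
have mq x : measurable_fun setT (fun y => `|a y| * poisson e (y - x)).
  by apply: measurable_funM => //; exact: measurableT_comp.
have aap0 x y : (0 <= (`|a x| * (`|a y| * poisson e (y - x)))%:E)%E.
  by rewrite lee_fin mulr_ge0// mulr_ge0// poisson_ge0.
have pi2 : (pi%:E * S + pi%:E * S = (2 * pi)%:E * S :> \bar R)%E.
  by rewrite -ge0_muleDl ?lee_fin ?pi_ge0// -EFinD; congr (_%:E * _)%E; ring.
have halfB : (\int[mu]_x \int[mu]_y (a y ^+ 2 / 2 * poisson e (y - x))%:E = pi%:E * S)%E.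
  rewrite -half.
  transitivity (\int[mu]_y \int[mu]_x (a y ^+ 2 / 2 * poisson e (y - x))%:E)%E.
    apply: (fubini_tonelli (m1 := mu) (m2 := mu) _ mB) => z.
    by rewrite lee_fin mulr_ge0 ?poisson_ge0// divr_ge0 ?sqr_ge0.
  by apply: eq_integral => y _; exact: psq'.
have AB : (\int[mu]_x \int[mu]_y (`|a x| * (`|a y| * poisson e (y - x)))%:E <= (2 * pi)%:E * S)%E.
  rewrite -pi2 -[X in (_ <= X + _)%E]half -[X in (_ <= _ + X)%E]halfB.
  under [X in (_ <= X + _)%E]eq_integral do rewrite -psq.
  rewrite -ge0_integralD//=; last 4 first.
  - move=> x _; apply: integral_ge0 => y _.
    by rewrite lee_fin mulr_ge0 ?poisson_ge0// divr_ge0 ?sqr_ge0.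
  - exact: (measurable_fun_fubini_tonelli_F (m2 := mu) _ mA A0).
  - move=> x _; apply: integral_ge0 => y _.
    by rewrite lee_fin mulr_ge0 ?poisson_ge0// divr_ge0 ?sqr_ge0.
  - exact: (measurable_fun_fubini_tonelli_F (m2 := mu) _ mB B0).
  apply: ge0_le_integral => //=.
  - by move=> x _; apply: integral_ge0 => y _; exact: aap0.
  - apply: (measurable_fun_fubini_tonelli_F (m2 := mu)
      (fun z : R * R => (`|a z.1| * (`|a z.2| * poisson e (z.2 - z.1)))%:E)); last first.
      by move=> z; exact: aap0.
    apply/measurable_EFinP; apply: measurable_funM.
      by apply: measurableT_comp => //; exact: measurableT_comp ma _.
    apply: measurable_funM => //.
    by apply: measurableT_comp => //; exact: measurableT_comp ma _.
  - apply: emeasurable_funD.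
      exact: (measurable_fun_fubini_tonelli_F (m2 := mu) _ mA A0).
    exact: (measurable_fun_fubini_tonelli_F (m2 := mu) _ mB B0).
  - move=> x _; rewrite -ge0_integralD//=; last 4 first.
    + by move=> y _; rewrite lee_fin mulr_ge0 ?poisson_ge0// divr_ge0 ?sqr_ge0.
    + exact: (measurableT_comp mA (measurable_pair1 x)).
    + by move=> y _; rewrite lee_fin mulr_ge0 ?poisson_ge0// divr_ge0 ?sqr_ge0.
    + exact: (measurableT_comp mB (measurable_pair1 x)).
    apply: ge0_le_integral => //=.
    + by apply/measurable_EFinP; apply: measurable_funM => //; exact: mq.
    + apply: emeasurable_funD.
        exact: (measurableT_comp mA (measurable_pair1 x)).
      exact: (measurableT_comp mB (measurable_pair1 x)).
    + move=> y _; rewrite -EFinD lee_fin mulrA -mulrDl ler_wpM2r ?poisson_ge0//.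
      rewrite -(real_normK (num_real (a x))) -(real_normK (num_real (a y))).
      rewrite -subr_ge0.
      have -> : `|a x| ^+ 2 / 2 + `|a y| ^+ 2 / 2 - `|a x| * `|a y| =
        (`|a x| - `|a y|) ^+ 2 / 2 by field.
      by rewrite divr_ge0 ?sqr_ge0.
apply: le_trans AB.
pose J x := \int[mu]_y (a y * poisson e (y - x)).
(* By damped inversion [J] is a sum of transforms of integrable functions, hence bounded and
   measurable. *)
have aJ : L1 (fun x => a x * J x).
  have -> : (fun x => a x * J x) = fun x =>
      a x * cosT (fun xi => abel e xi * cosT a xi) x +
      a x * sinT (fun xi => abel e xi * sinT a xi) x.
    by apply/funext => x; rewrite -mulrDr abel_inversion_cos.
  apply: L1D; [apply: L1_mul_cosT => //; apply: L1_mul_cosT|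
    apply: L1_mul_sinT => //; apply: L1_mul_sinT] => //; exact: L1_abel.
apply: (@le_trans _ _ (`|\int[mu]_x (a x * J x)|%:E)); first by rewrite lee_fin ler_norm.
rewrite EFin_normr_Rintegral//.
apply: (le_trans (le_abse_integral mu measurableT (measurable_int mu aJ))).
apply: ge0_le_integral => //=.
- exact: (measurable_int mu (L1_norm aJ)).
- apply: (measurable_fun_fubini_tonelli_F (m2 := mu)
      (fun z : R * R => (`|a z.1| * (`|a z.2| * poisson e (z.2 - z.1)))%:E)); last first.
    by move=> z; exact: aap0.
  apply/measurable_EFinP; apply: measurable_funM.
    by apply: measurableT_comp => //; exact: measurableT_comp ma _.
  apply: measurable_funM => //.
  by apply: measurableT_comp => //; exact: measurableT_comp ma _.
- move=> x _; under eq_integral do rewrite EFinM.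
  rewrite ge0_integralZl//; last 2 first.
  + by apply/measurable_EFinP; exact: mq.
  + by move=> y _; rewrite lee_fin mulr_ge0 ?poisson_ge0.
  rewrite normrM EFinM lee_wpmul2l ?lee_fin// EFin_normr_Rintegral//.
  apply: (le_trans (le_abse_integral mu measurableT (measurable_int mu (ap x)))).
  rewrite le_eqVlt; apply/orP; left; apply/eqP.
  by apply: eq_integral => y _; rewrite /= normrM (ger0_norm (poisson_ge0 _ e0)).
Qed.

(** * Removal of the damping: the Plancherel inequality and Fourier inversion *)

Lemma cvg_abel x : abel n.+1%:R^-1 x @[n --> \oo] --> (1 : R).
Proof.
have : abel n.+1%:R^-1 x @[n --> \oo] --> expR (- (0 * `|x|)).
  apply: continuous_cvg; first exact: continuous_expR.
  by apply: cvgN; apply: cvgMl; exact: cvg_harmonic.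
by rewrite mul0r oppr0 expR0.
Qed.

(** The bound of [schur_poisson] is uniform in the damping, so Fatou along e = 1/(n + 1) transfers
    it to the undamped integral. The right-hand side is allowed to be +oo. *)
Theorem plancherel_le a : L1 a ->
  (\int[mu]_xi (cosT a xi ^+ 2 + sinT a xi ^+ 2)%:E <=
   (2 * pi)%:E * \int[mu]_x (a x ^+ 2)%:E)%E.
Proof.
move=> ai.
have mc := measurable_cosT ai; have ms := measurable_sinT ai.
pose F n xi := (abel n.+1%:R^-1 xi * (cosT a xi ^+ 2 + sinT a xi ^+ 2))%:E.
have mF n : measurable_fun setT (F n).
  apply/measurable_EFinP; apply: measurable_funM.
    exact: measurable_abel.
  by apply: measurable_funD; exact: measurable_funX.
have F0 n x : (0 <= F n x)%E.
  by rewrite lee_fin mulr_ge0 ?abel_ge0// addr_ge0 ?sqr_ge0.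
have e0 n : 0 < (n.+1%:R^-1 : R) by rewrite invr_gt0.
have Fle n : (\int[mu]_x F n x <= (2 * pi)%:E * \int[mu]_x (a x ^+ 2)%:E)%E.
  apply: le_trans (schur_poisson ai (e0 n)).
  rewrite -abel_plancherel// /Rintegral fineK//.
  apply/integrable_fin_num => //.
  have ei := L1_abel (e0 n).
  have : L1 (fun xi => abel n.+1%:R^-1 xi * cosT a xi * cosT a xi +
      abel n.+1%:R^-1 xi * sinT a xi * sinT a xi).
    apply: L1D; [apply: L1_mul_cosT => //; exact: L1_mul_cosT|].
    by apply: L1_mul_sinT => //; exact: L1_mul_sinT.
  congr (_.-integrable _ _); apply/funext => x /=.
  by rewrite mulrDr !expr2 !mulrA.
have := @fatou _ _ _ mu setT measurableT F mF (fun n x _ => F0 n x).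
under eq_integral => x _.
  have h : F n x @[n --> \oo] --> (cosT a x ^+ 2 + sinT a x ^+ 2)%:E.
    apply: cvg_EFin; first exact: nearW.
    rewrite -[X in _ --> X]mul1r; apply: cvgMl; exact: cvg_abel.
  rewrite (cvg_limn_einf_sup h).1.
  over.
move=> /le_trans; apply.
rewrite limn_einf_lim; apply: lime_le; first exact: is_cvg_einfs.
apply: nearW => n; apply: le_trans (Fle n).
by apply: ereal_inf_lbound; exists n => /=.
Qed.

(* Let e -> 0 in [abel_inversion_cos]. *)
Lemma inversion_cos (g : R -> R) M : L1 g -> continuous g ->
  (forall x, 0 <= g x) -> (forall x, g x <= M) ->
  L1 (cosT g) -> L1 (sinT g) -> forall xi,
  cosT (cosT g) xi + sinT (sinT g) xi = 2 * pi * g xi.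
Proof.
move=> gi cg g0 gM ci si xi.
have mg := integrable_measurable gi.
have e0 n : 0 < (n.+1%:R^-1 : R) by rewrite invr_gt0.
have h1 : cosT (fun x => abel n.+1%:R^-1 x * cosT g x) xi @[n --> \oo] --> cosT (cosT g) xi.
  apply: (@dominated_cvg_Rintegral _ _ (fun x => `|cosT g x|)).
  - move=> n; exact: integrable_measurable (L1_cos xi (L1_mul_cosT (L1_abel (e0 n)) gi)).
  - exact: integrable_measurable (L1_cos xi ci).
  - move=> x; apply: cvgMl; rewrite -[X in _ --> X]mul1r; apply: cvgMl.
    exact: cvg_abel.
  - by move=> n x; apply: norm_abelM_le; [exact/ltW|exact: cos_max].
  - exact: L1_norm.
have h2 : sinT (fun x => abel n.+1%:R^-1 x * sinT g x) xi @[n --> \oo] --> sinT (sinT g) xi.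
  apply: (@dominated_cvg_Rintegral _ _ (fun x => `|sinT g x|)).
  - move=> n; exact: integrable_measurable (L1_sin xi (L1_mul_sinT (L1_abel (e0 n)) gi)).
  - exact: integrable_measurable (L1_sin xi si).
  - move=> x; apply: cvgMl; rewrite -[X in _ --> X]mul1r; apply: cvgMl.
    exact: cvg_abel.
  - by move=> n x; apply: norm_abelM_le; [exact/ltW|exact: sin_max].
  - exact: L1_norm.
have h3 : (\int[mu]_y (g y * poisson n.+1%:R^-1 (y - xi))) @[n --> \oo] -->
    cosT (cosT g) xi + sinT (sinT g) xi.
  rewrite (_ : (fun n => _) = (fun n => cosT (fun x => abel n.+1%:R^-1 x * cosT g x) xi +
      sinT (fun x => abel n.+1%:R^-1 x * sinT g x) xi)); first exact: cvgD.
  by apply/funext => n; rewrite abel_inversion_cos.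
apply: (cvg_unique _ h3) => //.
(* The same sequence after rescaling: [g] is sampled ever closer to [xi] against a fixed kernel of
   mass 2 pi, with majorant [M * poisson 1]. *)
have h4 : \int[mu]_u (g (n.+1%:R^-1 * u + xi) * poisson 1 u) @[n --> \oo] -->
    \int[mu]_u (g xi * poisson 1 u).
  apply: (@dominated_cvg_Rintegral _ _ (fun u => M * poisson 1 u)).
  - move=> n; apply: measurable_funM.
      apply: measurableT_comp => //; exact: measurable_funD.
    exact: continuous_measurable_fun (@continuous_poisson 1 ltr01).
  - apply: measurable_funM => //.
    exact: continuous_measurable_fun (@continuous_poisson 1 ltr01).
  - move=> u; apply: cvgMl; apply: continuous_cvg; first exact: cg.
    rewrite -[X in _ --> X]add0r; apply: cvgD; last exact: cvg_cst.
    by rewrite -(mul0r u); apply: cvgMl; exact: cvg_harmonic.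
  - move=> n x; rewrite normrM !ger0_norm ?poisson_ge0//.
    by rewrite ler_wpM2r ?poisson_ge0.
  - apply: L1Z; have := L1_poisson 0 (@ltr01 R).
    by under [X in EFin \o X]eq_fun do rewrite subr0.
have -> : 2 * pi * g xi = \int[mu]_u (g xi * poisson 1 u).
  rewrite RintegralZl//; last first.
    have := L1_poisson 0 (@ltr01 R).
    by under [X in EFin \o X]eq_fun do rewrite subr0.
  by rewrite /Rintegral integral_poisson1/= mulrC.
have <- : (fun n : nat => \int[mu]_u (g (n.+1%:R^-1 * u + xi) * poisson 1 u)) =
  (fun n => \int[mu]_y (g y * poisson n.+1%:R^-1 (y - xi))).
  by apply/funext => n; rewrite /Rintegral integral_poisson_shift.
exact: h4.
Qed.

(** Imaginary part of the inversion formula for a real function, as the limit of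
    [abel_inversion_sin] when the damping disappears. *)
Lemma inversion_sin (g : R -> R) : L1 g ->
  L1 (cosT g) -> L1 (sinT g) -> forall xi,
  cosT (sinT g) xi = sinT (cosT g) xi.
Proof.
move=> gi ci si xi.
have e0 n : 0 < (n.+1%:R^-1 : R) by rewrite invr_gt0.
have h1 : sinT (fun x => abel n.+1%:R^-1 x * cosT g x) xi @[n --> \oo] --> sinT (cosT g) xi.
  apply: (@dominated_cvg_Rintegral _ _ (fun x => `|cosT g x|)).
  - move=> n; exact: integrable_measurable (L1_sin xi (L1_mul_cosT (L1_abel (e0 n)) gi)).
  - exact: integrable_measurable (L1_sin xi ci).
  - move=> x; apply: cvgMl; rewrite -[X in _ --> X]mul1r; apply: cvgMl.
    exact: cvg_abel.
  - by move=> n x; apply: norm_abelM_le; [exact/ltW|exact: sin_max].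
  - exact: L1_norm.
have h2 : cosT (fun x => abel n.+1%:R^-1 x * sinT g x) xi @[n --> \oo] --> cosT (sinT g) xi.
  apply: (@dominated_cvg_Rintegral _ _ (fun x => `|sinT g x|)).
  - move=> n; exact: integrable_measurable (L1_cos xi (L1_mul_sinT (L1_abel (e0 n)) gi)).
  - exact: integrable_measurable (L1_cos xi si).
  - move=> x; apply: cvgMl; rewrite -[X in _ --> X]mul1r; apply: cvgMl.
    exact: cvg_abel.
  - by move=> n x; apply: norm_abelM_le; [exact/ltW|exact: cos_max].
  - exact: L1_norm.
apply: (cvg_unique _ h2) => //.
rewrite (_ : (fun n => _) = (fun n => sinT (fun x => abel n.+1%:R^-1 x * cosT g x) xi))//.
by apply/funext => n; rewrite abel_inversion_sin.
Qed.

End RealIntegrals.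

(** * Almost everywhere limits of rapidly Cauchy sequences in L^2 *)

Section RieszFischer.
Local Open Scope classical_set_scope.
Context {R : realType}.
Local Notation mu := (@lebesgue_measure R).

Lemma cvg_of_geometric_increments (u : R^nat) (M : R) : 0 <= M ->
  (forall n, `|u n.+1 - u n| <= M / 2 ^+ n) -> cvgn u.
Proof.
move=> M0 hu.
have hs : cvgn (series (fun n => u n.+1 - u n)).
  apply: normed_cvg.
  apply: (@series_le_cvg _ _ (geometric M 2^-1)) => //.
  - by move=> n; exact: normr_ge0.
  - by move=> n; rewrite /geometric/= mulr_ge0// exprn_ge0// invr_ge0.
  - by move=> n; rewrite /geometric/= exprVn.
  - apply: is_cvg_geometric_series; rewrite ger0_norm ?invr_ge0//.
    by rewrite invf_lt1// ltr1n.
have -> : u = (fun n => u 0%N + series (fun n => u n.+1 - u n) n).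
  by apply/funext => n; rewrite /series/= telescope_sumr// addrC subrK.
by apply: is_cvgD; [exact: is_cvg_cst|].
Qed.

Lemma ae_imply2 (P Q S : R -> Prop) :
  {ae mu, forall x, P x} -> {ae mu, forall x, Q x} ->
  (forall x, P x -> Q x -> S x) -> {ae mu, forall x, S x}.
Proof.
move=> hP hQ h; apply: negligibleS (negligibleU hP hQ).
move=> x /= nS; apply/not_andP => -[? ?]; exact/nS/h.
Qed.

(* The sum of 4^n (f (n+1) - f n)^2 has finite integral, so almost everywhere
   the increments are O(2^-n). *)
Lemma riesz_fischer (f : nat -> R -> R) :
  (forall n, measurable_fun setT (f n)) ->
  (forall n, (\int[mu]_x ((f n.+1 x - f n x) ^+ 2)%:E <= (16%:R^-1 ^+ n)%:E)%E) ->
  exists w : R -> R, measurable_fun setT w /\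
    {ae mu, forall x, f n x @[n --> \oo] --> w x}.
Proof.
move=> mf fle.
pose S x := (\sum_(0 <= n <oo) (4 ^+ n * (f n.+1 x - f n x) ^+ 2)%:E)%E.
have mt n : measurable_fun setT (fun x => (4 ^+ n * (f n.+1 x - f n x) ^+ 2)%:E).
  apply/measurable_EFinP; apply: measurable_funM => //.
  by apply: measurable_funX; exact: measurable_funB.
have md n : measurable_fun setT (fun x => (f n.+1 x - f n x) ^+ 2).
  by apply: measurable_funX; exact: measurable_funB.
have t0 n x : (0 <= (4 ^+ n * (f n.+1 x - f n x) ^+ 2)%:E)%E.
  by rewrite lee_fin mulr_ge0 ?sqr_ge0// exprn_ge0.
have mS : measurable_fun setT S.
  by apply: ge0_emeasurable_sum.
have iS : mu.-integrable setT S.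
  apply/integrableP; split=> //.
  under eq_integral do rewrite gee0_abs ?nneseries_ge0//.
  rewrite integral_nneseries//.
  (* The n-th term is at most 4^n 16^-n = 4^-n, which is compared with 2^-n, written 2 / 2^(n + 1)
     to fit the summation formula. *)
  apply: (@le_lt_trans _ _ (\sum_(0 <= n <oo) (2 / (2 ^ (n + 1))%:R)%:E)%E).
    apply: lee_nneseries => [n _ _|n _]; first exact: integral_ge0.
    have -> : (\int[mu]_x (4 ^+ n * (f n.+1 x - f n x) ^+ 2)%:E =
        (4 ^+ n)%:E * \int[mu]_x ((f n.+1 x - f n x) ^+ 2)%:E)%E.
      rewrite -ge0_integralZl//.
      - by apply/measurable_EFinP; exact: md.
      - by move=> x _; rewrite lee_fin sqr_ge0.
    apply: (@le_trans _ _ ((4 ^+ n)%:E * (16%:R^-1 ^+ n)%:E)%E).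
      by rewrite lee_wpmul2l// lee_fin exprn_ge0.
    rewrite -EFinM lee_fin -exprMn addn1 natrX exprS invfM mulrA divff// mul1r.
    rewrite -exprVn lerXn2r ?nnegrE ?divr_ge0 ?invr_ge0//.
    by rewrite (_ : 4 / 16%:R = 4^-1); [rewrite lef_pV2 ?posrE// ler_nat|field].
  rewrite (_ : (\sum_(0 <= n <oo) _)%E = (2 / 2 ^+ 0)%:E) ?ltry//.
  by apply/cvg_lim => //; exact: cvg_geometric_eseries_half.
(* The upper limit is measurable whether or not the sequence converges, and agrees with the limit
   wherever there is one. *)
exists (fun x => fine (limn_esup (fun n => (f n x)%:E))); split.
  apply: measurableT_comp => //.
  by apply: measurable_fun_limn_esup => n; apply/measurable_EFinP; exact: mf.
have := integrable_ae measurableT iS.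
apply: filterS => x /(_ I) Sx.
have /cvg_ex[l fl] : cvgn (f ^~ x).
  (* With S the value of the series, (2^n |f (n+1) - f n|)^2 <= S <= (S + 1)^2, so S + 1 serves as
     the constant without a square root. *)
  apply: (@cvg_of_geometric_increments _ (fine (S x) + 1)) => [|n].
    by rewrite addr_ge0// fine_ge0// nneseries_ge0.
  have S0 : 0 <= fine (S x) by rewrite fine_ge0// nneseries_ge0.
  have : 4 ^+ n * (f n.+1 x - f n x) ^+ 2 <= fine (S x).
    rewrite -lee_fin fineK//.
    apply: le_trans (nneseries_lim_ge n.+1 (fun k _ _ => t0 k x)).
    by rewrite big_nat_recr//= leeDr// sume_ge0.
  move=> h; rewrite ler_pdivlMr ?exprn_gt0//.
  rewrite -(@ler_pXn2r _ 2)// ?nnegrE ?mulr_ge0 ?exprn_ge0 ?addr_ge0//.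
  rewrite exprMn real_normK ?num_real// -exprM mulnC exprM mulrC.
  rewrite (_ : 2 ^+ 2 = 4); last by ring.
  apply: (le_trans h); rewrite sqrrD1.
  by have := sqr_ge0 (fine (S x)); lra.
have h : (f n x)%:E @[n --> \oo] --> l%:E by apply: cvg_EFin => //; exact: nearW.
by rewrite (cvg_limn_einf_sup h).2.
Qed.
End RieszFischer.

(** * Squared L^2 norms and transforms of complex functions *)

Section ComplexL2.
Local Open Scope classical_set_scope.
Context {R : realType}.
Implicit Types (f g h w : R -> R[i]) (D : set R) (z : R[i]).
Local Notation mu := (@lebesgue_measure R).
Local Notation Re := complex.Re.
Local Notation Im := complex.Im.

Definition sqn z : R := Re z ^+ 2 + Im z ^+ 2.

Lemma sqn_ge0 z : 0 <= sqn z.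
Proof. by rewrite addr_ge0 ?sqr_ge0. Qed.

Lemma sqr_normc z : Normc.normc z ^+ 2 = sqn z.
Proof. by case: z => a b; rewrite /Normc.normc sqr_sqrtr// addr_ge0 ?sqr_ge0. Qed.

Lemma normc_ge0 z : 0 <= Normc.normc z.
Proof. by case: z => a b; exact: sqrtr_ge0. Qed.

Lemma sqnD_le (z1 z2 : R[i]) : sqn (z1 + z2) <= 2 * sqn z1 + 2 * sqn z2.
Proof.
case: z1 z2 => [a b] [c d]; rewrite /sqn /= -subr_ge0.
have -> : 2 * (a ^+ 2 + b ^+ 2) + 2 * (c ^+ 2 + d ^+ 2) - ((a + c) ^+ 2 + (b + d) ^+ 2)
  = (a - c) ^+ 2 + (b - d) ^+ 2 by ring.
by rewrite addr_ge0 ?sqr_ge0.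
Qed.

Lemma sqnM (z1 z2 : R[i]) : sqn (z1 * z2) = sqn z1 * sqn z2.
Proof. by rewrite -!sqr_normc Normc.normcM exprMn. Qed.

Lemma sqnN z : sqn (- z) = sqn z.
Proof. by case: z => a b; rewrite /sqn /= !sqrrN. Qed.

Lemma ReD (z1 z2 : R[i]) : Re (z1 + z2) = Re z1 + Re z2.
Proof. by case: z1 z2 => [? ?] []. Qed.
Lemma ImD (z1 z2 : R[i]) : Im (z1 + z2) = Im z1 + Im z2.
Proof. by case: z1 z2 => [? ?] []. Qed.
Lemma ReN z : Re (- z) = - Re z. Proof. by case: z. Qed.
Lemma ImN z : Im (- z) = - Im z. Proof. by case: z. Qed.
Lemma ReM (z1 z2 : R[i]) : Re (z1 * z2) = Re z1 * Re z2 - Im z1 * Im z2.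
Proof. by case: z1 z2 => [? ?] []. Qed.
Lemma ImM (z1 z2 : R[i]) : Im (z1 * z2) = Re z1 * Im z2 + Im z1 * Re z2.
Proof. by case: z1 z2 => [? ?] []. Qed.

(** The squared L^2 norm over [D]. Sums and limits are treated at this level, where the triangle
    inequality becomes the factor 2 of [energyD]; [LpNorm2_le] returns to the norm. *)
Definition energy_on D f : \bar R := (\int[mu]_(x in D) (sqn (f x))%:E)%E.
Definition energy f := energy_on setT f.

Lemma energy_on_ge0 D f : (0 <= energy_on D f)%E.
Proof. by apply: integral_ge0 => x _; rewrite lee_fin sqn_ge0. Qed.

Lemma measurable_sqn f : cmeasurable f -> measurable_fun setT (fun x => sqn (f x)).
Proof. by move=> [mr mi]; apply: measurable_funD; exact: measurable_funX. Qed.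

Lemma cmeasurableD f g : cmeasurable f -> cmeasurable g ->
  cmeasurable (fun x => f x + g x).
Proof.
move=> [fr fi] [gr gi]; split.
  by under eq_fun do rewrite ReD; exact: measurable_funD.
by under eq_fun do rewrite ImD; exact: measurable_funD.
Qed.

Lemma cmeasurableN f : cmeasurable f -> cmeasurable (fun x => - f x).
Proof.
move=> [fr fi]; split.
  by under eq_fun do rewrite ReN; exact: measurable_funN.
by under eq_fun do rewrite ImN; exact: measurable_funN.
Qed.

Lemma cmeasurableB f g : cmeasurable f -> cmeasurable g ->
  cmeasurable (fun x => f x - g x).
Proof. by move=> mf mg; exact: cmeasurableD (cmeasurableN mg). Qed.

Lemma cmeasurableM f g : cmeasurable f -> cmeasurable g ->
  cmeasurable (fun x => f x * g x).
Proof.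
move=> [fr fi] [gr gi]; split.
  by under eq_fun do rewrite ReM; apply: measurable_funB; exact: measurable_funM.
by under eq_fun do rewrite ImM; apply: measurable_funD; exact: measurable_funM.
Qed.

Lemma cmeasurable_cst z : cmeasurable (fun _ : R => z).
Proof. by split; exact: measurable_cst. Qed.

Lemma le_energy_on D f g h : measurable D ->
  cmeasurable f -> cmeasurable g -> cmeasurable h ->
  (forall x, D x -> sqn (h x) <= 2 * sqn (f x) + 2 * sqn (g x)) ->
  (energy_on D h <= 2%:E * energy_on D f + 2%:E * energy_on D g)%E.
Proof.
move=> mD /measurable_sqn mf /measurable_sqn mg /measurable_sqn mh hfg.
rewrite /energy_on -!ge0_integralZl//; last 4 first.
- by apply/measurable_EFinP; exact: measurable_funTS.
- by move=> x _; rewrite lee_fin sqn_ge0.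
- by apply/measurable_EFinP; exact: measurable_funTS.
- by move=> x _; rewrite lee_fin sqn_ge0.
rewrite -ge0_integralD//=; last 4 first.
- by move=> x _; rewrite mule_ge0 ?lee_fin// sqn_ge0.
- by apply/measurable_EFinP; apply: measurable_funM => //; exact: measurable_funTS.
- by move=> x _; rewrite mule_ge0 ?lee_fin// sqn_ge0.
- by apply/measurable_EFinP; apply: measurable_funM => //; exact: measurable_funTS.
apply: ge0_le_integral => //=.
- by move=> x _; rewrite lee_fin sqn_ge0.
- by apply/measurable_EFinP; exact: measurable_funTS.
- by apply/measurable_EFinP; apply: measurable_funD; apply: measurable_funM => //;
    exact: measurable_funTS.
Qed.

Lemma energyD f g : cmeasurable f -> cmeasurable g ->
  (energy (fun x => f x + g x)%R <= 2%:E * energy f + 2%:E * energy g)%E.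
Proof.
move=> mf mg; apply: le_energy_on => //; first exact: cmeasurableD.
by move=> x _; exact: sqnD_le.
Qed.

Lemma energyZ z f : cmeasurable f ->
  energy (fun x => z * f x) = ((sqn z)%:E * energy f)%E.
Proof.
move=> mf; rewrite /energy /energy_on -ge0_integralZl//.
- by apply: eq_integral => x _; rewrite sqnM EFinM.
- by apply/measurable_EFinP; exact: measurable_sqn.
- by move=> x _; rewrite lee_fin sqn_ge0.
- by rewrite lee_fin sqn_ge0.
Qed.

Lemma LpNorm2E f : LpNorm 2%:E f = (energy f `^ 2^-1)%E.
Proof.
rewrite /LpNorm unlock; congr (_ `^ _)%E; apply: eq_integral => x _.
by rewrite /= ger0_norm ?normc_ge0// -sqr_normc -powR_mulrn// normc_ge0.
Qed.

Lemma LpNorm2_le f (c : R) : 0 <= c ->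
  (LpNorm 2%:E f <= c%:E)%E = (energy f <= (c ^+ 2)%:E)%E.
Proof.
move=> c0; rewrite LpNorm2E.
have e0 : (0 <= energy f)%E := energy_on_ge0 setT f.
have mono (r : R) (u v : \bar R) : 0 <= r -> (0 <= u)%E -> (0 <= v)%E ->
    (u <= v -> u `^ r <= v `^ r)%E.
  by move=> r0 u0 v0; apply: gt0_ler_poweR; rewrite ?in_itv/= ?u0 ?v0 ?leey.
have sq2 (u : \bar R) : (0 <= u)%E -> ((u `^ 2^-1) `^ 2 = u)%E.
  by move=> u0; rewrite -poweRrM mulVf// poweRe1.
apply/idP/idP => h.
  rewrite -(sq2 _ e0); have := mono 2 _ _ (ler0n _ _) (poweR_ge0 _ _) _ h.
  by rewrite lee_fin poweR_EFin -powR_mulrn//; apply.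
have -> : c%:E = ((c ^+ 2)%:E `^ 2^-1)%E.
  by rewrite poweR_EFin powR12_sqrt ?sqr_ge0// sqrtr_sqr ger0_norm.
by apply: mono => //; rewrite ?lee_fin ?sqr_ge0// invr_ge0.
Qed.

Lemma energy_on_mkcond D f : energy_on D f =
  (\int[mu]_x ((fun x => sqn (f x)) \_ D x)%:E)%E.
Proof. by rewrite /energy_on integral_mkcond restrict_EFin. Qed.

Lemma cosT_add a b : mu.-integrable setT (EFin \o a) -> mu.-integrable setT (EFin \o b) ->
  forall xi, cosT (fun x => a x + b x) xi = cosT a xi + cosT b xi.
Proof.
move=> ai bi xi; rewrite /cosT -RintegralD//; [|exact: L1_cos|exact: L1_cos].
by apply: eq_Rintegral => x _; rewrite mulrDl.
Qed.

Lemma sinT_add a b : mu.-integrable setT (EFin \o a) -> mu.-integrable setT (EFin \o b) ->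
  forall xi, sinT (fun x => a x + b x) xi = sinT a xi + sinT b xi.
Proof.
move=> ai bi xi; rewrite /sinT -RintegralD//; [|exact: L1_sin|exact: L1_sin].
by apply: eq_Rintegral => x _; rewrite mulrDl.
Qed.

Lemma cosT_scale (k : R) a : mu.-integrable setT (EFin \o a) ->
  forall xi, cosT (fun x => k * a x) xi = k * cosT a xi.
Proof.
move=> ai xi; rewrite /cosT -RintegralZl//; last exact: L1_cos.
by apply: eq_Rintegral => x _; rewrite mulrA.
Qed.

Lemma sinT_scale (k : R) a : mu.-integrable setT (EFin \o a) ->
  forall xi, sinT (fun x => k * a x) xi = k * sinT a xi.
Proof.
move=> ai xi; rewrite /sinT -RintegralZl//; last exact: L1_sin.
by apply: eq_Rintegral => x _; rewrite mulrA.
Qed.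

Definition cintegrable f : Prop :=
  mu.-integrable setT (EFin \o (fun x => Re (f x))) /\
  mu.-integrable setT (EFin \o (fun x => Im (f x))).

Definition crestrict D f x : R[i] := if x \in D then f x else 0.

Lemma Re_crestrict D f x : Re (crestrict D f x) = ((fun x => Re (f x)) \_ D) x.
Proof. by rewrite /crestrict patchE; case: ifP. Qed.

Lemma Im_crestrict D f x : Im (crestrict D f x) = ((fun x => Im (f x)) \_ D) x.
Proof. by rewrite /crestrict patchE; case: ifP. Qed.

Lemma inv_fourier_on_mkcond D g : inv_fourier_on D g = inv_fourier_on setT (crestrict D g).
Proof.
apply/funext => x; rewrite /inv_fourier_on /cintegral Rintegral_mkcond.
rewrite [X in _ +i* X]Rintegral_mkcond.
congr (_ * (_ +i* _)); apply: eq_Rintegral => xi _; rewrite patchE /crestrict;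
  by case: ifP => // _; rewrite mulr0.
Qed.

(** Real coordinates of the integral of g(y) e^(i s x y), used with s = 1 for the inverse and s = -1
    for the direct transform. *)
Definition transform (s : R) g x : R[i] :=
  (cosT (fun y => Re (g y)) x - s * sinT (fun y => Im (g y)) x) +i*
  (cosT (fun y => Im (g y)) x + s * sinT (fun y => Re (g y)) x).

Lemma inv_fourierE g : cintegrable g ->
  inv_fourier_on setT g = (fun x => ((2 * pi)^-1)%:C * transform 1 g x).
Proof.
move=> [ri ii]; apply/funext => x; rewrite /inv_fourier_on; congr (_ * _).
rewrite /cintegral /transform /cosT /sinT !mul1r.
rewrite -RintegralB//; [|exact: L1_cos|exact: L1_sin].
rewrite -RintegralD//; [|exact: L1_cos|exact: L1_sin].
congr (_ +i* _); apply: eq_Rintegral => xi _.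
  by rewrite ReM /= expR0 !mul1r (mulrC x); ring.
by rewrite ImM /= expR0 !mul1r (mulrC x); ring.
Qed.

Lemma fourierE f : cintegrable f -> fourier f = transform (-1) f.
Proof.
move=> [ri ii]; apply/funext => x; rewrite /fourier.
rewrite /cintegral /transform /cosT /sinT !mulN1r opprK.
rewrite -RintegralD//; [|exact: L1_cos|exact: L1_sin].
rewrite -RintegralB//; [|exact: L1_cos|exact: L1_sin].
congr (_ +i* _); apply: eq_Rintegral => xi _.
  by rewrite ReM /= expR0 !mul1r cosN sinN; ring.
by rewrite ImM /= expR0 !mul1r cosN sinN; ring.
Qed.

Lemma cmeasurable_transform s g : cintegrable g -> cmeasurable (transform s g).
Proof.
move=> [ri ii]; split => /=.
  apply: measurable_funB; first exact: measurable_cosT.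
  by apply: measurable_funM => //; exact: measurable_sinT.
apply: measurable_funD; first exact: measurable_cosT.
by apply: measurable_funM => //; exact: measurable_sinT.
Qed.

(** Real and imaginary parts are transformed separately and recombined by (a - b)^2 <= 2 a^2 + 2
    b^2, which doubles the sharp constant 2 pi. *)
Lemma energy_transform s g : `|s| = 1 -> cintegrable g ->
  (energy (transform s g) <= (4 * pi)%:E * energy g)%E.
Proof.
move=> s1 [ri ii].
have mr := integrable_measurable ri; have mi := integrable_measurable ii.
have mcr := measurable_cosT ri; have msr := measurable_sinT ri.
have mci := measurable_cosT ii; have msi := measurable_sinT ii.
pose P (a : R -> R) x := cosT a x ^+ 2 + sinT a x ^+ 2.
have P0 a x : 0 <= P a x by rewrite addr_ge0 ?sqr_ge0.
have mPr : measurable_fun setT (P (fun y => Re (g y))).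
  by apply: measurable_funD; exact: measurable_funX.
have mPi : measurable_fun setT (P (fun y => Im (g y))).
  by apply: measurable_funD; exact: measurable_funX.
have s2 : s ^+ 2 = 1 by rewrite -(real_normK (num_real s)) s1 expr1n.
apply: (@le_trans _ _ (\int[mu]_x (2 * (P (fun y => Re (g y)) x + P (fun y => Im (g y)) x))%:E)%E).
  apply: ge0_le_integral => //.
  - by move=> x _; rewrite lee_fin sqn_ge0.
  - by apply/measurable_EFinP; apply: measurable_sqn; apply: cmeasurable_transform.
  - by apply/measurable_EFinP; apply: measurable_funM => //; exact: measurable_funD.
  - move=> x _; rewrite lee_fin /sqn /transform /P /=.
    set c := cosT _ x; set s' := sinT _ x; set c' := cosT _ x; set s'' := sinT _ x.
    rewrite -subr_ge0.
    have -> : 2 * (c ^+ 2 + s'' ^+ 2 + (c' ^+ 2 + s' ^+ 2)) -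
       ((c - s * s') ^+ 2 + (c' + s * s'') ^+ 2) =
       (c + s * s') ^+ 2 + (c' - s * s'') ^+ 2
       + 2 * (1 - s ^+ 2) * (s' ^+ 2 + s'' ^+ 2) by ring.
    by rewrite s2 subrr mulr0 mul0r addr0 addr_ge0 ?sqr_ge0.
have -> : (\int[mu]_x (2 * (P (fun y => Re (g y)) x + P (fun y => Im (g y)) x))%:E =
    2%:E * (\int[mu]_x (P (fun y => Re (g y)) x)%:E +
      \int[mu]_x (P (fun y => Im (g y)) x)%:E))%E.
  rewrite -ge0_integralD//.
  - rewrite -ge0_integralZl//.
      by apply: emeasurable_funD; exact/measurable_EFinP.
    by move=> x _; rewrite adde_ge0// lee_fin.
  - by move=> x _; rewrite lee_fin.
  - exact/measurable_EFinP.
  - by move=> x _; rewrite lee_fin.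
  - exact/measurable_EFinP.
apply: (@le_trans _ _ (2%:E * ((2 * pi)%:E * \int[mu]_x (Re (g x) ^+ 2)%:E +
   (2 * pi)%:E * \int[mu]_x (Im (g x) ^+ 2)%:E))%E).
  by rewrite lee_wpmul2l ?lee_fin// leeD//; exact: plancherel_le.
rewrite -ge0_muleDr//; last 2 first.
- by apply: integral_ge0 => x _; rewrite lee_fin sqr_ge0.
- by apply: integral_ge0 => x _; rewrite lee_fin sqr_ge0.
rewrite -ge0_integralD//; last 4 first.
- by move=> x _; rewrite lee_fin sqr_ge0.
- by apply/measurable_EFinP; exact: measurable_funX.
- by move=> x _; rewrite lee_fin sqr_ge0.
- by apply/measurable_EFinP; exact: measurable_funX.
by rewrite muleA -EFinM mulrA -natrM.
Qed.

(** The normalisation absorbs the lost factor: (2 pi)^-2 * 4 pi = 1/pi <= 1. *)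
Lemma energy_inv_fourier g : cintegrable g ->
  (energy (inv_fourier_on setT g) <= energy g)%E.
Proof.
move=> gi; rewrite inv_fourierE// energyZ; last exact: cmeasurable_transform.
have h := energy_transform (normr1 _) gi.
apply: (@le_trans _ _ ((sqn (((2 * pi)^-1)%:C : R[i]))%:E * ((4 * pi)%:E * energy g))%E).
  by rewrite lee_wpmul2l// lee_fin sqn_ge0.
rewrite muleA -EFinM -[leRHS]mul1e lee_wpmul2r ?energy_on_ge0// lee_fin.
rewrite /sqn/= expr0n/= addr0.
have p0 : (pi : R) != 0 by exact: lt0r_neq0 (pi_gt0 R).
have hp (p : R) : p != 0 -> (2 * p)^-1 ^+ 2 * (4 * p) = p^-1.
  by move=> p1; field.
rewrite hp//.
by rewrite invf_le1 ?pi_gt0// (le_trans _ (pi_ge2 R))// ler1n.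
Qed.

Lemma cmeasurable_inv_fourier g : cintegrable g ->
  cmeasurable (inv_fourier_on setT g).
Proof.
move=> gi; rewrite inv_fourierE//; apply: cmeasurableM.
  exact: cmeasurable_cst.
exact: cmeasurable_transform.
Qed.

(** * The inverse transform as an L^2 limit of truncations *)

Definition square_integrable f : Prop := cmeasurable f /\ (energy f < +oo)%E.

Lemma cmeasurable_crestrict D f : measurable D -> cmeasurable f ->
  cmeasurable (crestrict D f).
Proof.
move=> mD [mr mi]; split.
  by under eq_fun do rewrite Re_crestrict; exact: measurable_restrictT.
by under eq_fun do rewrite Im_crestrict; exact: measurable_restrictT.
Qed.

Lemma energy_crestrict D f : energy (crestrict D f) = energy_on D f.
Proof.
rewrite energy_on_mkcond; apply: eq_integral => x _; congr EFin.
rewrite patchE /crestrict; case: ifP => // _.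
by rewrite /sqn/= expr0n addr0.
Qed.

Lemma cintegrable_le f (g : R -> R) : cmeasurable f ->
  mu.-integrable setT (EFin \o g) ->
  (forall x, `|Re (f x)| <= g x) -> (forall x, `|Im (f x)| <= g x) -> cintegrable f.
Proof. by move=> [mr mi] gi r i; split; exact: le_L1 gi. Qed.

Lemma norm_le1Dsqr (r : R) : `|r| <= 1 + r ^+ 2.
Proof.
rewrite -(real_normK (num_real r)); have := sqr_ge0 (`|r| - 1).
have := normr_ge0 r; nra.
Qed.

Lemma norm_Re_le z : `|Re z| <= 1 + sqn z.
Proof. by rewrite (le_trans (norm_le1Dsqr _))// lerD2l lerDl sqr_ge0. Qed.

Lemma norm_Im_le z : `|Im z| <= 1 + sqn z.
Proof. by rewrite (le_trans (norm_le1Dsqr _))// lerD2l lerDr sqr_ge0. Qed.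

Lemma integrable_sqn f : square_integrable f ->
  mu.-integrable setT (EFin \o (fun x => sqn (f x))).
Proof.
move=> [mf ef]; apply/integrableP; split; first by apply/measurable_EFinP; exact: measurable_sqn.
by under eq_integral do rewrite /= ger0_norm ?sqn_ge0//.
Qed.

(** On a bounded set |g| <= 1 + |g|^2 has a finite integral, so the truncated inverse transforms of
    an L^2 function converge absolutely. *)
Lemma square_integrable_cintegrable g (N : R) D : measurable D ->
  D `<=` `[- N, N] -> square_integrable g -> cintegrable (crestrict D g).
Proof.
move=> mD DN gs.
have ie := integrable_sqn gs.
apply: (@cintegrable_le _ (fun x => \1_(`[- N, N]%classic) x + sqn (g x))).
- apply: cmeasurable_crestrict => //; exact: gs.1.
- by apply: L1D => //; exact: integrable_indic_itv.
- move=> x; rewrite /crestrict; case: ifPn => xD.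
    by rewrite indicE mem_set ?norm_Re_le//; apply: DN; exact: set_mem.
  by rewrite normr0 addr_ge0// sqn_ge0.
- move=> x; rewrite /crestrict; case: ifPn => xD.
    by rewrite indicE mem_set ?norm_Im_le//; apply: DN; exact: set_mem.
  by rewrite normr0 addr_ge0// sqn_ge0.
Qed.

Lemma cintegrable_crestrict D f : measurable D -> cintegrable f ->
  cintegrable (crestrict D f).
Proof.
move=> mD [fr fi]; split.
  apply: le_L1 (L1_norm fr).
    under eq_fun do rewrite Re_crestrict.
    by apply: measurable_restrictT => //; exact: integrable_measurable.
  by move=> x; rewrite Re_crestrict patchE; case: ifP => // _; rewrite normr0.
apply: le_L1 (L1_norm fi).
  under eq_fun do rewrite Im_crestrict.
  by apply: measurable_restrictT => //; exact: integrable_measurable.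
by move=> x; rewrite Im_crestrict patchE; case: ifP => // _; rewrite normr0.
Qed.

Lemma cintegrableD f g : cintegrable f -> cintegrable g ->
  cintegrable (fun x => f x + g x).
Proof.
move=> [fr fi] [gr gi]; split.
  by under [X in EFin \o X]eq_fun do rewrite ReD; exact: L1D.
by under [X in EFin \o X]eq_fun do rewrite ImD; exact: L1D.
Qed.

Lemma cintegrableZ z f : cintegrable f -> cintegrable (fun x => z * f x).
Proof.
move=> [fr fi]; split.
  by under [X in EFin \o X]eq_fun do rewrite ReM; apply: L1B; exact: L1Z.
by under [X in EFin \o X]eq_fun do rewrite ImM; apply: L1D; exact: L1Z.
Qed.

Lemma transformD s f g : cintegrable f -> cintegrable g -> forall x,
  transform s (fun y => f y + g y) x = transform s f x + transform s g x.
Proof.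
move=> [fr fi] [gr gi] x; rewrite /transform.
have -> : (fun y => Re (f y + g y)) = (fun y => Re (f y) + Re (g y)).
  by apply/funext => y; rewrite ReD.
have -> : (fun y => Im (f y + g y)) = (fun y => Im (f y) + Im (g y)).
  by apply/funext => y; rewrite ImD.
rewrite !cosT_add// !sinT_add//; congr (_ +i* _); ring.
Qed.

Lemma transformZ s z f : cintegrable f -> forall x,
  transform s (fun y => z * f y) x = z * transform s f x.
Proof.
move=> [fr fi] x; rewrite /transform.
have -> : (fun y => Re (z * f y)) = (fun y => Re z * Re (f y) + (- Im z) * Im (f y)).
  by apply/funext => y; rewrite ReM mulNr.
have -> : (fun y => Im (z * f y)) = (fun y => Re z * Im (f y) + Im z * Re (f y)).
  by apply/funext => y; rewrite ImM.
rewrite !cosT_add ?sinT_add ?cosT_scale ?sinT_scale//; try exact: L1Z.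
by case: z => a b /=; congr (_ +i* _); ring.
Qed.

Lemma crestrictD D f g : crestrict D (fun y => f y + g y) =
  (fun y => crestrict D f y + crestrict D g y).
Proof. by apply/funext => y; rewrite /crestrict; case: ifP => //; rewrite addr0. Qed.

Lemma crestrictZ D z f : crestrict D (fun y => z * f y) =
  (fun y => z * crestrict D f y).
Proof. by apply/funext => y; rewrite /crestrict; case: ifP => //; rewrite mulr0. Qed.

Lemma inv_fourierD f g : cintegrable f -> cintegrable g ->
  forall x, inv_fourier_on setT (fun y => f y + g y) x =
  inv_fourier_on setT f x + inv_fourier_on setT g x.
Proof.
move=> fi gi x; rewrite !inv_fourierE//; last exact: cintegrableD.
by rewrite transformD// mulrDr.
Qed.

Lemma inv_fourierZ z f : cintegrable f ->
  forall x, inv_fourier_on setT (fun y => z * f y) x = z * inv_fourier_on setT f x.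
Proof.
move=> fi x; rewrite !inv_fourierE//; last exact: cintegrableZ.
by rewrite transformZ// mulrCA.
Qed.

Lemma inv_fourier_on_setD A B g : measurable A -> measurable B -> A `<=` B ->
  cintegrable (crestrict B g) -> forall x,
  inv_fourier_on B g x - inv_fourier_on A g x = inv_fourier_on (B `\` A) g x.
Proof.
move=> mA mB AB gi x.
have restr C : measurable C -> C `<=` B -> cintegrable (crestrict C g).
  move=> mC CB; have -> : crestrict C g = crestrict C (crestrict B g).
    apply/funext => y; rewrite /crestrict; case: ifPn => // yC.
    by rewrite mem_set//; apply: CB; exact: set_mem.
  exact: cintegrable_crestrict.
have gA := restr A mA AB.
have gBA : cintegrable (crestrict (B `\` A) g).
  by apply: restr; [exact: measurableD|exact: subDsetl].
have gE : crestrict B g = (fun y => crestrict (B `\` A) g y + crestrict A g y).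
  apply/funext => y; rewrite /crestrict in_setD.
  have [yA|yA] /= := boolP (y \in A).
    by rewrite andbF add0r (mem_set (AB _ (set_mem yA))).
  by rewrite addr0 andbT.
by rewrite !(inv_fourier_on_mkcond _ g) gE inv_fourierD// addrK.
Qed.

Lemma energy_inv_fourier_on D g : cintegrable (crestrict D g) ->
  (energy (inv_fourier_on D g) <= energy_on D g)%E.
Proof.
by move=> gi; rewrite inv_fourier_on_mkcond -energy_crestrict; exact: energy_inv_fourier.
Qed.

(** Dominated convergence outside [-n, n]. Allowing every [D] disjoint from [-N, N] covers both the
    shells between two truncations and the full complement. *)
Lemma energy_on_tail g : square_integrable g -> forall e : R, 0 < e ->
  exists2 N : R, 0 <= N & forall D, measurable D -> D `&` `[- N, N] = set0 ->
    (energy_on D g <= e%:E)%E.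
Proof.
move=> gs e e0.
have ie := integrable_sqn gs.
pose F (n : nat) x := ((fun x => sqn (g x)) \_ (~` `[- n%:R, n%:R])) x.
have mF n : measurable_fun setT (F n).
  by apply: measurable_restrictT; [exact: measurableC|exact: integrable_measurable].
have F0 n x : 0 <= F n x by rewrite /F patchE; case: ifP => // _; exact: sqn_ge0.
have iF n : mu.-integrable setT (EFin \o F n).
  apply: le_L1 ie => // x; rewrite ger0_norm// /F patchE; case: ifP => // _.
  exact: sqn_ge0.
have h : \int[mu]_x F n x @[n --> \oo] --> \int[mu]_(x in setT) (0 : R).
  apply: (@dominated_cvg_Rintegral _ _ _ (fun x => sqn (g x))) => //.
  - move=> x; apply: cvg_near_cst; near=> n; rewrite /F patchE memNset//=.
    apply; rewrite /= in_itv/= -ler_norml.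
    by near: n; exact: nbhs_infty_ger.
  - move=> n x; rewrite ger0_norm// /F patchE; case: ifP => // _.
    exact: sqn_ge0.
rewrite Rintegral_cst// mul0r in h.
have /cvgrPdist_le/(_ _ e0)[n _ /(_ n (leqnn n))] := h.
rewrite /= sub0r normrN ger0_norm; last by apply: Rintegral_ge0 => x _; exact: F0.
move=> Fe; exists n%:R => // D mD Dn.
apply: (@le_trans _ _ (\int[mu]_x F n x)%:E); last by rewrite lee_fin.
rewrite energy_on_mkcond /Rintegral fineK; last exact: (integrable_fin_num measurableT (iF n)).
apply: ge0_le_integral => //.
- by move=> x _; rewrite lee_fin patchE; case: ifP => // _; exact: sqn_ge0.
- apply/measurable_EFinP; apply: measurable_restrictT => //.
  exact: integrable_measurable.
- by apply/measurable_EFinP; exact: mF.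
- move=> x _; rewrite lee_fin patchE; case: ifPn => // /set_mem xD.
  rewrite /F patchE mem_set// => xn.
  by have : (D `&` `[- n%:R, n%:R]) x by []; rewrite Dn.
Unshelve. all: by end_near. Qed.

(** The epsilon form of [is_inv_fourier2], phrased with squared norms so that [energyD] and
    [energyZ] apply directly. *)
Definition l2_inv_fourier g w : Prop := cmeasurable w /\
  forall e : R, 0 < e -> exists N0 : R, forall N, N0 <= N ->
    (energy (fun x => w x - inv_fourier_on `[- N, N] g x)%R <= e%:E)%E.

Lemma is_inv_fourier2P g w : is_inv_fourier2 g w <-> l2_inv_fourier g w.
Proof.
split=> -[mw h]; split => //.
  move=> e e0.
  have /fine_cvgP[fin hc] := h.
  have s0 : 0 < Num.sqrt e by rewrite sqrtr_gt0.
  have /cvgrPdist_le/(_ _ s0) hc' := hc.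
  have [N0 [_ N0P]] : \forall N \near +oo, (energy (fun x => w x - inv_fourier_on `[- N, N] g x)%R <= e%:E)%E.
    near=> N.
    have := LpNorm2_le (fun x => w x - inv_fourier_on `[- N, N] g x) (sqrtr_ge0 e).
    rewrite sqr_sqrtr ?(ltW e0)// => <-.
    have fN : LpNorm 2%:E (fun x => w x - inv_fourier_on `[- N, N] g x)%R \is a fin_num.
      by near: N.
    rewrite -(fineK fN) lee_fin.
    have : `|0 - fine (LpNorm 2%:E (fun x => w x - inv_fourier_on `[- N, N] g x)%R)| <= Num.sqrt e.
      by near: N.
    by rewrite sub0r normrN; apply: le_trans; exact: ler_norm.
  (* The filter at +oo speaks of N > N0; the shift by 1 accommodates the weak inequality. *)
  by exists (N0 + 1) => N NN; apply: N0P; rewrite (lt_le_trans _ NN)// ltrDl.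
have h' (e : R) : 0 < e -> \forall N \near +oo%R,
   (LpNorm 2%:E (fun x => w x - inv_fourier_on `[- N, N] g x)%R <= e%:E)%E.
  move=> e0; have [N0 N0P] := h (e ^+ 2) (exprn_gt0 _ e0).
  near=> N.
  rewrite (LpNorm2_le (fun x => w x - inv_fourier_on `[- N, N] g x) (ltW e0)).
  by apply: N0P; near: N; apply: nbhs_pinfty_ge; exact: num_real.
have ge0 N : (0 <= LpNorm 2%:E (fun x => w x - inv_fourier_on `[- N, N] g x)%R)%E.
  exact: Lnorm_ge0.
apply/fine_cvgP; split.
  have := h' 1 ltr01; apply: filterS => N hN.
  by rewrite ge0_fin_numE// (le_lt_trans hN)// ltry.
apply/cvgrPdist_le => e e0; have := h' e e0; apply: filterS => N hN.
rewrite sub0r normrN /= ger0_norm ?fine_ge0// -lee_fin fineK//.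
by rewrite ge0_fin_numE// (le_lt_trans hN)// ltry.
Unshelve. all: by end_near. Qed.

Lemma crestrict_itv_cintegrable g (N : R) : square_integrable g ->
  cintegrable (crestrict `[- N, N] g).
Proof. by move=> gs; apply: (@square_integrable_cintegrable _ N). Qed.

Lemma cmeasurable_inv_fourier_on D g : cintegrable (crestrict D g) ->
  cmeasurable (inv_fourier_on D g).
Proof. by move=> gi; rewrite inv_fourier_on_mkcond; exact: cmeasurable_inv_fourier. Qed.

Lemma square_integrableD f g : square_integrable f -> square_integrable g ->
  square_integrable (fun x => f x + g x).
Proof.
move=> [mf ef] [mg eg]; split; first exact: cmeasurableD.
apply: (le_lt_trans (energyD mf mg)).
by rewrite lte_add_pinfty// lte_mul_pinfty// lee_fin.
Qed.

Lemma square_integrableZ z f : square_integrable f ->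
  square_integrable (fun x => z * f x).
Proof.
move=> [mf ef]; split; first exact/cmeasurableM/mf/cmeasurable_cst.
by rewrite energyZ// lte_mul_pinfty// lee_fin sqn_ge0.
Qed.

Lemma lee_2D (u v : \bar R) (a b : R) : (u <= a%:E -> v <= b%:E ->
  2%:E * u + 2%:E * v <= (2 * a + 2 * b)%:E)%E.
Proof.
move=> ua vb; rewrite (EFinD (2 * a)) (EFinM 2 a) (EFinM 2 b).
by apply: leeD; rewrite lee_wpmul2l ?lee_fin.
Qed.

Lemma l2_inv_fourierD f g wf wg : square_integrable f -> square_integrable g ->
  l2_inv_fourier f wf -> l2_inv_fourier g wg ->
  l2_inv_fourier (fun x => f x + g x) (fun x => wf x + wg x).
Proof.
move=> fs gs [mwf hf] [mwg hg]; split; first exact: cmeasurableD.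
move=> e e0; have e40 : 0 < e / 4 by rewrite divr_gt0.
have [N1 N1P] := hf _ e40; have [N2 N2P] := hg _ e40.
exists (Num.max N1 N2) => N; rewrite ge_max => /andP[/N1P h1 /N2P h2].
have fi := crestrict_itv_cintegrable N fs; have gi := crestrict_itv_cintegrable N gs.
have -> : (fun x => wf x + wg x - inv_fourier_on `[- N, N] (fun y => f y + g y) x) =
   (fun x => (wf x - inv_fourier_on `[- N, N] f x) + (wg x - inv_fourier_on `[- N, N] g x)).
  apply/funext => x; rewrite !(inv_fourier_on_mkcond `[- N, N]) crestrictD inv_fourierD//.
  by rewrite opprD addrACA.
apply: (le_trans (energyD _ _)).
- by apply: cmeasurableB => //; exact: cmeasurable_inv_fourier_on.
- by apply: cmeasurableB => //; exact: cmeasurable_inv_fourier_on.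
by apply: (le_trans (lee_2D h1 h2)); rewrite lee_fin; lra.
Qed.

Lemma l2_inv_fourierZ z f wf : square_integrable f -> l2_inv_fourier f wf ->
  l2_inv_fourier (fun x => z * f x) (fun x => z * wf x).
Proof.
move=> fs [mwf hf]; split; first exact/cmeasurableM/mwf/cmeasurable_cst.
move=> e e0; have s0 : 0 < 1 + sqn z by rewrite ltr_pwDl// sqn_ge0.
have [|N0 N0P] := hf (e / (1 + sqn z)); first by rewrite divr_gt0.
exists N0 => N /N0P hN.
have fi := crestrict_itv_cintegrable N fs.
have -> : (fun x => z * wf x - inv_fourier_on `[- N, N] (fun y => z * f y) x) =
   (fun x => z * (wf x - inv_fourier_on `[- N, N] f x)).
  apply/funext => x; rewrite !(inv_fourier_on_mkcond `[- N, N]) crestrictZ inv_fourierZ//.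
  by rewrite mulrBr.
rewrite energyZ; last by apply: cmeasurableB => //; exact: cmeasurable_inv_fourier_on.
apply: (@le_trans _ _ ((sqn z)%:E * (e / (1 + sqn z))%:E)%E).
  by rewrite lee_wpmul2l// lee_fin sqn_ge0.
by rewrite -EFinM lee_fin mulrCA (ler_piMr (ltW e0))// ler_pdivrMr// mul1r lerDr.
Qed.

(** Up to arbitrarily small energy [w] is a truncated inverse transform, whose energy is at most
    that of [g]; the 2 is the cost of the squared triangle inequality. *)
Lemma l2_inv_fourier_energy g w : square_integrable g -> l2_inv_fourier g w ->
  (energy w <= 2%:E * energy g)%E.
Proof.
move=> gs [mw h]; apply/lee_addgt0Pr => e e0.
have [N /(_ N (lexx _)) hN] := h (e / 2) (divr_gt0 e0 (ltr0n _ 2)).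
have gi := crestrict_itv_cintegrable N gs.
have mN := cmeasurable_inv_fourier_on gi.
have -> : w = (fun x => (w x - inv_fourier_on `[- N, N] g x) + inv_fourier_on `[- N, N] g x).
  by apply/funext => x; rewrite subrK.
apply: (le_trans (energyD (cmeasurableB mw mN) mN)).
rewrite addeC; apply: leeD.
  rewrite lee_wpmul2l ?lee_fin//; apply: (le_trans (energy_inv_fourier_on gi)).
  apply: ge0_subset_integral => //.
    by apply/measurable_EFinP; apply: measurable_sqn; exact: gs.1.
  by move=> x _; rewrite lee_fin sqn_ge0.
apply: (@le_trans _ _ (2%:E * (e / 2)%:E)%E); first by rewrite lee_wpmul2l ?lee_fin.
by rewrite -EFinM lee_fin mulrC divfK.
Qed.

(** The part not yet covered by a truncation is the inverse transform of a tail of [g]. This brings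
    [G] and its derivative, given by absolutely convergent integrals, under the same relation as the
    multipliers. *)
Lemma l2_inv_fourier_integrable g : square_integrable g -> cintegrable g ->
  l2_inv_fourier g (inv_fourier_on setT g).
Proof.
move=> gs gi; split; first exact: cmeasurable_inv_fourier.
move=> e e0; have [N0 N00 N0P] := energy_on_tail gs e0.
exists N0 => N N0N.
have gi' : cintegrable (crestrict setT g) by exact: cintegrable_crestrict.
have -> : (fun x => inv_fourier_on setT g x - inv_fourier_on `[- N, N] g x) =
    inv_fourier_on (setT `\` `[- N, N]) g.
  by apply/funext => x; rewrite inv_fourier_on_setD.
have mD : measurable (setT `\` `[- N, N] : set R) by exact: measurableD.
apply: (le_trans (energy_inv_fourier_on (cintegrable_crestrict mD gi))).
apply: N0P => //; apply/seteqP; split=> // x [[_ xN]]; rewrite /= !in_itv/= => /andP[h1 h2].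
by apply: xN; rewrite /= in_itv/= (le_trans h2)// (le_trans _ h1)// lerN2.
Qed.

(** Two truncations differ by the inverse transform of [g] over a shell, whose energy is a tail of
    the energy of [g]. *)
Lemma energy_inv_fourier_cauchy g : square_integrable g -> forall e : R, 0 < e ->
  exists2 N0 : R, 0 <= N0 & forall N M, N0 <= N -> N0 <= M ->
   (energy (fun x => inv_fourier_on `[- M, M] g x - inv_fourier_on `[- N, N] g x)%R <= e%:E)%E.
Proof.
move=> gs e e0; have [N0 N00 N0P] := energy_on_tail gs e0.
exists N0 => // N M.
wlog NM : N M / N <= M.
  move=> H h1 h2; have [NM|/ltW MN] := leP N M; first exact: H.
  have -> : energy (fun x => inv_fourier_on `[- M, M] g x - inv_fourier_on `[- N, N] g x) =
     energy (fun x => inv_fourier_on `[- N, N] g x - inv_fourier_on `[- M, M] g x).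
    by apply: eq_integral => x _; rewrite -sqnN opprB.
  exact: H.
move=> N0N N0M.
have gi := crestrict_itv_cintegrable M gs.
have -> : (fun x => inv_fourier_on `[- M, M] g x - inv_fourier_on `[- N, N] g x) =
    inv_fourier_on (`[- M, M] `\` `[- N, N]) g.
  apply/funext => x; rewrite inv_fourier_on_setD// => y.
  rewrite /= !in_itv/= => /andP[h1 h2].
  by rewrite (le_trans h2)// (le_trans _ h1)// lerN2.
have mD : measurable (`[- M, M] `\` `[- N, N] : set R) by exact: measurableD.
have gD : cintegrable (crestrict (`[- M, M] `\` `[- N, N]) g).
  by apply: (@square_integrable_cintegrable _ M) => //; exact: subDsetl.
apply: (le_trans (energy_inv_fourier_on gD)).
apply: N0P => //; apply/seteqP; split=> // x [[_ xN]]; rewrite /= !in_itv/= => /andP[h1 h2].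
by apply: xN; rewrite /= in_itv/= (le_trans h2)// (le_trans _ h1)// lerN2.
Qed.

Lemma l2_inv_fourier_exists g : square_integrable g -> exists w, l2_inv_fourier g w.
Proof.
move=> gs.
have /choice[n_ n_P] : forall k : nat, exists N0 : R, 0 <= N0 /\
    forall N M, N0 <= N -> N0 <= M ->
    (energy (fun x => inv_fourier_on `[- M, M] g x - inv_fourier_on `[- N, N] g x)%R
     <= (16%:R^-1 ^+ k)%:E)%E.
  move=> k; have [|N0 ? ?] := energy_inv_fourier_cauchy gs (e := 16%:R^-1 ^+ k).
    by rewrite exprn_gt0.
  by exists N0.
(* Partial sums make the radii increase and dominate each [n_ k]; the summand k makes them
   unbounded. *)
pose N k := \sum_(i < k.+1) n_ i + k%:R.
have n0 k : 0 <= n_ k by case: (n_P k).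
have nN k : n_ k <= N k by rewrite /N big_ord_recr/= -addrA addrCA lerDl addr_ge0// sumr_ge0.
have NS k : N k <= N k.+1 by rewrite /N lerD// ?ler_nat// [leRHS]big_ord_recr/= lerDl.
pose u k := inv_fourier_on `[- N k, N k] g.
have mu_ k : cmeasurable (u k).
  by apply: cmeasurable_inv_fourier_on; exact: crestrict_itv_cintegrable.
have uE k : (energy (fun x => u k.+1 x - u k x)%R <= (16%:R^-1 ^+ k)%:E)%E.
  by apply: (n_P k).2 => //; exact: le_trans (NS k).
have component (p : R[i] -> R) : (forall z1 z2, p (z1 - z2) = p z1 - p z2) ->
    (forall z, p z ^+ 2 <= sqn z) -> (forall k, measurable_fun setT (fun x => p (u k x))) ->
    exists w : R -> R, measurable_fun setT w /\
      {ae mu, forall x, p (u k x) @[k --> \oo] --> w x}.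
  move=> pB psq mp; apply: riesz_fischer => // k.
  apply: le_trans (uE k); apply: ge0_le_integral => //.
  - by move=> x _; rewrite lee_fin sqr_ge0.
  - by apply/measurable_EFinP; exact: (measurable_funX _ (measurable_funB (mp k.+1) (mp k))).
  - by apply/measurable_EFinP; apply: measurable_sqn; exact: cmeasurableB.
  - by move=> x _; rewrite lee_fin -pB.
have [||k|wr [mwr hwr]] := component (@complex.Re R).
- by move=> z1 z2; rewrite ReD ReN.
- by move=> z; rewrite lerDl sqr_ge0.
- exact: (mu_ k).1.
have [||k|wi [mwi hwi]] := component (@complex.Im R).
- by move=> z1 z2; rewrite ImD ImN.
- by move=> z; rewrite lerDr sqr_ge0.
- exact: (mu_ k).2.
exists (fun x => wr x +i* wi x); have mw : cmeasurable (fun x => wr x +i* wi x) by [].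
split => // e e0.
have [N0 N00 N0P] := energy_inv_fourier_cauchy gs e0.
have [k0 k0P] : exists k0, forall k, (k0 <= k)%N -> N0 <= N k.
  exists (Num.trunc N0).+1 => k k0k.
  have : N0 <= k%:R.
    by rewrite (le_trans (ltW (truncnS_gt N0)))// ler_nat.
  by move=> /le_trans; apply; rewrite /N lerDr sumr_ge0.
exists N0 => M N0M.
set v := inv_fourier_on `[- M, M] g.
have mv : cmeasurable v.
  by apply: cmeasurable_inv_fourier_on; exact: crestrict_itv_cintegrable.
have mF k : measurable_fun setT (fun x => (sqn (u k x - v x))%:E).
  by apply/measurable_EFinP; apply: measurable_sqn; exact: cmeasurableB.
(* Fatou turns almost everywhere convergence of the subsequence [u] into an L^2 estimate for every
   large truncation [v]: the energy of the limit minus [v] is at most the lower limit of the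
   energies of u k - v, all small by the Cauchy property. *)
apply: (@le_trans _ _ (\int[mu]_x limn_einf (fun k => (sqn (u k x - v x))%:E))%E).
  apply: ae_ge0_le_integral => //.
  - by move=> x _; rewrite lee_fin sqn_ge0.
  - by apply/measurable_EFinP; apply: measurable_sqn; exact: cmeasurableB.
  - move=> x _; rewrite limn_einf_lim; apply: lime_ge; first exact: is_cvg_einfs.
    apply: nearW => k; apply: le_ereal_inf_tmp => _ [j _ <-].
    by rewrite lee_fin sqn_ge0.
  - apply: (emeasurable_fun_cvg (fun n x => einfs (fun k => (sqn (u k x - v x))%:E) n)).
      by move=> n; exact: (measurable_fun_einfs mF n).
    by move=> x _; rewrite limn_einf_lim; exact: is_cvg_einfs.
  - apply: (ae_imply2 hwr hwi) => x hr hi _.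
    have h : (sqn (u k x - v x))%:E @[k --> \oo] --> (sqn ((wr x +i* wi x) - v x))%:E.
      apply: cvg_EFin; first exact: nearW.
      rewrite /sqn; under eq_fun do rewrite ReD ImD ReN ImN.
      rewrite ReD ImD ReN ImN /=.
      by apply: cvgD; rewrite !expr2; under eq_fun do rewrite expr2;
        apply: cvgM; (apply: cvgB; last exact: cvg_cst).
    by rewrite (cvg_limn_einf_sup h).1.
apply: (le_trans (fatou mu measurableT mF _)); first by move=> k x _; rewrite lee_fin sqn_ge0.
rewrite limn_einf_lim; apply: lime_le; first exact: is_cvg_einfs.
apply: nearW => k.
apply: (@le_trans _ _ (energy (fun x => u (k + k0)%N x - v x)%R)).
  by apply: ereal_inf_lbound; exists (k + k0)%N => //=; exact: leq_addr.
by apply: N0P => //; apply: k0P; exact: leq_addl.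
Qed.

Lemma is_inv_fourier2_inv_fourier2 g : square_integrable g ->
  l2_inv_fourier g (inv_fourier2 g).
Proof.
move=> gs; apply/is_inv_fourier2P; apply: xgetPex.
by have [w /is_inv_fourier2P hw] := l2_inv_fourier_exists gs; exists w.
Qed.

End ComplexL2.

(** * Elementary inequalities for sine, cosine, powers and the exponential *)

Section Elementary.
Local Open Scope classical_set_scope.
Context {R : realType}.
Implicit Types x y z c : R.

Lemma norm_sin_le x : `|sin x| <= `|x|.
Proof.
wlog x0 : x / 0 <= x.
  move=> H; have [|/ltW x0] := leP 0 x; first exact: H.
  by rewrite -normrN -sinN -(normrN x) H// oppr_ge0.
have [|c _] := @MVT_segment _ sin cos 0 x x0.
  by apply: continuous_subspaceT; exact: continuous_sin.
rewrite sin0 !subr0 => ->; rewrite normrM.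
by rewrite ler_piMl// cos_max.
Qed.

Lemma norm_1Bcos x : `|cos x - 1| = 2 * sin (x / 2) ^+ 2.
Proof.
have -> : cos x - 1 = - (2 * sin (x / 2) ^+ 2).
  have {1}-> : x = (x / 2) *+ 2 by rewrite -mulr_natr; field.
  by rewrite cos_mulr2n cos2sin2; ring.
by rewrite normrN ger0_norm// mulr_ge0// sqr_ge0.
Qed.

Lemma norm_1Bcos_le_sqr x : `|cos x - 1| <= x ^+ 2.
Proof.
rewrite norm_1Bcos -(real_normK (num_real (sin _))).
have : `|sin (x / 2)| ^+ 2 <= `|x / 2| ^+ 2.
  by rewrite lerXn2r ?nnegrE// norm_sin_le.
rewrite (real_normK (num_real (x / 2))) => h.
by have := sqr_ge0 x; rewrite exprMn in h; lra.
Qed.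

Lemma norm_1Bcos_le x : `|cos x - 1| <= `|x|.
Proof.
rewrite norm_1Bcos -(real_normK (num_real (sin _))).
have h := norm_sin_le (x / 2); rewrite normrM (ger0_norm (_ : 0 <= 2^-1)) ?invr_ge0// in h.
have := sin_max (x / 2); have := normr_ge0 (sin (x / 2)); have := normr_ge0 x; nra.
Qed.

(** Mean value theorem, the derivative being cos - 1. A quadratic bound is kept instead of a cubic
    one to match [norm_1Bcos_le_sqr] in the second-order remainder of the exponential. *)
Lemma norm_sinB_le x : `|sin x - x| <= x ^+ 2.
Proof.
wlog x0 : x / 0 <= x.
  move=> H; have [|/ltW x0] := leP 0 x; first exact: H.
  have := H (- x); by rewrite sinN sqrrN -opprD normrN; apply; rewrite oppr_ge0.
have [|c /[!in_itv]/= /andP[c0 cx]] := @MVT_segment _ (fun x => sin x - x) (fun x => cos x - 1) 0 x x0.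
  apply: continuous_subspaceT => y; apply: cvgB; first exact: continuous_sin.
  exact: cvg_id.
rewrite sin0 !subr0 => ->; rewrite normrM (ger0_norm x0) expr2 ler_wpM2r//.
by rewrite (le_trans (norm_1Bcos_le _))// ger0_norm.
Qed.

Lemma continuous_cosMr x : continuous (fun y => cos (y * x)).
Proof.
rewrite (_ : (fun y => _) = (fun y => cos (x * y))); first exact: continuous_cosM.
by apply/funext => y; rewrite mulrC.
Qed.

Lemma continuous_sinMr x : continuous (fun y => sin (y * x)).
Proof.
rewrite (_ : (fun y => _) = (fun y => sin (x * y))); first exact: continuous_sinM.
by apply/funext => y; rewrite mulrC.
Qed.

(** Only the origin is delicate: there 1 <= c squeezes the power between 0 and |y|. *)
Lemma continuous_powR_norm c : 1 <= c -> continuous (fun x : R => `|x| `^ c).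
Proof.
move=> c1 x; have [->|x0] := eqVneq x 0.
  rewrite /continuous_at normr0 powR0; last by rewrite gt_eqF// (lt_le_trans ltr01).
  apply: (@squeeze_cvgr _ _ _ _ (cst 0) (fun y : R => `|y|)).
  - near=> y; rewrite powR_ge0/=.
    have [->|y0] := eqVneq y 0; first by rewrite normr0 powR0// gt_eqF// (lt_le_trans ltr01).
    apply: ge1r_powR => //; rewrite normr_gt0 y0/=.
    near: y; apply/nbhs_ballP; exists 1 => //= y; rewrite /ball/= sub0r normrN; exact: ltW.
  - exact: cvg_cst.
  - by rewrite -[X in _ --> X](@normr0 _ R); exact: norm_continuous.
have -> : (fun x1 : R => `|x1| `^ c) = (fun y => y `^ c) \o (fun y : R => `|y|) by [].
apply: continuous_comp; first exact: norm_continuous.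
apply/differentiable_continuous/derivable1_diffP.
by apply: derivable_powR; rewrite in_itv/= andbT normr_gt0.
Unshelve. all: by end_near. Qed.

Lemma powR_norm_derive c x : 0 < x ->
  is_derive x 1 (fun y => `|y| `^ c) (c * x `^ (c - 1)).
Proof.
move=> x0; apply: near_eq_is_derive (is_derive1_powR c x0).
near=> y; rewrite gtr0_norm//; near: y; exact: lt_nbhsr.
Unshelve. all: by end_near. Qed.

(** The single term x^(n+1) / (n+1)! of the exponential series at x = 1 + z/2 gives (1 + z/2)^(n+1)
    <= (n+1)! e e^(z/2); the factor 2^(n+1) comes from 1 + z <= 2 (1 + z/2). *)
Lemma expR_poly_le n : exists2 B : R, 0 < B &
  forall z, 0 <= z -> (1 + z) ^+ n.+1 * expR (- (z / 2)) <= B.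
Proof.
exists (2 ^+ n.+1 * (n.+1`!%:R * expR 1)).
  by rewrite !mulr_gt0 ?exprn_gt0 ?expR_gt0// ltr0n fact_gt0.
move=> z z0; rewrite expRN ler_pdivrMr ?expR_gt0//.
have h0 : 0 <= 1 + z / 2 by rewrite addr_ge0// divr_ge0.
have h : (1 + z / 2) ^+ n.+1 <= n.+1`!%:R * (expR 1 * expR (z / 2)).
  rewrite -ler_pdivrMl ?ltr0n ?fact_gt0// mulrC -expRD.
  by apply: le_trans (expR_ge1Dxn n h0); rewrite lerDr.
apply: (@le_trans _ _ ((2 * (1 + z / 2)) ^+ n.+1)).
  by apply: lerXn2r; rewrite ?nnegrE ?addr_ge0 ?mulr_ge0//; lra.
by rewrite exprMn -!mulrA ler_wpM2l ?exprn_ge0.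
Qed.

End Elementary.

(** * The heat symbol and its similarity scale t^(1/m) *)

Section Kernel.
Local Open Scope classical_set_scope.
Context {R : realType}.
Variables (B m t : R).
Hypotheses (m2 : 2 < m) (t0 : 0 < t).
(* Exponent 10: eight powers absorb the square of the factor (1 + t |xi|^m)^4
   of [symbol_error_le], two make up for [weight]. *)
Hypothesis expR_poly :
  forall z : R, 0 <= z -> (1 + z) ^+ 10 * expR (- (z / 2)) <= B.
Local Notation mu := (@lebesgue_measure R).
Local Notation L1 f := (mu.-integrable setT (EFin \o (f : R -> R))).

Definition symb (xi : R) : R := `|xi| `^ m.
Definition heat (xi : R) : R := expR (- (t * symb xi)).
Definition scale : R := t `^ m^-1.
(** A Lorentzian in the similarity variable, thus a multiple of a Poisson kernel. Its integral pi /
    [scale] is the source of the factor t^(-1/(2m)) in the final L^2 bound. *)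
Definition weight (xi : R) : R := (1 + (scale * xi) ^+ 2)^-1.

Lemma m_gt0 : 0 < m. Proof. by rewrite (lt_trans _ m2). Qed.

Lemma scale_gt0 : 0 < scale. Proof. exact: powR_gt0. Qed.

Lemma symb_ge0 xi : 0 <= symb xi. Proof. exact: powR_ge0. Qed.

Lemma symbN xi : symb (- xi) = symb xi. Proof. by rewrite /symb normrN. Qed.

Lemma continuous_symb : continuous symb.
Proof. by apply: continuous_powR_norm; rewrite ltW// (lt_trans _ m2)// ltr1n. Qed.

Lemma scale_symb xi : (scale * `|xi|) `^ m = t * symb xi.
Proof.
rewrite powRM ?powR_ge0// /scale -powRrM mulVf ?gt_eqF ?m_gt0// powRr1//.
exact: ltW.
Qed.

(** For y = t^(1/m) |xi| either y <= 1 or y <= y^m. Every power of the scaled frequency can thus be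
    absorbed into powers of 1 + t |xi|^m. *)
Lemma scale_le xi : scale * `|xi| <= 1 + t * symb xi.
Proof.
rewrite -scale_symb; have [y1|y1] := leP (scale * `|xi|) 1.
  by rewrite (le_trans y1)// lerDl powR_ge0.
rewrite (le_trans (le1r_powR (ltW y1) (_ : 1 <= m))) ?lerDr//.
by rewrite ltW// (lt_trans _ m2)// ltr1n.
Qed.

Lemma weight_ge0 xi : 0 <= weight xi.
Proof. by rewrite invr_ge0 addr_ge0// sqr_ge0. Qed.

(** Two of the ten available powers are traded for the weight, through 1 + y^2 <= 2 (1 + z)^2 with y
    the scaled frequency. *)
Lemma decay xi : (1 + t * symb xi) ^+ 8 * expR (- (t * symb xi / 2)) <=
  2 * B * weight xi.
Proof.
set z := t * symb xi.
have z0 : 0 <= z by rewrite mulr_ge0 ?symb_ge0 ?ltW.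
rewrite ler_pdivlMr ?ltr_pwDl ?sqr_ge0//.
have y1 : (scale * xi) ^+ 2 <= (1 + z) ^+ 2.
  rewrite -(real_normK (num_real (scale * xi))) normrM (ger0_norm (ltW scale_gt0)).
  have h1 := scale_le xi; have s0 := ltW scale_gt0.
  apply: lerXn2r; [by rewrite nnegrE mulr_ge0|by rewrite nnegrE addr_ge0|exact: h1].
have h : 1 + (scale * xi) ^+ 2 <= 2 * (1 + z) ^+ 2.
  have : 1 <= (1 + z) ^+ 2 by rewrite exprn_ege1// lerDl.
  lra.
apply: (@le_trans _ _ ((1 + z) ^+ 8 * expR (- (z / 2)) * (2 * (1 + z) ^+ 2))).
  by rewrite ler_wpM2l// mulr_ge0 ?expR_ge0 ?exprn_ge0 ?addr_ge0.
have -> : (1 + z) ^+ 8 * expR (- (z / 2)) * (2 * (1 + z) ^+ 2) =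
  2 * ((1 + z) ^+ 10 * expR (- (z / 2))) by ring.
by rewrite ler_wpM2l// expR_poly.
Qed.

Lemma weightE xi : weight xi = (2 * scale)^-1 * poisson scale^-1 xi.
Proof.
rewrite /weight /poisson; have s0 := scale_gt0; move: scale s0 => s s0.
have s1 : s != 0 by rewrite gt_eqF.
by field; rewrite s1/= gt_eqF// ltr_pwDl// sqr_ge0.
Qed.

Lemma L1_weight : L1 weight.
Proof.
rewrite (_ : weight = fun x => (2 * scale)^-1 * poisson scale^-1 (x - 0)).
  by apply: L1Z; apply: L1_poisson; rewrite invr_gt0 scale_gt0.
by apply/funext => x; rewrite subr0 weightE.
Qed.

Lemma integral_weight : (\int[mu]_x (weight x)%:E = (pi / scale)%:E)%E.
Proof.
have s0 := scale_gt0.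
have i0 : 0 < scale^-1 by rewrite invr_gt0.
transitivity ((2 * scale)^-1%:E * \int[mu]_x (poisson scale^-1 (x - 0))%:E)%E.
  rewrite -ge0_integralZl//.
  - by apply: eq_integral => x _; rewrite weightE subr0 EFinM.
  - exact: (measurable_int mu (L1_poisson 0 i0)).
  - by move=> x _; rewrite lee_fin poisson_ge0.
  - by rewrite lee_fin invr_ge0 mulr_ge0// ltW.
rewrite integral_poisson// -EFinM; congr EFin.
by have := pi_gt0 R; move: (pi : R) => p p0; field; rewrite gt_eqF.
Qed.

Lemma heat_gt0 xi : 0 < heat xi. Proof. exact: expR_gt0. Qed.

Lemma heat_le1 xi : heat xi <= 1.
Proof. by rewrite expR_le1 oppr_le0 mulr_ge0 ?symb_ge0// ltW. Qed.

Lemma heatN xi : heat (- xi) = heat xi. Proof. by rewrite /heat symbN. Qed.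

Lemma continuous_heat : continuous heat.
Proof.
move=> x; apply: continuous_comp; last exact: continuous_expR.
apply: cvgN; apply: cvgM; [exact: cvg_cst|exact: continuous_symb].
Qed.

Lemma heat_decay xi : (1 + t * symb xi) ^+ 8 * heat xi <=
  2 * B * weight xi.
Proof.
apply: le_trans (decay xi).
have z0 : 0 <= t * symb xi by rewrite mulr_ge0 ?symb_ge0 ?ltW.
rewrite ler_wpM2l ?exprn_ge0 ?addr_ge0// ler_expR lerN2; lra.
Qed.

Lemma B_ge0 : 0 <= B.
Proof. by apply: le_trans (expR_poly (lexx 0)); rewrite mulr_ge0 ?expR_ge0. Qed.

Lemma le_heat_weight (f : R -> R) (M : R) (k : nat) : measurable_fun setT f -> (k <= 8)%N ->
  0 <= M -> (forall x, `|f x| <= M * (1 + t * symb x) ^+ k * heat x) -> L1 f.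
Proof.
move=> mf k8 M0 fM.
apply: (le_L1 mf _ (L1Z (M * (2 * B)) L1_weight)) => x.
apply: (le_trans (fM x)); rewrite -!mulrA ler_wpM2l// !mulrA.
apply: (le_trans _ (heat_decay x)); rewrite (ler_wpM2r (ltW (heat_gt0 x)))//.
by apply: ler_weXn2l => //; rewrite lerDl mulr_ge0 ?symb_ge0 ?ltW.
Qed.

Lemma measurable_heat : measurable_fun setT heat.
Proof. exact: continuous_measurable_fun continuous_heat. Qed.

Lemma measurable_symb : measurable_fun setT symb.
Proof. exact: continuous_measurable_fun continuous_symb. Qed.

Lemma z_ge0 xi : 0 <= t * symb xi.
Proof. by rewrite mulr_ge0 ?symb_ge0// ltW. Qed.

Lemma L1_heat : L1 heat.
Proof.
apply: (@le_heat_weight _ 1 0) => //; first exact: measurable_heat.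
by move=> x; rewrite expr0 !mul1r ger0_norm// ltW// heat_gt0.
Qed.

Lemma L1_heat_sqr : L1 (fun x => heat x ^+ 2).
Proof.
apply: (@le_heat_weight _ 1 0) => //.
  by apply: measurable_funX; exact: measurable_heat.
move=> x; rewrite expr0 !mul1r ger0_norm ?sqr_ge0// expr2.
by rewrite ler_piMl ?heat_le1// ltW// heat_gt0.
Qed.

(** Minus the derivative of [heat] on xi > 0, extended evenly. It is continuous through the origin
    because m - 1 >= 1. *)
Definition heat' (xi : R) : R := t * m * (`|xi| `^ (m - 1)) * heat xi.

Lemma continuous_heat' : continuous heat'.
Proof.
move=> x; apply: cvgM; last exact: continuous_heat.
apply: cvgM; first exact: cvg_cst.
by apply: continuous_powR_norm; rewrite lerBrDl ltW.
Qed.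

Lemma heat'_bound x : `|heat' x| <= (m * (t + 1)) * (1 + t * symb x) ^+ 1 * heat x.
Proof.
have m0 := m_gt0; have h0 := ltW (heat_gt0 x).
rewrite normrM (ger0_norm h0) expr1 ler_wpM2r// ger0_norm; last first.
  by rewrite !mulr_ge0 ?powR_ge0// ltW.
have hp : `|x| `^ (m - 1) <= 1 + symb x.
  have [x1|x1] := leP `|x| 1.
    rewrite (@le_trans _ _ 1)// ?lerDl ?symb_ge0//.
    have := @ge0_ler_powR R (m - 1) _ `|x| 1; rewrite powR1; apply; rewrite ?nnegrE//.
    by have := m2; lra.
  rewrite (@le_trans _ _ (symb x))// ?lerDr//.
  by rewrite /symb ler_powR ?ltW// ltrBlDr ltrDl.
apply: (@le_trans _ _ (t * m * (1 + symb x))); first by rewrite ler_wpM2l// mulr_ge0 ?ltW.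
rewrite (mulrC t) -!mulrA ler_wpM2l ?(ltW m0)//.
by have := z_ge0 x; have := t0; have := symb_ge0 x; nra.
Qed.

Lemma L1_heat' : L1 heat'.
Proof.
apply: (le_heat_weight (k := 1) _ _ _ heat'_bound) => //.
  exact: continuous_measurable_fun continuous_heat'.
by rewrite mulr_ge0 ?(ltW m_gt0)// addr_ge0// ltW.
Qed.

Lemma L1_heat'_sqr : L1 (fun x => heat' x ^+ 2).
Proof.
apply: (@le_heat_weight _ ((m * (t + 1)) ^+ 2) 2) => //.
- by apply: measurable_funX; exact: continuous_measurable_fun continuous_heat'.
- exact: sqr_ge0.
- move=> x; rewrite normrX.
  apply: (@le_trans _ _ (((m * (t + 1)) * (1 + t * symb x) ^+ 1 * heat x) ^+ 2)).
    rewrite lerXn2r ?nnegrE ?heat'_bound//.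
    by rewrite (le_trans (normr_ge0 _) (heat'_bound x)).
  rewrite expr1; have h0 := ltW (heat_gt0 x); have h1 := heat_le1 x.
  have := sqr_ge0 ((m * (t + 1)) * (1 + t * symb x)).
  move: (_ * _) (1 + _) (heat x) h0 h1 => q p h h0 h1 qp0.
  have -> : (q * p * h) ^+ 2 = (q * p) ^+ 2 * h * h by ring.
  by rewrite -exprMn ler_piMr// mulr_ge0.
Qed.

(** * Integrability of the kernel and Fourier inversion *)

Lemma sinT_heat x : sinT heat x = 0.
Proof.
apply: continuous_integral_odd.
- move=> y; apply: cvgM; first exact: continuous_heat.
  exact: continuous_sinMr.
- exact: L1_sin L1_heat.
- by move=> y; rewrite heatN mulNr sinN mulrN.
Qed.

Lemma is_derive_heat (x : R) : 0 < x -> is_derive x 1 heat (- heat' x).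
Proof.
move=> x0.
have h := is_derive_scale (- t) (powR_norm_derive m x0).
have := @is_derive1_comp _ expR (fun y => - t * `|y| `^ m) x _ _ (is_derive_expR _) h.
have -> : expR \o (fun y => - t * `|y| `^ m) = heat.
  by apply/funext => y /=; rewrite mulNr.
move=> h'; apply: is_derive_eq h' _.
by rewrite /heat' /heat /symb gtr0_norm// mulNr; ring.
Qed.

Lemma heat_cvg0 : heat x @[x --> +oo] --> (0 : R).
Proof.
apply: (@squeeze_cvgr _ _ _ _ (cst 0) (fun x => expR 1 * expR (- (scale * x)))).
- near=> x; rewrite (ltW (heat_gt0 x))/= -expRD ler_expR.
  have x0 : 0 < x by near: x; apply: nbhs_pinfty_gt; exact: num_real.
  have := scale_le x; rewrite gtr0_norm//; lra.
- exact: cvg_cst.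
- rewrite -(mulr0 (expR 1)); apply: cvgMr.
  by apply: cvgr_expRM; exact: scale_gt0.
Unshelve. all: by end_near. Qed.

(** Integration by parts on the half-line: the boundary terms vanish since sin 0 = 0 and [heat]
    tends to 0. Cutting [heat'] off at 0 presents the result as a sine transform, to which
    [plancherel_le] applies. *)
Lemma mul_cosT_heat x :
  x * cosT heat x = 2 * sinT (heat' \_ `[0, +oo[) x.
Proof.
have cc : continuous (fun y => heat y * cos (y * x)).
  move=> y; apply: cvgM; first exact: continuous_heat.
  exact: continuous_cosMr.
rewrite /cosT (continuous_integral_even cc (L1_cos x L1_heat)); last first.
  by move=> y; rewrite heatN mulNr cosN.
have sE : sinT (heat' \_ `[0, +oo[) x = \int[mu]_(y in `[0, +oo[) (heat' y * sin (y * x)).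
  rewrite Rintegral_mkcond; apply: eq_Rintegral => y _; rewrite !patchE.
  by case: ifP => // _; rewrite mul0r.
rewrite sE.
pose f y := x * (heat y * cos (y * x)) - heat' y * sin (y * x).
have fi : L1 f by apply: L1B; [exact/L1Z/L1_cos/L1_heat|exact/L1_sin/L1_heat'].
have cs : continuous (fun y : R => sin (y * x)) := @continuous_sinMr R x.
have : \int[mu]_(y in `[0, +oo[) f y = 0 - heat 0 * sin (0 * x).
  apply: (integral_itvcy_FTC (F := fun y => heat y * sin (y * x))) => //.
  - move=> y; apply: cvgB; first by apply: cvgMr; exact: cc.
    by apply: cvgM; [exact: continuous_heat'|exact: cs].
  - by move=> y; apply: cvgM; [exact: continuous_heat|exact: cs].
  - move=> y y0; have hd := is_derive_heat y0.
    have hs : is_derive y 1 (fun y => sin (y * x)) (x * cos (x * y)).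
      by under eq_fun do rewrite mulrC; exact: is_derive_sinM.
    apply: is_derive_eq (is_derive_mul hd hs) _.
    by rewrite /f (mulrC x y); ring.
  - apply: (@squeeze_cvgr _ _ _ _ (fun y => - heat y) heat).
    + apply: nearW => y; rewrite -ler_norml normrM (ger0_norm (ltW (heat_gt0 y))).
      by rewrite (ler_piMr (ltW (heat_gt0 y)))// sin_max.
    + by rewrite -[X in _ --> X]oppr0; apply: cvgN; exact: heat_cvg0.
    + exact: heat_cvg0.
rewrite mul0r sin0 mulr0 subr0 RintegralB//; last 2 first.
- exact: integrableS (L1Z x (L1_cos x L1_heat)).
- exact: integrableS (L1_sin x L1_heat').
rewrite RintegralZl//; last exact: integrableS (L1_cos x L1_heat).
by move=> /eqP; rewrite subr_eq0 => /eqP <-; ring.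
Qed.

(* By Plancherel c = cosT heat and x c are square integrable, and
   |c| <= (1 + x^2) c^2 + 2 / (1 + x^2). *)
Lemma L1_cosT_heat : L1 (cosT heat).
Proof.
have mh' := continuous_measurable_fun continuous_heat'.
have hi : L1 (heat' \_ `[0, +oo[).
  apply: (le_L1 _ _ (L1_norm L1_heat')); first exact: measurable_restrictT.
  by move=> x; rewrite patchE; case: ifP => // _; rewrite normr0.
have sq (a : R -> R) : L1 a -> L1 (fun x => a x ^+ 2) -> L1 (fun x => cosT a x ^+ 2 + sinT a x ^+ 2).
  move=> ai a2; apply/integrableP; split.
    apply/measurable_EFinP; apply: measurable_funD; apply: measurable_funX.
      exact: measurable_cosT.
    exact: measurable_sinT.
  under eq_integral do rewrite /= ger0_norm ?addr_ge0 ?sqr_ge0//.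
  apply: (le_lt_trans (plancherel_le ai)).
  rewrite lte_mul_pinfty// ?lee_fin ?mulr_ge0 ?pi_ge0//.
  have /integrableP[_] := a2; under eq_integral do rewrite /= ger0_norm ?sqr_ge0//.
  done.
have h1 := sq _ L1_heat L1_heat_sqr.
have h2 : L1 (fun x => cosT (heat' \_ `[0, +oo[) x ^+ 2 + sinT (heat' \_ `[0, +oo[) x ^+ 2).
  apply: sq => //; apply: (le_L1 _ _ L1_heat'_sqr).
    by apply: measurable_funX; exact: measurable_restrictT.
  move=> x; rewrite ger0_norm ?sqr_ge0// patchE; case: ifP => // _.
  by rewrite expr0n/= sqr_ge0.
have h3 := L1_poisson 0 (@ltr01 R).
apply: (le_L1 _ _ (L1D (L1D h1 (L1Z 4 h2)) h3)).
  exact: measurable_cosT L1_heat.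
move=> x; rewrite subr0.
have e := mul_cosT_heat x.
set c := cosT heat x in e *; set s' := sinT heat x; set s := sinT _ x in e *; set c' := cosT _ x.
have : (x * c) ^+ 2 = 4 * s ^+ 2 by rewrite e; ring.
rewrite exprMn => e2.
have p : poisson 1 x = 2 / (1 + x ^+ 2) by rewrite /poisson expr1n mulr1.
have x1 : 0 < 1 + x ^+ 2 by rewrite ltr_pwDl ?sqr_ge0.
have am : `|c| <= c ^+ 2 * (1 + x ^+ 2) + 2 / (1 + x ^+ 2).
  rewrite -(real_normK (num_real c)); move: (1 + x ^+ 2) x1 (`|c|) (normr_ge0 c) => q q0 r r0.
  rewrite -(ler_pM2r q0) mulrDl divfK ?gt_eqF//.
  by have := sqr_ge0 (r * q - 1); nra.
apply: (le_trans am); rewrite p lerD2r mulrDr mulr1 (mulrC _ (x ^+ 2)) e2.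
by have := sqr_ge0 s'; have := sqr_ge0 c'; nra.
Qed.

Lemma L1_0 : L1 (fun=> 0).
Proof.
have := L1Z 0 L1_heat; rewrite (_ : (fun x => 0 * heat x) = fun=> 0)//.
by apply/funext => x; rewrite mul0r.
Qed.

Lemma cosT0 x : cosT (fun=> 0) x = 0 :> R.
Proof.
by rewrite /cosT; under eq_Rintegral do rewrite mul0r; rewrite Rintegral_cst// mul0r.
Qed.

Lemma sinT0 x : sinT (fun=> 0) x = 0 :> R.
Proof.
by rewrite /sinT; under eq_Rintegral do rewrite mul0r; rewrite Rintegral_cst// mul0r.
Qed.

Lemma cintegrable_heat : cintegrable (fun xi => (heat xi)%:C).
Proof. by split => /=; [exact: L1_heat|exact: L1_0]. Qed.

Lemma G_heat : G m t = inv_fourier_on setT (fun xi => (heat xi)%:C).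
Proof. by []. Qed.

Lemma GE : G m t = (fun x => ((2 * pi)^-1 * cosT heat x)%:C).
Proof.
rewrite G_heat inv_fourierE; last exact: cintegrable_heat.
apply/funext => x; rewrite /transform /= cosT0 sinT0 sinT_heat mulr0 subr0 addr0.
by rewrite rmorphM.
Qed.

(** [dxM] multiplies the actual Fourier integral of [G m t], so its symbol is known only after
    inversion. This is what the integrability of [cosT heat] is for; the sine parts vanish by
    evenness. *)
Lemma fourier_G : fourier (G m t) = (fun xi => (heat xi)%:C).
Proof.
have ci := L1Z ((2 * pi)^-1) L1_cosT_heat.
have s0 : sinT heat = (fun=> 0) by apply/funext => x; exact: sinT_heat.
have si : L1 (sinT heat) by rewrite s0; exact: L1_0.
have gi : cintegrable (G m t) by rewrite GE; split => //=; exact: L1_0.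
rewrite fourierE// GE; apply/funext => xi; rewrite /transform /=.
rewrite cosT0 sinT0 mulr0 subr0 add0r cosT_scale ?sinT_scale//; try exact: L1_cosT_heat.
have := @inversion_cos _ _ 1 L1_heat continuous_heat (fun x => ltW (heat_gt0 x)) heat_le1
  L1_cosT_heat si xi.
have := inversion_sin L1_heat L1_cosT_heat si xi.
rewrite !s0 cosT0 sinT0 addr0 => <- ->.
rewrite !mulr0; congr (_ +i* _).
by have := pi_gt0 R; move: (pi : R) => p p0; field; rewrite gt_eqF.
Qed.

(** * The derivative of the kernel *)

Lemma L1_xheat : L1 (fun xi => xi * heat xi).
Proof.
have s0 := scale_gt0.
apply: (@le_heat_weight _ scale^-1 1) => //.
- by apply: measurable_funM => //; exact: measurable_heat.
- by rewrite invr_ge0 ltW.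
- move=> x; have h0 := ltW (heat_gt0 x); rewrite normrM (ger0_norm h0) ler_wpM2r//.
  by rewrite expr1 ler_pdivlMl// scale_le.
Qed.

(** Differentiation under the integral near [x], with the majorant |xi| heat(xi), integrable by
    [L1_xheat]. *)
Lemma is_derive_cosT_heat (x : R) :
  is_derive x 1 (cosT heat) (- sinT (fun xi => xi * heat xi) x).
Proof.
pose f (x y : R) := heat y * cos (y * x).
have df (z y : R) : is_derive z 1 (f ^~ y) (heat y * - (y * sin (y * z))).
  exact: is_derive_scale (is_derive_cosM y z).
have pf z y : partial1of2 f z y = heat y * - (y * sin (y * z)).
  by rewrite partial1of2E; have [_ ->] := df z y.
have xI : `]x - 1, x + 1[%classic x by rewrite /= in_itv/= ltrBlDr !ltrDl ltr01.
have fi z : `]x - 1, x + 1[%classic z -> L1 (f z) by move=> _; exact: L1_cos L1_heat.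
have fd (z y : R) : `]x - 1, x + 1[%classic z -> setT y -> derivable (f ^~ y) z 1.
  by move=> _ _; have [] := df z y.
have fb (z y : R) : `]x - 1, x + 1[%classic z -> setT y -> `|partial1of2 f z y| <= `|y * heat y|.
  move=> _ _; rewrite pf mulrN normrN mulrA (mulrC (heat y)) normrM.
  by rewrite ler_piMr// sin_max.
have n0 (y : R) : 0 <= `|y * heat y| by [].
split.
  exact: (@derivable_under_integral R _ _ mu f setT measurableT _ _ _ xI fi fd _ n0
    (L1_norm L1_xheat) fb).
rewrite -derive1E (@differentiation_under_integral R _ _ mu f setT measurableT _ _ _ xI fi fd _ n0
    (L1_norm L1_xheat) fb).
rewrite (_ : \int[mu]_ _ _ = \int[mu]_y (-1 * (y * heat y * sin (y * x)))).
  by rewrite RintegralZl ?mulN1r//; exact: L1_sin L1_xheat.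
by apply: eq_Rintegral => y _; rewrite pf; ring.
Qed.

Lemma cosT_xheat x : cosT (fun xi => xi * heat xi) x = 0.
Proof.
apply: continuous_integral_odd.
- move=> y; apply: cvgM; last exact: continuous_cosMr.
  by apply: cvgM; [exact: cvg_id|exact: continuous_heat].
- exact: L1_cos L1_xheat.
- by move=> y; rewrite heatN !mulNr cosN.
Qed.

Lemma cintegrable_xheat : cintegrable (fun xi => 0 +i* (xi * heat xi)).
Proof. by split => /=; [exact: L1_0|exact: L1_xheat]. Qed.

Lemma realC_mul (c a b : R) : c%:C * (a +i* b) = (c * a) +i* (c * b).
Proof. by apply/eqP; rewrite eq_complex/= !mul0r subr0 addr0 !eqxx. Qed.

(** The classical derivative becomes an inverse transform with symbol i xi, so that it joins the
    other terms on the transform side. *)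
Lemma cderive_G : cderive 1 (G m t) = inv_fourier_on setT (fun xi => 0 +i* (xi * heat xi)).
Proof.
rewrite inv_fourierE; last exact: cintegrable_xheat.
apply/funext => x; rewrite /transform /= cosT0 sinT0 cosT_xheat mulr0 addr0 sub0r mul1r.
have dc := is_derive_scale ((2 * pi)^-1) (is_derive_cosT_heat x).
rewrite realC_mul mulr0 /cderive GE /=; congr (_ +i* _).
  by rewrite derive1E; have [_ ->] := dc.
exact: derive1_cst.
Qed.

End Kernel.

(** * Complex integrals and Taylor remainders of the exponential *)

Section ComplexIntegral.
Local Open Scope classical_set_scope.
Context {R : realType}.
Implicit Types (f g h w : R -> R[i]) (D : set R) (z : R[i]).
Local Notation mu := (@lebesgue_measure R).
Local Notation Re := complex.Re.
Local Notation Im := complex.Im.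
Local Notation normc := Normc.normc.
Local Notation L1 f := (mu.-integrable setT (EFin \o (f : R -> R))).

Lemma norm_Re_normc z : `|Re z| <= normc z.
Proof.
rewrite -(@ler_pXn2r _ 2)// ?nnegrE ?normc_ge0//.
by rewrite real_normK ?num_real// sqr_normc lerDl sqr_ge0.
Qed.

Lemma norm_Im_normc z : `|Im z| <= normc z.
Proof.
rewrite -(@ler_pXn2r _ 2)// ?nnegrE ?normc_ge0//.
by rewrite real_normK ?num_real// sqr_normc lerDr sqr_ge0.
Qed.

Lemma normc_le_ReIm z : normc z <= `|Re z| + `|Im z|.
Proof.
rewrite -(@ler_pXn2r _ 2)// ?nnegrE ?normc_ge0 ?addr_ge0//.
rewrite sqr_normc /sqn -(real_normK (num_real (Re z))) -(real_normK (num_real (Im z))).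
have := normr_ge0 (Re z); have := normr_ge0 (Im z); nra.
Qed.

Lemma cmeasurable_normc f : cmeasurable f -> measurable_fun setT (fun x => normc (f x)).
Proof.
move=> /measurable_sqn mf.
have -> : (fun x => normc (f x)) = (fun x => Num.sqrt (sqn (f x))).
  by apply/funext => x; case: (f x).
apply: measurableT_comp => //; apply: continuous_measurable_fun.
exact: sqrt_continuous.
Qed.

Lemma cintegrable_normc_le f (h : R -> R) : cmeasurable f -> L1 h ->
  (forall x, normc (f x) <= h x) -> cintegrable f.
Proof.
move=> mf hi fh; apply: (cintegrable_le mf hi) => x; apply: le_trans (fh x).
  exact: norm_Re_normc.
exact: norm_Im_normc.
Qed.

(** Real and imaginary parts are estimated separately, whence the factor 2. *)
Lemma normc_cintegral_le f (h : R -> R) : cintegrable f -> L1 h ->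
  (forall x, normc (f x) <= h x) -> normc (cintegral setT f) <= 2 * \int[mu]_x h x.
Proof.
move=> [fr fi] hi fh; rewrite (le_trans (normc_le_ReIm _))//= mulr2n mulrDl mul1r.
apply: lerD; (apply: (le_trans (le_normr_Rintegral _ _)) => //);
  (apply: le_Rintegral => //; first exact: L1_norm) => x _.
  exact: le_trans (norm_Re_normc _) (fh x).
exact: le_trans (norm_Im_normc _) (fh x).
Qed.

Lemma cintegralD f g : cintegrable f -> cintegrable g ->
  cintegral setT (fun x => f x + g x) = cintegral setT f + cintegral setT g.
Proof.
move=> [fr fi] [gr gi]; rewrite /cintegral.
under eq_Rintegral do rewrite ReD.
under [X in _ +i* X = _]eq_Rintegral do rewrite ImD.
by rewrite !RintegralD.
Qed.

Lemma cintegralZ z f : cintegrable f ->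
  cintegral setT (fun x => z * f x) = z * cintegral setT f.
Proof.
move=> [fr fi]; rewrite /cintegral.
under eq_Rintegral do rewrite ReM.
under [X in _ +i* X = _]eq_Rintegral do rewrite ImM.
rewrite RintegralB//; [|exact: L1Z|exact: L1Z].
rewrite RintegralD//; [|exact: L1Z|exact: L1Z].
rewrite !RintegralZl//.
by apply/eqP; rewrite eq_complex ReM ImM /= !eqxx.
Qed.

Lemma cintegrableN f : cintegrable f -> cintegrable (fun x => - f x).
Proof.
move=> fi; have := cintegrableZ (-1) fi; congr cintegrable.
by apply/funext => x; rewrite mulN1r.
Qed.

Lemma cintegralN f : cintegrable f ->
  cintegral setT (fun x => - f x) = - cintegral setT f.
Proof.
move=> fi; rewrite -mulN1r -cintegralZ//.
by congr cintegral; apply/funext => x; rewrite mulN1r.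
Qed.

Lemma normc_cexp (a b : R) : normc (cexp (a +i* b)) = expR a.
Proof.
apply/eqP; rewrite -(@eqrXn2 _ 2)// ?normc_ge0 ?expR_ge0//.
by rewrite sqr_normc /sqn /= !exprMn -mulrDr cos2Dsin2 mulr1.
Qed.

Lemma normc_cexp1 (b : R) : normc (cexp (0 +i* b) - 1) <= 2 * `|b|.
Proof.
rewrite (le_trans (normc_le_ReIm _))// ReD ImD ReN ImN /= expR0 !mul1r subr0.
by rewrite mulr2n mulrDl mul1r lerD ?norm_1Bcos_le ?norm_sin_le.
Qed.

Lemma normc_cexp2 (b : R) : normc (cexp (0 +i* b) - 1 - (0 +i* b)) <= 2 * b ^+ 2.
Proof.
rewrite (le_trans (normc_le_ReIm _))// !(ReD, ImD, ReN, ImN) /= expR0 !mul1r !subr0.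
by rewrite mulr2n mulrDl mul1r lerD ?norm_1Bcos_le_sqr ?norm_sinB_le.
Qed.

Lemma normc_real (a : R) : normc (a%:C) = `|a|.
Proof. by rewrite /Normc.normc /= expr0n/= addr0 sqrtr_sqr. Qed.

Lemma normc_imag (a : R) : normc (0 +i* a) = `|a|.
Proof. by rewrite /Normc.normc /= expr0n/= add0r sqrtr_sqr. Qed.

Lemma cmeasurable_cexp_im (xi : R) : cmeasurable (fun x : R => cexp (0 +i* (- (x * xi)))).
Proof.
have mM : measurable_fun setT (fun x : R => - (x * xi)).
  by apply: measurable_funN; apply: measurable_funM.
split => /=; apply: measurable_funM => //; apply: measurableT_comp => //.
  exact: continuous_measurable_fun (@continuous_cos R).
exact: continuous_measurable_fun (@continuous_sin R).
Qed.

End ComplexIntegral.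

(** * Moments and the expansion of the Fourier transform at the origin *)

Section Moments.
Local Open Scope classical_set_scope.
Context {R : realType}.
Variable v : R -> R[i].
Local Notation mu := (@lebesgue_measure R).
Local Notation normc := Normc.normc.
Local Notation L1 f := (mu.-integrable setT (EFin \o (f : R -> R))).
Hypothesis hv : inL1_weight 2 v.

Definition absmoment (k : nat) : R := \int[mu]_x (`|x| ^+ k * normc (v x)).

Lemma cmeasurable_v : cmeasurable v. Proof. exact: hv.1. Qed.

Lemma L1_weighted k : (k <= 2)%N -> L1 (fun x => `|x| ^+ k * normc (v x)).
Proof.
move=> k2; have mv := cmeasurable_normc cmeasurable_v.
have mabs : measurable_fun setT (fun x : R => `|x|).
  exact: continuous_measurable_fun (@norm_continuous _ R).
have mn : measurable_fun setT (fun x : R => 1 + `|x| ^+ 2).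
  by apply: measurable_funD => //; apply: measurable_funX; exact: mabs.
have i2 : L1 (fun x => (1 + `|x| ^+ 2) * normc (v x)).
  apply/integrableP; split.
    by apply/measurable_EFinP; apply: measurable_funM => //; exact: mn.
  under eq_integral do rewrite /= ger0_norm ?mulr_ge0 ?normc_ge0 ?addr_ge0//.
  exact: hv.2.
apply: (le_L1 _ _ i2).
  by apply: measurable_funM => //; apply: measurable_funX; exact: mabs.
move=> x; rewrite ger0_norm ?mulr_ge0 ?normc_ge0// ler_wpM2r ?normc_ge0//.
have := normr_ge0 x; move: (`|x|) => r r0.
case: k k2 => [|[|[|//]]] _; rewrite ?expr0 ?expr1.
- by rewrite lerDl sqr_ge0.
- by have := sqr_ge0 (r - 1); nra.
- by rewrite lerDr.
Qed.

Lemma absmoment_ge0 k : 0 <= absmoment k.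
Proof. by apply: Rintegral_ge0 => x _; rewrite mulr_ge0 ?normc_ge0. Qed.

Lemma LpNorm1_absx_pow k : (k <= 2)%N ->
  LpNorm 1%:E (absx_pow k v) = (absmoment k)%:E.
Proof.
move=> k2; rewrite /LpNorm Lnorm1 /absmoment /Rintegral fineK; last first.
  exact: integrable_fin_num (L1_weighted k2).
apply: eq_integral => x _; rewrite /= ger0_norm ?normc_ge0//.
by rewrite /absx_pow Normc.normcM normc_real ger0_norm.
Qed.

Lemma LpNorm1_absmoment : LpNorm 1%:E v = (absmoment 0)%:E.
Proof.
rewrite -LpNorm1_absx_pow//; congr LpNorm; apply/funext => x.
by rewrite /absx_pow expr0 mul1r.
Qed.

Lemma cintegrable_weighted k : (k <= 2)%N -> cintegrable (fun x => (x ^+ k)%:C * v x).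
Proof.
move=> k2; apply: cintegrable_normc_le (L1_weighted k2) _.
  by apply: cmeasurableM cmeasurable_v; split => //=.
by move=> x; rewrite Normc.normcM normc_real normrX.
Qed.

Lemma cintegrable_v : cintegrable v.
Proof.
have := cintegrable_weighted (leq0n 2); congr cintegrable.
by apply/funext => x; rewrite expr0 mul1r.
Qed.

Lemma cintegrable_fourier (xi : R) : cintegrable (fun x => cexp (0 +i* (- (x * xi))) * v x).
Proof.
apply: cintegrable_normc_le (L1_weighted (leq0n 2)) _.
  exact/cmeasurableM/cmeasurable_v/cmeasurable_cexp_im.
by move=> x; rewrite Normc.normcM normc_cexp expR0 expr0.
Qed.

Lemma normc_fourier_le (xi : R) : normc (fourier v xi) <= 2 * absmoment 0.
Proof.
apply: normc_cintegral_le (cintegrable_fourier xi) (L1_weighted (leq0n 2)) _ => x.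
by rewrite Normc.normcM normc_cexp expR0 expr0.
Qed.

Lemma moment0E : moment 0 v = cintegral setT v.
Proof.
rewrite /moment expr0 divr1 mul1r; congr cintegral.
by apply/funext => x; rewrite expr0 mul1r.
Qed.

Lemma moment1E : moment 1 v = - cintegral setT (fun x => (x ^+ 1)%:C * v x).
Proof. by rewrite /moment expr1 divr1 rmorphN rmorph1 mulN1r. Qed.

(** The first-order remainder |e^(-i x xi) - 1| <= 2 |x xi| is integrated against [v]; 4 is this 2
    times that of [normc_cintegral_le]. *)
Lemma fourierB_moment0 (xi : R) :
  normc (fourier v xi - moment 0 v) <= 4 * `|xi| * absmoment 1.
Proof.
have -> : fourier v xi - moment 0 v =
    cintegral setT (fun x => (cexp (0 +i* (- (x * xi))) - 1) * v x).
  rewrite moment0E -cintegralN; last exact: cintegrable_v.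
  rewrite /fourier -cintegralD; [|exact: cintegrable_fourier|exact/cintegrableN/cintegrable_v].
  by congr cintegral; apply/funext => x; rewrite mulrBl mul1r.
have le x : normc ((cexp (0 +i* (- (x * xi))) - 1) * v x) <=
    (2 * `|xi|) * (`|x| ^+ 1 * normc (v x)).
  rewrite Normc.normcM mulrA ler_wpM2r ?normc_ge0//.
  by rewrite (le_trans (normc_cexp1 _))// normrN normrM expr1 -mulrA (mulrC `|x|).
have hi := L1Z (2 * `|xi|) (L1_weighted (isT : 1 <= 2)%N).
have := normc_cintegral_le (cintegrable_normc_le _ hi le) hi le.
rewrite RintegralZl//; last exact: L1_weighted.
move=> h; apply: (le_trans (h _)); last by rewrite /absmoment !mulrA -natrM.
apply: cmeasurableM cmeasurable_v; apply: cmeasurableB; first exact: cmeasurable_cexp_im.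
exact: cmeasurable_cst.
Qed.

(** The sign in [moment 1 v] makes its product with i xi the integral of (-i x xi) v, the linear
    Taylor term; what is left is the second-order remainder of the exponential. *)
Lemma fourierB_moment1 (xi : R) :
  normc (fourier v xi - moment 0 v - moment 1 v * (0 +i* xi)) <= 4 * xi ^+ 2 * absmoment 2.
Proof.
have -> : fourier v xi - moment 0 v - moment 1 v * (0 +i* xi) =
    cintegral setT (fun x => (cexp (0 +i* (- (x * xi))) - 1 - (0 +i* (- (x * xi)))) * v x).
  have i1 := cintegrable_weighted (isT : 1 <= 2)%N.
  rewrite moment0E moment1E -cintegralN; last exact: cintegrable_v.
  rewrite mulNr opprK mulrC -cintegralZ//.
  rewrite /fourier -cintegralD; [|exact: cintegrable_fourier|exact/cintegrableN/cintegrable_v].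
  rewrite -cintegralD; last 2 first.
  - apply: cintegrableD; first exact: cintegrable_fourier.
    exact/cintegrableN/cintegrable_v.
  - exact: cintegrableZ.
  congr cintegral; apply/funext => x; rewrite !mulrBl mul1r; congr (_ + _).
  rewrite mulrA -mulNr; congr (_ * _).
  by apply/eqP; rewrite eq_complex/= expr1 !(mul0r, mulr0, subr0, oppr0, addr0, add0r, opprK) mulrC !eqxx.
have le x : normc ((cexp (0 +i* (- (x * xi))) - 1 - (0 +i* (- (x * xi)))) * v x) <=
    (2 * xi ^+ 2) * (`|x| ^+ 2 * normc (v x)).
  rewrite Normc.normcM mulrA ler_wpM2r ?normc_ge0//.
  rewrite (le_trans (normc_cexp2 _))// sqrrN exprMn real_normK ?num_real//.
  by rewrite -mulrA (mulrC (x ^+ 2)).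
have hi := L1Z (2 * xi ^+ 2) (L1_weighted (leqnn 2)).
have := normc_cintegral_le (cintegrable_normc_le _ hi le) hi le.
rewrite RintegralZl//; last exact: L1_weighted.
move=> h; apply: (le_trans (h _)); last by rewrite /absmoment !mulrA -natrM.
apply: cmeasurableM cmeasurable_v; apply: cmeasurableB.
  apply: cmeasurableB; first exact: cmeasurable_cexp_im.
  exact: cmeasurable_cst.
split => //=; apply: measurable_funN; exact: measurable_funM.
Qed.

End Moments.

(** * Comparison of the propagator with the heat symbol at low frequency *)

Section SymbolEstimate.
Local Open Scope classical_set_scope.
Context {R : realType}.
Implicit Types a b x z tau eta : R.

(** With al = a / (1 + a), the exponents differ by t (a - al) <= t a^2, and 1 - e^(-x) <= x. For a
    <= 1 one has al >= a/2, which is why half of the heat exponent survives. *)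
Lemma expR_quotient_diff (t a : R) : 0 <= t -> 0 <= a -> a <= 1 ->
  `|expR (- (t * (a / (1 + a)))) - expR (- (t * a))| <= t * a ^+ 2 * expR (- (t * a / 2)).
Proof.
move=> t0 a0 a1.
have a10 : 0 < 1 + a by rewrite ltr_pwDl.
set al := a / (1 + a).
have ala : al <= a by rewrite /al ler_pdivrMr// ler_peMr// lerDl.
have al2 : a / 2 <= al by rewrite /al ler_wpM2l// lef_pV2 ?posrE//; lra.
have d : a - al <= a ^+ 2.
  have -> : a - al = a ^+ 2 / (1 + a) by rewrite /al; field; rewrite gt_eqF.
  by rewrite ler_pdivrMr// ler_peMr ?sqr_ge0// lerDl.
rewrite ger0_norm; last by rewrite subr_ge0 ler_expR lerN2 ler_wpM2l.
have -> : expR (- (t * al)) - expR (- (t * a)) =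
   expR (- (t * al)) * (1 - expR (- (t * (a - al)))).
  by rewrite mulrBr mulr1 -expRD; congr (_ - expR _); ring.
have h : 1 - expR (- (t * (a - al))) <= t * (a - al).
  by have := @expR_ge1Dx R (- (t * (a - al))); lra.
rewrite mulrC; apply: (@le_trans _ _ (t * (a - al) * expR (- (t * al)))).
  by rewrite ler_wpM2r ?expR_ge0.
apply: ler_pM; rewrite ?mulr_ge0 ?subr_ge0 ?expR_ge0//.
  by rewrite ler_wpM2l.
by rewrite ler_expR lerN2 -mulrA ler_wpM2l.
Qed.

(* Components of exp(-t Phi) - exp(-t a) (1 + i t xi a), at low frequency. *)
Lemma low_freq_re (t a xi : R) : 0 <= t -> 0 <= a -> a <= 1 ->
  `|expR (- (t * (a / (1 + a)))) * cos (t * xi * (a / (1 + a))) - expR (- (t * a))|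
  <= (t * a ^+ 2 + (t * `|xi| * a) ^+ 2) * expR (- (t * a / 2)).
Proof.
move=> t0 a0 a1; have h := expR_quotient_diff t0 a0 a1.
have a10 : 0 < 1 + a by rewrite ltr_pwDl.
set al := a / (1 + a) in h *.
have al0 : 0 <= al by rewrite divr_ge0// ltW.
have ala : al <= a by rewrite /al ler_pdivrMr// ler_peMr// lerDl.
have -> : expR (- (t * al)) * cos (t * xi * al) - expR (- (t * a)) =
   (expR (- (t * al)) - expR (- (t * a))) * cos (t * xi * al) +
   expR (- (t * a)) * (cos (t * xi * al) - 1) by ring.
clearbody al; rewrite (le_trans (ler_normD _ _))// [leRHS]mulrDl; apply: lerD.
  by rewrite normrM (le_trans _ h)// ler_piMr// cos_max.
rewrite normrM ger0_norm ?expR_ge0// mulrC; apply: ler_pM; rewrite ?expR_ge0//.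
  rewrite (le_trans (norm_1Bcos_le_sqr _))// -(real_normK (num_real (_ * al))).
  rewrite lerXn2r ?nnegrE ?mulr_ge0// !normrM (ger0_norm t0) (ger0_norm al0).
  by rewrite ler_wpM2l// mulr_ge0.
by rewrite ler_expR lerN2 ler_pdivrMr// ler_peMr ?mulr_ge0// ler1n.
Qed.

Lemma low_freq_im (t a xi : R) : 0 <= t -> 0 <= a -> a <= 1 -> `|xi| <= 1 ->
  `|expR (- (t * (a / (1 + a)))) * sin (t * xi * (a / (1 + a))) -
    expR (- (t * a)) * (t * xi * a)|
  <= (2 * (t * a ^+ 2) + (t * `|xi| * a) ^+ 2) * expR (- (t * a / 2)).
Proof.
move=> t0 a0 a1 xi1; have h := expR_quotient_diff t0 a0 a1.
have a10 : 0 < 1 + a by rewrite ltr_pwDl.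
set al := a / (1 + a) in h *.
have al0 : 0 <= al by rewrite divr_ge0// ltW.
have ala : al <= a by rewrite /al ler_pdivrMr// ler_peMr// lerDl.
have d : `|al - a| <= a ^+ 2.
  have -> : al - a = - (a ^+ 2 / (1 + a)) by rewrite /al; field; rewrite gt_eqF.
  rewrite normrN ger0_norm ?divr_ge0 ?sqr_ge0 ?(ltW a10)//.
  by rewrite ler_pdivrMr// ler_peMr ?sqr_ge0// lerDl.
clearbody al.
have e2 : expR (- (t * a)) <= expR (- (t * a / 2)).
  by rewrite ler_expR lerN2 ler_pdivrMr// ler_peMr ?mulr_ge0// ler1n.
(* Three errors: al against a in the exponential, the linearised sine, and al against a in the
   linear term. The first and the third cost t a^2 each, the third by |xi| <= 1; hence the
   coefficient 2. *)
have -> : expR (- (t * al)) * sin (t * xi * al) - expR (- (t * a)) * (t * xi * a) =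
   (expR (- (t * al)) - expR (- (t * a))) * sin (t * xi * al) +
   (expR (- (t * a)) * (sin (t * xi * al) - t * xi * al) +
    expR (- (t * a)) * (t * xi * (al - a))) by ring.
have -> : (2 * (t * a ^+ 2) + (t * `|xi| * a) ^+ 2) * expR (- (t * a / 2)) =
  t * a ^+ 2 * expR (- (t * a / 2)) + ((t * `|xi| * a) ^+ 2 * expR (- (t * a / 2)) +
   t * a ^+ 2 * expR (- (t * a / 2))) by ring.
rewrite (le_trans (ler_normD _ _))//; apply: lerD.
  by rewrite normrM (le_trans _ h)// ler_piMr// sin_max.
rewrite (le_trans (ler_normD _ _))//; apply: lerD.
  rewrite normrM ger0_norm ?expR_ge0// mulrC; apply: ler_pM; rewrite ?expR_ge0//.
  rewrite (le_trans (norm_sinB_le _))// -(real_normK (num_real (_ * al))).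
  rewrite lerXn2r ?nnegrE ?mulr_ge0// !normrM (ger0_norm t0) (ger0_norm al0).
  by rewrite ler_wpM2l// mulr_ge0.
rewrite normrM ger0_norm ?expR_ge0// mulrC; apply: ler_pM; rewrite ?expR_ge0//.
rewrite !normrM (ger0_norm t0) -mulrA ler_wpM2l//.
by rewrite -[leRHS]mul1r ler_pM.
Qed.

End SymbolEstimate.

(** * Pointwise bound on the transform of the remainder *)

Section MainEstimate.
Local Open Scope classical_set_scope.
Context {R : realType}.
Variables (B m t : R) (v : R -> R[i]).
Hypotheses (m2 : 2 < m) (t0 : 0 < t).
Hypothesis expR_poly :
  forall z : R, 0 <= z -> (1 + z) ^+ 10 * expR (- (z / 2)) <= B.
Hypotheses (v2 : inL2 v) (hv : inL1_weight 2 v).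
Local Notation mu := (@lebesgue_measure R).
Local Notation normc := Normc.normc.
Local Notation symb := (symb m).
Local Notation heat := (heat m t).
Local Notation s := (scale m t).
Local Notation weight := (weight m t).
Local Notation V := (absmoment v).
Local Notation vh := (fourier v).
Local Notation prop xi := (cexp (- (t%:C * Phi m xi))).

Lemma propE xi : prop xi =
  cexp ((- (t * (symb xi / (1 + symb xi)))) +i* (t * xi * (symb xi / (1 + symb xi)))).
Proof.
have a0 := symb_ge0 m xi.
have a10 : 1 + symb xi != 0 by rewrite gt_eqF// ltr_pwDl.
congr cexp; rewrite /Phi -/(symb xi) -rmorphV ?unitfE// [X in - (_ * X)]mulrC !realC_mul.
by apply/eqP; rewrite eq_complex/=; apply/andP; split; apply/eqP; field.
Qed.

(** The L^1 part of the final bound without its common factor t^(-1/(2m)), where s^-1 = t^(-1/m).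
    The group s^-2 collects the Taylor errors and the quadratic phase error, t^-1 the replacement of
    a / (1 + a) by a, and the exponential the heat terms at high frequency. *)
Definition rate : R := s^-1 ^+ 2 * (V 0 + V 1 + V 2) + t^-1 * (1 + s^-1) * V 0 +
  expR (- (t / 2)) * (1 + s^-1) * V 0.

Definition symbol_error xi : R[i] := prop xi * vh xi - moment 0 v * (heat xi)%:C
  - moment 1 v * (0 +i* (xi * heat xi))
  - t%:C * moment 0 v * ((0 +i* (xi * symb xi)) * (heat xi)%:C).

(* Error on the symbol, second-order and first-order Taylor errors on the
   transform of v. *)
Lemma symbol_errorE xi : symbol_error xi =
  (prop xi - (heat xi)%:C * (1 +i* (t * xi * symb xi))) * vh xi +
  (heat xi)%:C * (vh xi - moment 0 v - moment 1 v * (0 +i* xi)) +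
  (heat xi)%:C * (0 +i* (t * xi * symb xi)) * (vh xi - moment 0 v).
Proof.
rewrite /symbol_error; move: (prop xi) (vh xi) (moment 0 v) (moment 1 v) => [e1 e2] [p q] [a1 a2] [b1 b2].
by apply/eqP; rewrite eq_complex/=; apply/andP; split; apply/eqP; ring.
Qed.

(** The powers of t are extracted here: with z = t |xi|^m and y = t^(1/m) |xi|, the errors t a^2 and
    t |xi| a are t^-1 z^2 and s^-1 y z. The coefficients add those of the real and imaginary
    parts. *)
Lemma low_bracket xi : `|xi| <= 1 ->
  normc (prop xi - (heat xi)%:C * (1 +i* (t * xi * symb xi))) <=
  (3 * (t^-1 * (t * symb xi) ^+ 2) +
   2 * (s^-1 * (s * `|xi|) * (t * symb xi)) ^+ 2) * expR (- (t * symb xi / 2)).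
Proof.
move=> xi1; have a0 := symb_ge0 m xi.
have a1 : symb xi <= 1.
  have := @ge0_ler_powR R m _ `|xi| 1; rewrite powR1; apply; rewrite ?nnegrE//.
  by rewrite ltW// m_gt0.
have hr := low_freq_re xi (ltW t0) a0 a1.
have hi := low_freq_im (ltW t0) a0 a1 xi1.
rewrite propE realC_mul mulr1 (le_trans (normc_le_ReIm _))//=.
rewrite /heat; apply: (le_trans (lerD hr hi)).
rewrite -mulrDl ler_wpM2r ?expR_ge0//.
have -> : s^-1 * (s * `|xi|) = `|xi| by rewrite mulKf// gt_eqF// (scale_gt0 m t0).
have -> : t^-1 * (t * symb xi) ^+ 2 = t * symb xi ^+ 2 by field; rewrite gt_eqF.
by rewrite (mulrC t) -!mulrA le_eqVlt; apply/orP; left; apply/eqP; ring.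
Qed.

Lemma normc_prop xi : normc (prop xi) = expR (- (t * (symb xi / (1 + symb xi)))).
Proof. by rewrite propE normc_cexp. Qed.

Lemma normc_prop_le1 xi : normc (prop xi) <= 1.
Proof.
rewrite normc_prop expR_le1 oppr_le0 mulr_ge0 ?(ltW t0)// divr_ge0 ?symb_ge0//.
by rewrite addr_ge0 ?symb_ge0.
Qed.

(** For |xi| > 1 the propagator is small in t but does not decay in xi, so it keeps the factor
    [vh xi], later controlled in L^2; all other terms carry a decaying profile and use pointwise
    bounds by moments. The exponent 4 is the degree of the worst error (y z)^2, and 12 majorises all
    coefficients that occur. *)
Lemma symbol_error_le xi : normc (symbol_error xi) <=
  12 * rate * (1 + t * symb xi) ^+ 4 * expR (- (t * symb xi / 2))
  + expR (- (t / 2)) * normc (vh xi).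
Proof.
have V0 k := absmoment_ge0 v k.
have a0 := symb_ge0 m xi; have s0 := (scale_gt0 m t0).
have z0 : 0 <= t * symb xi by rewrite mulr_ge0// ltW.
have yz := scale_le m2 t0 xi.
have y0 : 0 <= s * `|xi| by rewrite mulr_ge0// ltW.
have e0 := expR_ge0 (- (t * symb xi / 2)).
have he : heat xi <= expR (- (t * symb xi / 2)).
  by rewrite ler_expR lerN2 ler_pdivrMr// ler_peMr// ler1n.
have h0 := ltW (heat_gt0 m t xi).
have si0 : 0 <= s^-1 by rewrite invr_ge0 ltW.
have ti0 : 0 <= t^-1 by rewrite invr_ge0 ltW.
have et0 := expR_ge0 (- (t / 2)).
have xiE : `|xi| = s^-1 * (s * `|xi|) by rewrite mulKf// gt_eqF.
have xi2 : xi ^+ 2 = s^-1 ^+ 2 * (s * `|xi|) ^+ 2.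
  by rewrite -(real_normK (num_real xi)) {1}xiE exprMn.
have thE : `|t * xi * symb xi| = s^-1 * ((s * `|xi|) * (t * symb xi)).
  rewrite !normrM (ger0_norm (ltW t0)) (ger0_norm a0) {1}xiE; ring.
have V20 := V0 2%N; have V10 := V0 1%N; have V00 := V0 0%N.
have f1 := fourierB_moment1 hv xi; have f0 := fourierB_moment0 hv xi.
have f := normc_fourier_le hv xi.
have lb := @low_bracket xi.
(* Both the scaled frequency and t |xi|^m are at most 1 + t |xi|^m, so one power bounds every
   monomial of degree at most 4. *)
have mono a b : (a + b <= 4)%N ->
    (s * `|xi|) ^+ a * (t * symb xi) ^+ b <= (1 + t * symb xi) ^+ 4.
  move=> ab; apply: (@le_trans _ _ ((1 + t * symb xi) ^+ a * (1 + t * symb xi) ^+ b)).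
    apply: ler_pM; rewrite ?exprn_ge0//; apply: lerXn2r; rewrite ?nnegrE ?addr_ge0//.
    by rewrite lerDr.
  by rewrite -exprD ler_weXn2l// lerDl.
have b2 : normc ((heat xi)%:C * (vh xi - moment 0 v - moment 1 v * (0 +i* xi))) <=
    4 * (s^-1 ^+ 2 * V 2) * (1 + t * symb xi) ^+ 4 * expR (- (t * symb xi / 2)).
  rewrite Normc.normcM normc_real (ger0_norm h0).
  apply: (@le_trans _ _ (expR (- (t * symb xi / 2)) * (4 * xi ^+ 2 * V 2))).
    by apply: ler_pM => //; exact: normc_ge0.
  rewrite mulrC ler_wpM2r// xi2.
  have := mono 2 0 isT; rewrite expr0 mulr1 => mo.
  have -> : 4 * (s^-1 ^+ 2 * (s * `|xi|) ^+ 2) * V 2 = 4 * (s^-1 ^+ 2 * V 2) * (s * `|xi|) ^+ 2 by ring.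
  by rewrite ler_wpM2l// mulr_ge0// mulr_ge0// exprn_ge0.
have b3 : normc ((heat xi)%:C * (0 +i* (t * xi * symb xi)) * (vh xi - moment 0 v)) <=
    4 * (s^-1 ^+ 2 * V 1) * (1 + t * symb xi) ^+ 4 * expR (- (t * symb xi / 2)).
  rewrite !Normc.normcM normc_real normc_imag (ger0_norm h0) thE.
  apply: (@le_trans _ _ (expR (- (t * symb xi / 2)) *
      (s^-1 * ((s * `|xi|) * (t * symb xi))) * (4 * `|xi| * V 1))).
    apply: ler_pM => //; rewrite ?normc_ge0//.
      by rewrite mulr_ge0// mulr_ge0// mulr_ge0.
    by rewrite ler_wpM2r// mulr_ge0// mulr_ge0.
  have mo := mono 2 1 isT.
  have -> : expR (- (t * symb xi / 2)) * (s^-1 * ((s * `|xi|) * (t * symb xi))) * (4 * `|xi| * V 1)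
    = 4 * (s^-1 ^+ 2 * V 1) * ((s * `|xi|) ^+ 2 * (t * symb xi) ^+ 1) * expR (- (t * symb xi / 2)).
    by rewrite {2}xiE; ring.
  by rewrite ler_wpM2r// ler_wpM2l// mulr_ge0// mulr_ge0// exprn_ge0.
have b1 : normc ((prop xi - (heat xi)%:C * (1 +i* (t * xi * symb xi))) * vh xi) <=
    (10 * (s^-1 ^+ 2 * V 0) + 10 * (t^-1 * V 0) + 10 * (expR (- (t / 2)) * (1 + s^-1) * V 0))
     * (1 + t * symb xi) ^+ 4 * expR (- (t * symb xi / 2))
    + expR (- (t / 2)) * normc (vh xi).
  (* Only the symbol error depends on the frequency range; the two Taylor errors above hold for all
     xi. *)
  have [xi1|xi1] := leP `|xi| 1.
    rewrite Normc.normcM; apply: (@le_trans _ _ ((3 * (t^-1 * (t * symb xi) ^+ 2) +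
       2 * (s^-1 * (s * `|xi|) * (t * symb xi)) ^+ 2) * expR (- (t * symb xi / 2)) * (2 * V 0))).
      by apply: ler_pM; rewrite ?normc_ge0//; exact: lb.
    have mo1 := mono 0 2 isT; have mo2 := mono 2 2 isT; rewrite expr0 mul1r in mo1.
    rewrite -[leLHS]addr0; apply: lerD; last by rewrite mulr_ge0// normc_ge0.
    have -> : (3 * (t^-1 * (t * symb xi) ^+ 2) +
       2 * (s^-1 * (s * `|xi|) * (t * symb xi)) ^+ 2) * expR (- (t * symb xi / 2)) * (2 * V 0) =
       (6 * (t^-1 * V 0) * (t * symb xi) ^+ 2 + 4 * (s^-1 ^+ 2 * V 0) *
       ((s * `|xi|) ^+ 2 * (t * symb xi) ^+ 2)) * expR (- (t * symb xi / 2)) by ring.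
    rewrite ler_wpM2r//.
    have c1 : 0 <= t^-1 * V 0 by rewrite mulr_ge0.
    have c2 : 0 <= s^-1 ^+ 2 * V 0 by rewrite mulr_ge0// exprn_ge0.
    have c3 : 0 <= expR (- (t / 2)) * (1 + s^-1) * V 0 by rewrite !mulr_ge0// addr_ge0.
    move: mo1 mo2; set P := (1 + _) ^+ 4; set Q := _ * (t * symb xi) ^+ 2; set Q' := (_ ^+ 2).
    move=> mo1 mo2.
    have P0 : 0 <= P by rewrite exprn_ge0 ?addr_ge0.
    apply: (@le_trans _ _ (6 * (t^-1 * V 0) * P + 4 * (s^-1 ^+ 2 * V 0) * P)).
      by apply: lerD; rewrite ler_wpM2l// mulr_ge0.
    rewrite -mulrDl ler_wpM2r//; lra.
  have a1 : 1 <= symb xi.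
    by rewrite /symb -[leLHS](powRr0 `|xi|) ler_powR ?(ltW xi1)// ltW// m_gt0.
  (* Since |xi|^m >= 1, the real part of [Phi] is at least 1/2. *)
  have pb : normc (prop xi) <= expR (- (t / 2)).
    rewrite normc_prop ler_expR lerN2 ler_wpM2l ?(ltW t0)//.
    by rewrite ler_pdivlMr ?ltr_pwDl//; lra.
  (* Since t <= t |xi|^m, half of the heat exponent yields the decay in t and the other half keeps
     the profile in xi. *)
  have hb : heat xi <= expR (- (t / 2)) * expR (- (t * symb xi / 2)).
    rewrite -expRD ler_expR.
    have h : t <= t * symb xi by rewrite ler_peMr// ltW.
    lra.
  rewrite mulrBl (le_trans (le_normcD _ _))// addrC; apply: lerD; last first.
    by rewrite Normc.normcM ler_wpM2r// normc_ge0.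
  rewrite normcN !Normc.normcM normc_real (ger0_norm h0).
  have n1 : normc (1 +i* (t * xi * symb xi)) <= 1 + s^-1 * ((s * `|xi|) * (t * symb xi)).
    by rewrite (le_trans (normc_le_ReIm _))//= normr1 thE.
  apply: (@le_trans _ _ (expR (- (t / 2)) * expR (- (t * symb xi / 2)) *
    (1 + s^-1 * ((s * `|xi|) * (t * symb xi))) * (2 * V 0))).
    apply: ler_pM => //; rewrite ?mulr_ge0 ?normc_ge0//.
    by apply: ler_pM => //; exact: normc_ge0.
  have mo1 := mono 1 1 isT; have mo2 := mono 0 0 isT; rewrite !expr1 in mo1.
  rewrite !expr0 mulr1 in mo2.
  have -> : expR (- (t / 2)) * expR (- (t * symb xi / 2)) *
    (1 + s^-1 * ((s * `|xi|) * (t * symb xi))) * (2 * V 0) =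
    2 * (expR (- (t / 2)) * (1 + s^-1 * ((s * `|xi|) * (t * symb xi))) * V 0) *
      expR (- (t * symb xi / 2)) by ring.
  rewrite ler_wpM2r//.
  have c1 : 0 <= t^-1 * V 0 by rewrite mulr_ge0.
  have c2 : 0 <= s^-1 ^+ 2 * V 0 by rewrite mulr_ge0// exprn_ge0.
  have c3 : 0 <= expR (- (t / 2)) * (1 + s^-1) * V 0 by rewrite !mulr_ge0// addr_ge0.
  move: mo1 mo2; set P := (1 + _) ^+ 4; set Q := _ * (t * symb xi).
  move=> mo1 mo2.
  have P0 : 0 <= P by rewrite exprn_ge0 ?addr_ge0.
  apply: (@le_trans _ _ (2 * (expR (- (t / 2)) * (1 + s^-1) * V 0) * P)).
    have q : 1 + s^-1 * Q <= (1 + s^-1) * P by rewrite mulrDl mul1r lerD// ler_wpM2l.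
    have -> : 2 * (expR (- (t / 2)) * (1 + s^-1) * V 0) * P =
      2 * (expR (- (t / 2)) * ((1 + s^-1) * P) * V 0) by ring.
    by rewrite ler_wpM2l// ler_wpM2r// ler_wpM2l.
  by rewrite ler_wpM2r//; lra.
rewrite symbol_errorE (le_trans (le_normcD _ _))// (le_trans (lerD (le_normcD _ _) (lexx _)))//.
rewrite (le_trans (lerD (lerD b1 b2) b3))//.
have c1 : 0 <= t^-1 * V 0 by rewrite mulr_ge0.
have c1' : 0 <= t^-1 * s^-1 * V 0 by rewrite !mulr_ge0.
have c3 : 0 <= expR (- (t / 2)) * (1 + s^-1) * V 0 by rewrite !mulr_ge0// addr_ge0.
have d0 : 0 <= s^-1 ^+ 2 * V 0 by rewrite mulr_ge0// exprn_ge0.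
have d1 : 0 <= s^-1 ^+ 2 * V 1 by rewrite mulr_ge0// exprn_ge0.
have d2 : 0 <= s^-1 ^+ 2 * V 2 by rewrite mulr_ge0// exprn_ge0.
rewrite /rate !(mulrDr (s^-1 ^+ 2)).
have -> : t^-1 * (1 + s^-1) * V 0 = t^-1 * V 0 + t^-1 * s^-1 * V 0 by ring.
set P := (1 + _) ^+ 4; set e := expR (- (t * symb xi / 2)).
have Pe0 : 0 <= P * e by rewrite mulr_ge0// exprn_ge0 ?addr_ge0.
set Y := expR (- (t / 2)) * normc _.
rewrite -!(mulrA _ P e).
move: (s^-1 ^+ 2 * V 0) (s^-1 ^+ 2 * V 1) (s^-1 ^+ 2 * V 2) (t^-1 * V 0)
  (t^-1 * s^-1 * V 0) (expR (- (t / 2)) * (1 + s^-1) * V 0) c1 c1' c3 d0 d1 d2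
  => q0 q1 q2 q3 q4 q5 h3 h4 h5 h0' h1 h2.
move: (P * e) Pe0 => w w0.
have := mulr_ge0 h0' w0; have := mulr_ge0 h1 w0; have := mulr_ge0 h2 w0.
have := mulr_ge0 h3 w0; have := mulr_ge0 h4 w0; have := mulr_ge0 h5 w0; lra.
Qed.

(** Squaring by (c + d)^2 <= 2 c^2 + 2 d^2 restores the full heat factor, to which [heat_decay]
    applies: 2 * 12^2 * 2 B = 24^2 B. *)
Lemma sqn_symbol_error_le xi : sqn (symbol_error xi) <=
  B * (24 * rate) ^+ 2 * weight xi + 2 * expR (- t) * sqn (vh xi).
Proof.
have hd := heat_decay m2 t0 expR_poly xi.
have n0 := normc_ge0 (symbol_error xi).
have := symbol_error_le xi; rewrite -!sqr_normc.
set P := 1 + t * symb xi in hd *; set e := expR (- (t * symb xi / 2)).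
have e2 : e ^+ 2 = heat xi by rewrite expr2 -expRD; congr expR; field.
have ->: expR (- t) = expR (- (t / 2)) ^+ 2 by rewrite expr2 -expRD; congr expR; field.
rewrite -e2 in hd.
move: (expR (- (t / 2))) (normc (vh xi)) (normc (symbol_error xi)) n0 => q a b b0 h.
have h1 : b ^+ 2 <= (12 * rate * P ^+ 4 * e + q * a) ^+ 2.
  by rewrite lerXn2r// nnegrE// (le_trans b0 h).
have h2 := sqr_ge0 (12 * rate * P ^+ 4 * e - q * a).
have h3 := ler_wpM2l (_ : 0 <= 2 * (12 * rate) ^+ 2) hd.
have := h3 (mulr_ge0 (ler0n _ 2) (sqr_ge0 _)).
have -> : 2 * (12 * rate) ^+ 2 * (P ^+ 8 * e ^+ 2) = 2 * (12 * rate * P ^+ 4 * e) ^+ 2 by ring.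
have -> : 2 * (12 * rate) ^+ 2 * (2 * B * weight xi) = B * (24 * rate) ^+ 2 * weight xi by ring.
move: (12 * rate * P ^+ 4 * e) h1 h2 => c h1 h2; lra.
Qed.

(** * Square integrability of the symbols and energy of the error *)

Lemma cmeasurable_prop : cmeasurable (fun xi => prop xi).
Proof.
have ms : measurable_fun setT symb by exact: measurable_symb.
have mal : measurable_fun setT (fun xi => symb xi / (1 + symb xi)).
  have cs := continuous_symb m2.
  apply: continuous_measurable_fun => xi; apply: cvgM; first exact: cs.
  apply: cvgV; last by apply: cvgD; [exact: cvg_cst|exact: cs].
  by rewrite gt_eqF// ltr_pwDl// symb_ge0.
have mr : measurable_fun setT (fun xi => expR (- (t * (symb xi / (1 + symb xi))))).
  apply: measurableT_comp => //; apply: measurable_funN; exact: measurable_funM.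
have mi : measurable_fun setT (fun xi => t * xi * (symb xi / (1 + symb xi))).
  by apply: measurable_funM => //; exact: measurable_funM.
split; under eq_fun do rewrite propE /=; apply: measurable_funM => //;
  apply: measurableT_comp => //; apply: continuous_measurable_fun.
  exact: (@continuous_cos R).
exact: (@continuous_sin R).
Qed.

Lemma cmeasurable_fourier : cmeasurable vh.
Proof.
by rewrite fourierE; [apply: cmeasurable_transform|]; exact: cintegrable_v hv.
Qed.

Local Notation n2 := (fine (LpNorm 2%:E v)).

Lemma LpNorm2_fin : LpNorm 2%:E v = n2%:E.
Proof. by rewrite fineK// ge0_fin_numE ?v2.2// Lnorm_ge0. Qed.

Lemma n2_ge0 : 0 <= n2.
Proof. by rewrite fine_ge0// Lnorm_ge0. Qed.

Lemma energy_fourier : (energy vh <= (4 * pi * n2 ^+ 2)%:E)%E.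
Proof.
have ci := cintegrable_v hv.
have h := @energy_transform _ (-1) v; rewrite -fourierE// normrN1 in h.
apply: (le_trans (h erefl ci)); rewrite [leRHS]EFinM lee_wpmul2l//.
  by rewrite lee_fin mulr_ge0// pi_ge0.
by rewrite -LpNorm2_le ?n2_ge0// LpNorm2_fin.
Qed.

Lemma square_integrable_fourier : square_integrable vh.
Proof.
split; first exact: cmeasurable_fourier.
by rewrite (le_lt_trans energy_fourier)// ltry.
Qed.

Lemma square_integrable_le f g : cmeasurable f -> square_integrable g ->
  (forall x : R, sqn (f x) <= sqn (g x)) -> square_integrable f.
Proof.
move=> mf [mg eg] fg; split => //; apply: le_lt_trans eg.
apply: ge0_le_integral => //.
- by move=> x _; rewrite lee_fin sqn_ge0.
- by apply/measurable_EFinP; exact: measurable_sqn.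
- by apply/measurable_EFinP; exact: measurable_sqn.
- by move=> x _; rewrite lee_fin.
Qed.

Lemma square_integrable_prop : square_integrable (fun xi => prop xi * vh xi).
Proof.
apply: (square_integrable_le _ square_integrable_fourier).
  exact: cmeasurableM cmeasurable_prop cmeasurable_fourier.
move=> xi; rewrite sqnM ler_piMl ?sqn_ge0// -sqr_normc.
by rewrite exprn_ile1 ?normc_ge0// normc_prop_le1.
Qed.

(** Squaring doubles [k], and [heat_decay] affords eight powers, whence k <= 4; the second heat
    factor is at most 1. *)
Lemma square_integrable_heat_le h M k : cmeasurable h -> (k <= 4)%N -> 0 <= M ->
  (forall x, normc (h x) <= M * (1 + t * symb x) ^+ k * heat x) -> square_integrable h.
Proof.
move=> mh k4 M0 hM; split => //.
have : mu.-integrable setT (EFin \o (fun x => sqn (h x))).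
  apply: (le_heat_weight m2 t0 expR_poly (M := M ^+ 2) (k := (k * 2)%N)).
  - exact: measurable_sqn.
  - by rewrite (leq_mul k4 (leqnn 2)).
  - exact: sqr_ge0.
  move=> x; rewrite ger0_norm ?sqn_ge0// -sqr_normc.
  have h0 := ltW (heat_gt0 m t x); have h1 := heat_le1 m t0 x.
  have z0 := z_ge0 m t0 x.
  have P0 : 0 <= M * (1 + t * symb x) ^+ k by rewrite mulr_ge0// exprn_ge0// addr_ge0.
  have := hM x; rewrite exprM -exprMn; move: (M * _) P0 => c c0 hc.
  apply: (@le_trans _ _ ((c * heat x) ^+ 2)).
    by rewrite lerXn2r ?nnegrE ?normc_ge0// mulr_ge0.
  by rewrite exprMn ler_wpM2l ?sqr_ge0// expr2 ler_piMr.
move=> /integrableP[_]; under eq_integral do rewrite /= ger0_norm ?sqn_ge0//.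
done.
Qed.

Lemma cmeasurable_real (f : R -> R) : measurable_fun setT f -> cmeasurable (fun x => (f x)%:C).
Proof. by split => //=. Qed.

Lemma cmeasurable_imag (f : R -> R) : measurable_fun setT f ->
  cmeasurable (fun x => 0 +i* (f x)).
Proof. by split => //=. Qed.

Lemma square_integrable_heat : square_integrable (fun xi => (heat xi)%:C).
Proof.
apply: (@square_integrable_heat_le _ 1 0) => //.
  by apply: cmeasurable_real; exact: measurable_heat.
by move=> x; rewrite normc_real expr0 !mul1r ger0_norm// ltW// heat_gt0.
Qed.

Lemma square_integrable_xheat : square_integrable (fun xi => 0 +i* (xi * heat xi)).
Proof.
apply: (@square_integrable_heat_le _ s^-1 1) => //.
- by apply: cmeasurable_imag; apply: measurable_funM => //; exact: measurable_heat.
- by rewrite invr_ge0 ltW// (scale_gt0 m t0).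
- move=> x; have h0 := ltW (heat_gt0 m t x).
  rewrite normc_imag normrM (ger0_norm h0) ler_wpM2r//.
  by rewrite expr1 ler_pdivlMl ?(scale_gt0 m t0)// scale_le.
Qed.

Lemma square_integrable_xsymb_heat :
  square_integrable (fun xi => (0 +i* (xi * symb xi)) * (heat xi)%:C).
Proof.
have s0 := (scale_gt0 m t0).
apply: (@square_integrable_heat_le _ (s^-1 * t^-1) 2) => //.
- apply: cmeasurableM.
    by apply: cmeasurable_imag; apply: measurable_funM => //; exact: measurable_symb.
  by apply: cmeasurable_real; exact: measurable_heat.
- by rewrite mulr_ge0// invr_ge0 ltW.
- move=> x; have h0 := ltW (heat_gt0 m t x); have a0 := symb_ge0 m x.
  rewrite Normc.normcM normc_imag normc_real (ger0_norm h0) ler_wpM2r//.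
  rewrite normrM (ger0_norm a0).
  have -> : `|x| * symb x = s^-1 * t^-1 * ((s * `|x|) * (t * symb x)).
    by move: (`|x|) => y; field; rewrite !gt_eqF.
  rewrite ler_wpM2l//; first by rewrite mulr_ge0// invr_ge0 ltW.
  rewrite expr2; apply: ler_pM.
  - by rewrite mulr_ge0// ltW.
  - by rewrite mulr_ge0// ltW.
  - exact: scale_le.
  - by rewrite lerDr.
Qed.

Lemma cmeasurable_symbol_error : cmeasurable symbol_error.
Proof.
have [p _] := square_integrable_prop; have [h0 _] := square_integrable_heat.
have [h1 _] := square_integrable_xheat; have [h2 _] := square_integrable_xsymb_heat.
have cM z (f : R -> R[i]) : cmeasurable f -> cmeasurable (fun x => z * f x).
  by move=> ?; apply: cmeasurableM => //; exact: cmeasurable_cst.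
exact: cmeasurableB (cmeasurableB (cmeasurableB p (cM _ _ h0)) (cM _ _ h1)) (cM _ _ h2).
Qed.

Lemma energy_symbol_error :
  (energy symbol_error <= (B * (24 * rate) ^+ 2 * (pi / s) + 2 * expR (- t) * (4 * pi * n2 ^+ 2))%:E)%E.
Proof.
have c0 : 0 <= B * (24 * rate) ^+ 2 by rewrite mulr_ge0 ?sqr_ge0 ?(B_ge0 expR_poly).
have e0 : 0 <= 2 * expR (- t) by rewrite mulr_ge0 ?expR_ge0.
apply: (@le_trans _ _ (\int[mu]_x
   ((B * (24 * rate) ^+ 2)%:E * (weight x)%:E + (2 * expR (- t))%:E * (sqn (vh x))%:E))%E).
  apply: ge0_le_integral => //.
  - by move=> x _; rewrite lee_fin sqn_ge0.
  - by apply/measurable_EFinP; apply: measurable_sqn; exact: cmeasurable_symbol_error.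
  - apply/measurable_EFinP; apply: measurable_funD; apply: measurable_funM => //.
      exact: integrable_measurable (L1_weight m t0).
    by apply: measurable_sqn; exact: cmeasurable_fourier.
  - by move=> x _; rewrite -!EFinM -EFinD lee_fin sqn_symbol_error_le.
have mw : measurable_fun setT (EFin \o weight).
  exact: measurable_int (L1_weight m t0).
have mh : measurable_fun setT (fun x => (sqn (vh x))%:E).
  by apply/measurable_EFinP; apply: measurable_sqn; exact: cmeasurable_fourier.
rewrite ge0_integralD//; last 4 first.
- by move=> x _; rewrite mule_ge0// lee_fin ?weight_ge0.
- exact: measurable_funeM.
- by move=> x _; rewrite mule_ge0// lee_fin ?sqn_ge0.
- exact: measurable_funeM.
rewrite ge0_integralZl//; [|by move=> x _; rewrite lee_fin weight_ge0].
rewrite ge0_integralZl//; [|by move=> x _; rewrite lee_fin sqn_ge0].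
rewrite integral_weight// EFinD; apply: leeD; first by rewrite EFinM.
by rewrite [leRHS]EFinM lee_wpmul2l// energy_fourier.
Qed.

(** * The remainder in physical space *)

Local Notation remainder := (fun x : R =>
  solution_op m t v x - \sum_(0 <= a < 2) moment a v * cderive a (G m t) x
  - t%:C * moment 0 v * dxM m (G m t) x).

(** Linearity of the L^2 inverse transform. The multiplier terms enter as chosen limits, [G] and its
    derivative as absolutely convergent integrals; being an L^2 limit is all that is asked of a
    representative. *)
Lemma l2_inv_fourier_remainder : l2_inv_fourier symbol_error remainder.
Proof.
have sp := square_integrable_prop; have sh := square_integrable_heat.
have sx := square_integrable_xheat; have sy := square_integrable_xsymb_heat.
have ip := is_inv_fourier2_inv_fourier2 sp; have iy := is_inv_fourier2_inv_fourier2 sy.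
have ih := l2_inv_fourier_integrable sh (cintegrable_heat m2 t0 expR_poly).
have ix := l2_inv_fourier_integrable sx (cintegrable_xheat m2 t0 expR_poly).
have := l2_inv_fourierD (square_integrableD (square_integrableD sp
    (square_integrableZ (- moment 0 v) sh)) (square_integrableZ (- moment 1 v) sx))
  (square_integrableZ (- (t%:C * moment 0 v)) sy)
  (l2_inv_fourierD (square_integrableD sp (square_integrableZ (- moment 0 v) sh))
    (square_integrableZ (- moment 1 v) sx)
    (l2_inv_fourierD sp (square_integrableZ (- moment 0 v) sh) ip
      (l2_inv_fourierZ (- moment 0 v) sh ih))
    (l2_inv_fourierZ (- moment 1 v) sx ix))
  (l2_inv_fourierZ (- (t%:C * moment 0 v)) sy iy).
set gd := (fun x => _ + _ * ((0 +i* _) * _)); set w := (fun x => _ + _ * inv_fourier2 _ x).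
have -> : gd = symbol_error by apply/funext => x; rewrite /gd /symbol_error !mulNr.
have -> // : w = remainder.
apply/funext => x; rewrite /w.
rewrite big_nat_recr//= big_nat1 (cderive_G m2 t0 expR_poly) /dxM /fourier_multiplier.
rewrite (fourier_G m2 t0 expR_poly) -(G_heat m t) /solution_op /fourier_multiplier !mulNr opprD addrA.
congr (_ - _ * _ - _ - _).
Qed.

Lemma energy_remainder : (energy remainder <=
  (2 * B * (24 * rate) ^+ 2 * (pi / s) + 16 * pi * (expR (- (t / 2)) * n2) ^+ 2)%:E)%E.
Proof.
have sd : square_integrable symbol_error.
  by split; [exact: cmeasurable_symbol_error|exact: le_lt_trans energy_symbol_error (ltry _)].
apply: (le_trans (l2_inv_fourier_energy sd l2_inv_fourier_remainder)).
apply: (le_trans (lee_wpmul2l _ energy_symbol_error)); first by rewrite lee_fin.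
rewrite -EFinM lee_fin.
have -> : expR (- t) = expR (- (t / 2)) ^+ 2 by rewrite expr2 -expRD; congr expR; field.
by move: (pi : R) => p; rewrite le_eqVlt; apply/orP; left; apply/eqP; ring.
Qed.

Lemma LpNorm2_remainder_le : (LpNorm 2%:E remainder <=
  (24 * (2 * B * pi + pi + 1) * (t `^ (- (2 * m)^-1) * rate + expR (- (t / 2)) * n2))%:E)%E.
Proof.
have B0 := B_ge0 expR_poly; have p0 := pi_ge0 R.
have rate0 : 0 <= rate.
  have V0 k := absmoment_ge0 v k.
  have si0 : 0 <= s^-1 by rewrite invr_ge0 ltW// (scale_gt0 m t0).
  have ti0 : 0 <= t^-1 by rewrite invr_ge0 ltW.
  by rewrite /rate !addr_ge0// !mulr_ge0 ?expR_ge0 ?sqr_ge0 ?addr_ge0 ?V0.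
have u0 : 0 <= t `^ (- (2 * m)^-1) * rate by rewrite mulr_ge0// powR_ge0.
have w0 : 0 <= expR (- (t / 2)) * n2 by rewrite mulr_ge0 ?expR_ge0 ?n2_ge0.
(* The integral of [weight] is proportional to s^-1, and its square root is the factor t^(-1/(2m))
   in the norm. *)
have sE : s^-1 = (t `^ (- (2 * m)^-1)) ^+ 2.
  rewrite -powR_mulrn ?powR_ge0// -powRrM /scale -powRN; congr (_ `^ _).
  by field; rewrite gt_eqF// (m_gt0 m2).
have := energy_remainder; rewrite sE.
move: (remainder) => f.
move: (pi : R) p0 => p p0.
move: (t `^ _) (expR _ * _) u0 w0 => q w u0 w0.
have -> : 2 * B * (24 * rate) ^+ 2 * (p * q ^+ 2) + 16 * p * w ^+ 2 =
  2 * B * p * (24 * (q * rate)) ^+ 2 + p * (4 * w) ^+ 2 by ring.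
have : 0 <= 2 * B * p by rewrite mulr_ge0// mulr_ge0.
move: (q * rate) (2 * B * p) u0 => u a u0 a0 hf.
(* The summand 1 makes the constant at least 1, hence at most its square, so it may be squared
   together with the bound; 24 covers both coefficients 24 and 4. *)
have c1 : 1 <= a + p + 1 by rewrite lerDr addr_ge0.
have c0 : 0 <= a + p + 1 by rewrite (le_trans ler01).
rewrite LpNorm2_le; last first.
  by rewrite (mulr_ge0 (mulr_ge0 (ler0n _ 24) c0)) ?addr_ge0.
apply: (le_trans hf); rewrite lee_fin.
have -> : 24 * (a + p + 1) * (u + w) = (a + p + 1) * (24 * (u + w)) by ring.
set y := 24 * (u + w); rewrite [leRHS]exprMn.
have uw : (24 * u) ^+ 2 <= y ^+ 2 by apply: lerXn2r; rewrite ?nnegrE /y; lra.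
have wu : (4 * w) ^+ 2 <= y ^+ 2 by apply: lerXn2r; rewrite ?nnegrE /y; lra.
have yy := sqr_ge0 y.
apply: (@le_trans _ _ ((a + p + 1) * y ^+ 2)).
  by have := ler_wpM2l a0 uw; have := ler_wpM2l p0 wu; lra.
by rewrite ler_wpM2r// expr2 ler_peMr.
Qed.

End MainEstimate.

Theorem theorem2p2 (R : realType) (n : nat) (delta m : R)
    (hn : (1 < n)%N) (hdelta0 : 0 < delta) (hdelta1 : delta < 1)
    (hm : m = n%:R + delta) :
  exists C : R, 0 < C /\
    forall (t : R) (v0 : R -> R[i]), 0 < t -> inL2 v0 -> inL1_weight 2 v0 ->
    (LpNorm 2%:E (fun x : R =>
       (solution_op m t v0 x
        - \sum_(0 <= a < 2) moment a v0 * cderive a (G m t) x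
        - t%:C * moment 0 v0 * dxM m (G m t) x)%R)
     <= C%:E *
        ((t `^ (- (2 / m) - (2 * m)^-1))%:E * LpNorm 1%:E v0
         + (t `^ (- (2 / m) - (2 * m)^-1))%:E
             * \sum_(1 <= r < 3) LpNorm 1%:E (absx_pow r v0)
         + (t `^ (- 1 - (2 * m)^-1)
              * \sum_(0 <= r < 2) t `^ (- (r%:R / m)) / r`!%:R)%:E
             * LpNorm 1%:E v0
         + (expR (- (t / 2)))%:E * LpNorm 2%:E v0
         + (expR (- (t / 2)) * t `^ (- (2 * m)^-1)
              * \sum_(0 <= r < 2) t `^ (- (r%:R / m)) / r`!%:R)%:E
             * LpNorm 1%:E v0
         + (Normc.normc (moment 0 v0) * t `^ (- (2 / m) - (2 * m)^-1))%:E
             * LpNorm 1%:E (absx_pow 1 (K m))))%E.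
Proof.
(* The lemma produces the exponent n + 1, so 9 yields the power 10 of the kernel estimates. *)
have [B B0 expR_poly] := @expR_poly_le R 9.
have m2 : 2 < m.
  have : (2 : R) <= n%:R by rewrite (ler_nat _ 2).
  by rewrite hm; lra.
have p0 := pi_ge0 R.
have C0 : 0 < 24 * (2 * B * pi + pi + 1) :> R.
  by rewrite mulr_gt0// ltr_wpDl// addr_ge0// mulr_ge0// mulr_ge0// ltW.
exists (24 * (2 * B * pi + pi + 1)); split => // t v t0 v2 hv.
apply: (le_trans (LpNorm2_remainder_le m2 t0 expR_poly v2 hv)).
rewrite EFinM lee_wpmul2l ?lee_fin ?(ltW C0)//.
(* The summand with [K m] is nonnegative and enlarges the right-hand side; the other five are
   matched with [rate] and the L^2 term exactly. *)
apply: (le_trans _ (leeDl _ _)); last first.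
  by apply: mule_ge0; [rewrite lee_fin mulr_ge0 ?normc_ge0 ?powR_ge0|exact: Lnorm_ge0].
have -> : \sum_(1 <= r < 3) LpNorm 1%:E (absx_pow r v) = (absmoment v 1 + absmoment v 2)%:E.
  by rewrite big_ltn// big_nat1 !(LpNorm1_absx_pow hv).
rewrite (LpNorm1_absmoment hv); have := LpNorm2_fin v2; move: (fine _) => n2 ->.
rewrite big_ltn// big_nat1.
rewrite -!(EFinM, EFinD) lee_fin.
have t1 : t != 0 by rewrite gt_eqF.
have m0 : m != 0 by rewrite gt_eqF// (lt_trans _ m2).
have si : t `^ (- m^-1) = (scale m t)^-1 by rewrite powRN.
have -> : t `^ (- (2 / m) - (2 * m)^-1) =
    (scale m t)^-1 ^+ 2 * t `^ (- (2 * m)^-1).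
  rewrite powRD ?t1 ?implybT//; congr (_ * _).
  by rewrite -si -powR_mulrn ?powR_ge0// -powRrM; congr (_ `^ _); ring.
have -> : t `^ (- 1 - (2 * m)^-1) = t^-1 * t `^ (- (2 * m)^-1).
  by rewrite powRD ?t1 ?implybT// powR_inv1// ltW.
rewrite mul0r oppr0 powRr0 divr1 mul1r si divr1 /rate.
by rewrite le_eqVlt; apply/orP; left; apply/eqP; ring.
Qed.
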